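(* Let $\mu\in M_{ad}(\mathbb{R}^d)$, let $K\subset\mathbb{C}$ be a compact set, and let $h$ be a complex-valued function that is real-analytic on an open neighborhood of $K$. Then there is a measure $\nu\in M_{ad}(\mathbb{R}^d)$ such that $\hat\nu(y)=h(\hat\mu(y))$ for every $y\in\mathbb{R}^d$ for which $\hat\mu(y)\in K$.
   Context: $M(\mathbb{R}^d)$ is the set of complex Borel measures on $\mathbb{R}^d$ with finite total variation. $M_{ad}(\mathbb{R}^d)$ is the set of those $\mu\in M(\mathbb{R}^d)$ containing only pure point and absolutely continuous (with respect to Lebesgue measure) components, i.e. $\mu=f\,dx+\sum_n a_n\delta_{\gamma_n}$ with $f\in L^1(\mathbb{R}^d)$, $\gamma_n\in\mathbb{R}^d$ (countably many), $\sum_n|a_n|<\infty$, where $\delta_s$ is the unit mass at $s$. The Fourier transform of $\mu\in M(\mathbb{R}^d)$ is $\hat\mu(y)=\int_{\mathbb{R}^d}e^{-2\pi i\langle x,y\rangle}\mu(dx)$, $y\in\mathbb{R}^d$, where $\langle x,y\rangle$ is the scalar product. A complex-valued function $h$ on an open set $V\subset\mathbb{C}$ is real-analytic on $V$ if for every $z\in V$ there are $r_z>0$ and coefficients $c_{k,n}\in\mathbb{C}$ such that $h(\xi+i\eta)=\sum_{k,n=0}^\infty c_{k,n}(\xi-\operatorname{Re}z)^k(\eta-\operatorname{Im}z)^n$, the series converging for all real $\xi,\eta$ with $|\xi-\operatorname{Re}z|^2+|\eta-\operatorname{Im}z|^2<r_z^2$. *)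

(* Defs.v *)
From HB Require Import structures.
From mathcomp Require Import all_boot all_order all_algebra finmap.
From mathcomp Require Import complex.
From mathcomp Require Import all_classical all_reals all_analysis.
From mathcomp.analysis Require Import summability.

Set Implicit Arguments.
Unset Strict Implicit.
Unset Printing Implicit Defensive.

Import Order.TTheory GRing.Theory Num.Theory.
Import numFieldNormedType.Exports.

Local Open Scope classical_set_scope.
Local Open Scope ring_scope.
Local Open Scope complex_scope.

(* R^d is the type [d.-tuple R].  Its sigma-algebra is generated by the
   coordinate projections, that is, it is the Borel sigma-algebra of R^d.

   The topology of the complex plane is that of the regular module R[i]^o
   (which is R[i] itself, with the topology of the modulus). *)

Section lebesgue_measure_on_tuples.
Context {R : realType}.

(* The library states [lebesgue_measure] on [measurableTypeR R], whose measure
   display differs from that of the canonical measurable structure of R, which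
   has the same measurable sets. *)
Definition lebesgue_line : set R -> \bar R := @lebesgue_measure R.

Let lebesgue_line0 : lebesgue_line set0 = 0%E.
Proof. exact: (@measure0 _ _ _ (@lebesgue_measure R)). Qed.

Let lebesgue_line_ge0 A : (0 <= lebesgue_line A)%E.
Proof. exact: (@measure_ge0 _ _ _ (@lebesgue_measure R)). Qed.

Let lebesgue_line_sigma_additive : semi_sigma_additive lebesgue_line.
Proof. exact: (@measure_semi_sigma_additive _ _ _ (@lebesgue_measure R)). Qed.

HB.instance Definition _ := isMeasure.Build _ _ _ lebesgue_line
  lebesgue_line0 lebesgue_line_ge0 lebesgue_line_sigma_additive.

Let lebesgue_line_sigma_finite : sigma_finite setT lebesgue_line.
Proof. exact: (@sigma_finiteT _ _ _ (@lebesgue_measure R)). Qed.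

HB.instance Definition _ := Measure_isSigmaFinite.Build _ _ _ lebesgue_line
  lebesgue_line_sigma_finite.

Definition cons_pair n (p : R * n.-tuple R) : n.+1.-tuple R :=
  [tuple of p.1 :: p.2].

Lemma measurable_cons_pair n : measurable_fun setT (@cons_pair n).
Proof. exact: measurable_cons. Qed.

Section step.
Variables (n : nat) (m : {sigma_finite_measure set (n.-tuple R) -> \bar R}).

Definition lebesgue_prod : set (n.+1.-tuple R) -> \bar R :=
  pushforward (lebesgue_line \x m)%E (@cons_pair n).

Let mcons A : measurable A -> measurable (@cons_pair n @^-1` A).
Proof. by move=> mA; rewrite -[X in measurable X]setTI; exact: measurable_cons_pair. Qed.

Let lebesgue_prod0 : lebesgue_prod set0 = 0%E.
Proof. by rewrite /lebesgue_prod /pushforward preimage_set0 measure0. Qed.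

Let lebesgue_prod_ge0 A : (0 <= lebesgue_prod A)%E.
Proof. by rewrite /lebesgue_prod /pushforward measure_ge0. Qed.

Let lebesgue_prod_sigma_additive : semi_sigma_additive lebesgue_prod.
Proof.
move=> F mF tF mUF; rewrite /lebesgue_prod /pushforward preimage_bigcup.
apply: measure_semi_sigma_additive.
- by move=> k; exact: mcons.
- apply/trivIsetP => /= i j _ _ ij; rewrite -preimage_setI.
  by move/trivIsetP : tF => /(_ _ _ _ _ ij) ->//; rewrite preimage_set0.
- by rewrite -preimage_bigcup; exact: mcons.
Qed.

HB.instance Definition _ := isMeasure.Build _ _ _ lebesgue_prod
  lebesgue_prod0 lebesgue_prod_ge0 lebesgue_prod_sigma_additive.

Let lebesgue_prod_sigma_finite : sigma_finite setT lebesgue_prod.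
Proof.
have /sigma_finiteP[F [FT ndF Foo]] := sigma_finiteT lebesgue_line.
have /sigma_finiteP[G [GT ndG Goo]] := sigma_finiteT m.
pose uncons (t : n.+1.-tuple R) := (thead t, [tuple of behead t]).
have uncons_cons p : uncons (cons_pair p) = p.
  by case: p => x t; rewrite /uncons theadE; congr pair; exact/val_inj.
have muncons : measurable_fun setT uncons.
  apply: measurable_fun_pair; last exact: measurable_behead.
  exact: measurable_tnth.
exists (fun k => uncons @^-1` (F k `*` G k)).
  rewrite -preimage_bigcup; apply/esym/seteqP; split=> // t _ /=.
  have : [set: R] (thead t) by [].
  have : [set: n.-tuple R] [tuple of behead t] by [].
  rewrite FT GT => -[j _ Gj] [i _ Fi]; exists (maxn i j) => //; split => /=.
  - by move: Fi; exact/subsetPset/ndF/leq_maxl.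
  - by move: Gj; exact/subsetPset/ndG/leq_maxr.
move=> k; have [mF Fk] := Foo k; have [mG Gk] := Goo k; split.
  by rewrite -[X in measurable X]setTI; apply: muncons => //; exact: measurableX.
rewrite /lebesgue_prod /pushforward (_ : _ @^-1` _ = F k `*` G k); last first.
  by apply/funext => p; rewrite /preimage /mkset uncons_cons.
by rewrite product_measure1E// lte_mul_pinfty// ge0_fin_numE.
Qed.

HB.instance Definition _ := Measure_isSigmaFinite.Build _ _ _ lebesgue_prod
  lebesgue_prod_sigma_finite.

End step.

Fixpoint lebesgue_tuple (n : nat) :
    {sigma_finite_measure set (n.-tuple R) -> \bar R} :=
  if n is k.+1 then lebesgue_prod (lebesgue_tuple k) else \d_[tuple].

Lemma lebesgue_tuple_box n (B : 'I_n -> set R) :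
  (forall i, measurable (B i)) ->
  lebesgue_tuple n [set t | forall i, B i (tnth t i)] =
  (\prod_(i < n) lebesgue_measure (B i))%E.
Proof.
elim: n B => [|n IHn] B mB.
  rewrite big_ord0 /= diracE mem_set// => -[]//.
rewrite big_ord_recl /= /lebesgue_prod /pushforward.
rewrite (_ : _ @^-1` _ = B ord0 `*`
    [set t : n.-tuple R | forall i, B (lift ord0 i) (tnth t i)]); last first.
  apply/seteqP; split => [[x t]/= Bt|[x t]/= [Bx Bt] i].
    split; first by have := Bt ord0; rewrite tnth0.
    by move=> i; have := Bt (lift ord0 i); rewrite tnthS.
  by have [j ->|->] := unliftP ord0 i; rewrite ?tnthS ?tnth0.
rewrite product_measure1E//.
  by congr mule; exact: (IHn (fun i => B (lift ord0 i))).
rewrite (_ : mkset _ = \bigcap_(i in [set: 'I_n])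
    ((@tnth _ R)^~ i @^-1` B (lift ord0 i))); last first.
  by apply/seteqP; split => t /= Bt i => [_|]; exact: Bt.
apply: fin_bigcap_measurable => [|i _]; first exact: finite_finset.
by rewrite -[X in measurable X]setTI; exact: measurable_tnth.
Qed.

Definition scalar_product d (x y : d.-tuple R) : R :=
  \sum_(i < d) tnth x i * tnth y i.

End lebesgue_measure_on_tuples.

(* A complex measure is a charge with values in R[i]: it takes finite values
   and is countably additive, so that its total variation is finite. *)
Section real_and_imaginary_parts.
Context {R : realType} {disp : measure_display} {T : measurableType disp}.
Variable mu : {charge set T -> \bar R[i]}.

Definition re_charge (A : set T) : \bar R := (complex.Re (fine (mu A)))%:E.
Definition im_charge (A : set T) : \bar R := (complex.Im (fine (mu A)))%:E.

Let part_sigma_additive (p : R[i] -> R) :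
  p 0 = 0 -> {morph p : x y / x + y} -> (forall z, `|p z|%:C <= `|z|) ->
  semi_sigma_additive (fun A => (p (fine (mu A)))%:E).
Proof.
move=> p0 pD pn F mF tF mUF.
have pS n : (\sum_(0 <= i < n) (p (fine (mu (F i))))%:E)%E =
    (p (fine (\sum_(0 <= i < n) mu (F i))%E))%:E.
  rewrite sumEFin -sum_fine; last by move=> i _; exact: fin_num_measure.
  by rewrite (big_morph p pD p0).
under eq_fun do rewrite pS.
apply: cvg_EFin; first by near=> n.
have /fine_cvgP[_ mucvg] : (\sum_(0 <= i < n) mu (F i))%E @[n --> \oo] -->
    (fine (mu (\bigcup_n F n)))%:E.
  by rewrite fineK ?fin_num_measure//; exact: charge_semi_sigma_additive.
apply/cvgrPdist_lt => e e0.
have e0C : 0 < e%:C :> R[i] by rewrite ltcR.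
have pB x y : p (x - y) = p x - p y.
  by apply/eqP; rewrite -subr_eq opprK -pD subrK.
move/(@cvgrPdist_lt _ R[i]^o) : mucvg => /(_ _ e0C).
apply: filterS => n /= mun; rewrite -pB -ltcR.
exact: le_lt_trans (pn _) mun.
Unshelve. all: by end_near. Qed.

Let re_charge0 : re_charge set0 = 0%E.
Proof. by rewrite /re_charge charge0. Qed.

Let re_charge_finite A : measurable A -> re_charge A \is a fin_num.
Proof. by []. Qed.

Let re_charge_sigma_additive : semi_sigma_additive re_charge.
Proof. by apply: part_sigma_additive => //; [case=> a b [c d]|exact: normc_ge_Re]. Qed.

HB.instance Definition _ := isCharge.Build _ _ _ re_charge
  re_charge0 re_charge_finite re_charge_sigma_additive.

Let im_charge0 : im_charge set0 = 0%E.
Proof. by rewrite /im_charge charge0. Qed.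

Let im_charge_finite A : measurable A -> im_charge A \is a fin_num.
Proof. by []. Qed.

Let im_charge_sigma_additive : semi_sigma_additive im_charge.
Proof.
apply: part_sigma_additive => //; first by case=> a b [c d].
move=> z; rewrite normc_def lecR -[leLHS]sqrtr_sqr ler_wsqrtr// lerDr.
exact: sqr_ge0.
Qed.

HB.instance Definition _ := isCharge.Build _ _ _ im_charge
  im_charge0 im_charge_finite im_charge_sigma_additive.

End real_and_imaginary_parts.

Section complex_integrals.
Context {R : realType} {disp : measure_display} {T : measurableType disp}.

Definition complex_integral (m : {measure set T -> \bar R}) (A : set T)
    (f : T -> R[i]) : R[i] :=
  (\int[m]_(x in A) complex.Re (f x)) +i* (\int[m]_(x in A) complex.Im (f x)).

Definition complex_integrable (m : {measure set T -> \bar R}) (f : T -> R[i]) :=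
  m.-integrable setT (fun x => (complex.Re (f x))%:E) /\
  m.-integrable setT (fun x => (complex.Im (f x))%:E).

Section real_charge.
Variable nu : {charge set T -> \bar R}.

Definition hahn_pos : set T := sval (cid (Hahn_decomposition nu)).
Definition hahn_neg : set T := sval (cid (svalP (cid (Hahn_decomposition nu)))).

Lemma hahn_posneg : hahn_decomposition nu hahn_pos hahn_neg.
Proof. exact: svalP (cid (svalP (cid (Hahn_decomposition nu)))). Qed.

Definition charge_integral (f : T -> R[i]) : R[i] :=
  complex_integral (jordan_pos hahn_posneg) setT f -
  complex_integral (jordan_neg hahn_posneg) setT f.

End real_charge.

Definition complex_charge_integral (mu : {charge set T -> \bar R[i]})
    (f : T -> R[i]) : R[i] :=
  charge_integral (re_charge mu) f + 'i * charge_integral (im_charge mu) f.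

End complex_integrals.

Section theorem_notions.
Context {R : realType}.

Definition fourier d (mu : {charge set (d.-tuple R) -> \bar R[i]})
    (y : d.-tuple R) : R[i] :=
  complex_charge_integral mu (fun x =>
    let t := - (2 * pi * scalar_product x y) in cos t +i* sin t).

(* The points [g n] may repeat and the coefficients [a n] may vanish, so finite
   and empty sums of point masses are included. *)
Definition Mad d (mu : {charge set (d.-tuple R) -> \bar R[i]}) : Prop :=
  exists (f : d.-tuple R -> R[i]) (a : (R[i]^o)^nat) (g : (d.-tuple R)^nat),
    [/\ complex_integrable (lebesgue_tuple d) f,
        cvgn [normed series a] &
        forall A, measurable A ->
          mu A = (complex_integral (lebesgue_tuple d) A f +
                  limn (series (fun n => a n * (\1_A (g n))%:C : R[i]^o)))%:E].

(* The double power series is summed as an unordered family over nat * nat.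
   Values of h outside V play no role. *)
Definition real_analytic_on (V : set R[i]^o) (h : R[i] -> R[i]) : Prop :=
  forall z, V z -> exists (r : R) (c : nat -> nat -> R[i]), 0 < r /\
    forall xi eta : R,
      (xi - complex.Re z) ^+ 2 + (eta - complex.Im z) ^+ 2 < r ^+ 2 ->
      partial_sum (fun kn : nat * nat => c kn.1 kn.2 *
        ((xi - complex.Re z) ^+ kn.1 * (eta - complex.Im z) ^+ kn.2)%:C)
        @ totally --> (h (xi +i* eta) : R[i]^o).

End theorem_notions.

(* Main.v *)
(* Call F localizable if, for every d > 0, there are functions X_i in the algebra A of
   the Fourier transforms of measures without singular continuous part, finite in
   number and with sum 1, such that the norms of X_i (F - x_i)^m in A are O(d^m).
   If F is localizable, so are Re F and Im F, and the power series of h converge in A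
   after multiplication by the X_i; those X_i whose support meets F^-1(K) sum up to 1
   there, which gives h(F) on F^-1(K).

   Localizable functions are stable under sums, multiples and norm limits.  A real p
   with values in [-1, 1] is localizable as soon as the norms of T_k(p), for the
   Chebyshev polynomials T_k, grow polynomially: a polynomial Q of degree D has
   Chebyshev coefficients bounded by 2 sup |Q|, so that the norm of Q(p) is at most
   sup |Q| times a power of D, and there are cutoff functions that are exactly 0 and
   exactly 1 off a short interval and are approximated at an exponential rate in a
   power of the degree.

   This applies to the real part of a multiple of a character, and hence to discrete
   measures.  For a density g, bounded, of compact support, small in L^1, and even or
   odd, T_k(p) p is up to a constant the transform of the iterate t_k of a three-term
   recurrence.  It has a conserved energy which bounds the L^2 norm of t_k, whereas
   its support grows linearly; hence the L^1 norm of t_k grows polynomially. *)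

Require Import Defs.
From HB Require Import structures.
From mathcomp Require Import all_boot all_order all_algebra finmap.
From mathcomp Require Import complex.
From mathcomp Require Import all_classical all_reals all_analysis.
From mathcomp.analysis Require Import summability measurable_realfun.
From mathcomp Require Import ring lra zify.

Set Implicit Arguments.
Unset Strict Implicit.
Unset Printing Implicit Defensive.

Import Order.TTheory GRing.Theory Num.Theory.
Import numFieldNormedType.Exports.

Local Open Scope classical_set_scope.
Local Open Scope ring_scope.
Local Open Scope complex_scope.

(** * Polynomial cutoff functions *)

(** Pointwise bounds do not bound the norm of A. In the algebra of all measures the conclusion
    fails: a transform bounded away from 0 need not have an inverse there (the Wiener-Pitt
    phenomenon). Hence smallness on a cell is measured in norm, for all powers at once. A bound
    O(d^m) makes power series converge whose radius is a large enough multiple of d, it adds up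
    under sums by the binomial theorem, and it tolerates a perturbation of norm e by passing to d +
    e. The last point lets localizability pass to limits.

    The cutoffs have to vanish exactly off their interval, because the factor d^m comes from
    chi(t)(t - x)^m being at most a constant times d^m on all of [-1, 1]. A power of the degree is
    harmless against an error 2^-n as long as the degree is itself bounded by a power of n.

    Parity makes convolution with g symmetric or antisymmetric on L^2, which is what gives the
    recurrence an invariant quadratic form; an L^1 norm of at most 1/2 makes this form positive
    definite. The factor p in T_k(p) p lets the recurrence start inside L^1. *)

Section polynomial_cutoffs.
Context {R : realType}.
Implicit Types (P Q : {poly R}) (t u : R).

(* The upper tail of the binomial distribution B(2m, u): it is exponentially close
   to 0 for u < 1/2 and to 1 for u > 1/2. *)
Definition binomial_step (m : nat) : {poly R} :=
  \sum_(m <= k < m.*2.+1) ('X^k * (1 - 'X) ^+ (m.*2 - k)) *+ 'C(m.*2, k).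

Lemma size_binomial_step m : (size (binomial_step m) <= m.*2.+1)%N.
Proof.
rewrite /binomial_step big_seq.
apply: (big_ind (fun p : {poly R} => (size p <= m.*2.+1)%N)).
- by rewrite size_poly0.
- by move=> p q hp hq; rewrite (leq_trans (size_polyD _ _))// geq_max hp hq.
move=> k; rewrite mem_index_iota => /andP[mk km].
rewrite -scaler_nat (leq_trans (size_scale_leq _ _))//.
rewrite (leq_trans (size_polyMleq _ _))// size_polyXn addSn /=.
have h : (size ((1 - 'X) ^+ (m.*2 - k) : {poly R}) <= (m.*2 - k).+1)%N.
  rewrite (leq_trans (size_poly_exp_leq _ _))//.
  rewrite ltnS -[leqRHS]mul1n leq_mul2r; apply/orP; right.
  rewrite -opprB size_polyN -['X - 1]/('X - 1%:P) size_XsubC //.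
by rewrite (leq_trans (leq_add (leqnn k) h))// addnS ltnS subnKC.
Qed.

Lemma horner_binomial_step m u : (binomial_step m).[u] =
  \sum_(m <= k < m.*2.+1) (u ^+ k * (1 - u) ^+ (m.*2 - k)) *+ 'C(m.*2, k).
Proof.
rewrite /binomial_step horner_sum; apply: eq_bigr => k _.
by rewrite hornerMn hornerM !horner_exp !hornerE.
Qed.

Lemma binomial_step_compl m u : 1 - (binomial_step m).[u] =
  \sum_(0 <= k < m) (u ^+ k * (1 - u) ^+ (m.*2 - k)) *+ 'C(m.*2, k).
Proof.
have E : \sum_(0 <= k < m.*2.+1)
    (u ^+ k * (1 - u) ^+ (m.*2 - k)) *+ 'C(m.*2, k) = 1.
  rewrite big_mkord; under eq_bigr do rewrite mulrC.
  by rewrite -exprDn addrC subrKC expr1n.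
rewrite horner_binomial_step -[X in X - _]E (@big_cat_nat _ _ _ m)//=; last lia.
by rewrite addrK.
Qed.

Lemma binomial_step_ge0 m u : 0 <= u <= 1 -> 0 <= (binomial_step m).[u].
Proof.
move=> /andP[u0 u1]; rewrite horner_binomial_step; apply: sumr_ge0 => k _.
by rewrite mulrn_wge0// mulr_ge0// exprn_ge0// subr_ge0.
Qed.

Lemma binomial_step_le1 m u : 0 <= u <= 1 -> (binomial_step m).[u] <= 1.
Proof.
move=> /andP[u0 u1]; rewrite -subr_ge0 binomial_step_compl.
apply: sumr_ge0 => k _.
by rewrite mulrn_wge0// mulr_ge0// exprn_ge0// subr_ge0.
Qed.

(** Since u <= 1 - u, trading the k - m surplus factors u for factors 1 - u only increases a term.
    So every term is at most (u(1 - u))^m times its binomial coefficient, and these coefficients sum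
    up to at most 4^m. *)
Lemma binomial_step_left m u : 0 <= u -> u <= 2^-1 ->
  (binomial_step m).[u] <= (4 * u * (1 - u)) ^+ m.
Proof.
move=> u0 u2; rewrite horner_binomial_step.
have v0 : 0 <= 1 - u by lra.
apply: (@le_trans _ _ (\sum_(m <= k < m.*2.+1)
    ((u * (1 - u)) ^+ m *+ 'C(m.*2, k)))).
  rewrite big_seq [leRHS]big_seq; apply: ler_sum => k.
  rewrite mem_index_iota => /andP[mk km]; apply: ler_wMn2r.
  rewrite exprMn.
  have -> : u ^+ k = u ^+ m * u ^+ (k - m) by rewrite -exprD subnKC.
  have -> : (1 - u) ^+ m = (1 - u) ^+ (k - m) * (1 - u) ^+ (m.*2 - k).
    by rewrite -exprD; congr (_ ^+ _); lia.
  rewrite -mulrA ler_wpM2l ?exprn_ge0// ler_wpM2r ?exprn_ge0//.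
  by apply: lerXn2r; rewrite ?nnegrE//; lra.
have -> : \sum_(m <= k < m.*2.+1) (u * (1 - u)) ^+ m *+ 'C(m.*2, k) =
          (u * (1 - u)) ^+ m *+ (\sum_(m <= k < m.*2.+1) 'C(m.*2, k))%N.
  by rewrite -sumrMnr.
rewrite -mulrA [leRHS]exprMn -mulr_natl ler_wpM2r ?exprn_ge0 ?mulr_ge0//.
rewrite -natrX ler_nat.
have -> : (4 ^ m = \sum_(0 <= k < m.*2.+1) 'C(m.*2, k))%N.
  rewrite (_ : 4 = 2 ^ 2)%N// -expnM mul2n big_mkord.
  rewrite -[X in (X ^ _)%N]/(1 + 1)%N expnDn.
  by apply: eq_bigr => i _; rewrite !exp1n !muln1.
by rewrite [leqRHS](@big_cat_nat _ _ _ m) ?leq_addl//; lia.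
Qed.


Lemma binomial_step_right m u : 2^-1 <= u -> u <= 1 ->
  1 - (binomial_step m).[u] <= (4 * u * (1 - u)) ^+ m.
Proof.
move=> u2 u1; rewrite binomial_step_compl.
have u0 : 0 <= u by lra.
have v0 : 0 <= 1 - u by lra.
apply: (@le_trans _ _ (\sum_(0 <= k < m)
    ((u * (1 - u)) ^+ m *+ 'C(m.*2, k)))).
  rewrite big_seq [leRHS]big_seq; apply: ler_sum => k.
  rewrite mem_index_iota => /andP[_ km]; apply: ler_wMn2r.
  rewrite exprMn.
  have -> : u ^+ m = u ^+ (m - k) * u ^+ k.
    by rewrite -exprD; congr (_ ^+ _); lia.
  have -> : (1 - u) ^+ (m.*2 - k) = (1 - u) ^+ (m - k) * (1 - u) ^+ m.
    by rewrite -exprD; congr (_ ^+ _); lia.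
  rewrite mulrA ler_wpM2r ?exprn_ge0// mulrC ler_wpM2r ?exprn_ge0//.
  by apply: lerXn2r; rewrite ?nnegrE//; lra.
have -> : \sum_(0 <= k < m) (u * (1 - u)) ^+ m *+ 'C(m.*2, k) =
          (u * (1 - u)) ^+ m *+ (\sum_(0 <= k < m) 'C(m.*2, k))%N.
  by rewrite -sumrMnr.
rewrite -mulrA [leRHS]exprMn -mulr_natl ler_wpM2r ?exprn_ge0 ?mulr_ge0//.
rewrite -natrX ler_nat.
have -> : (4 ^ m = \sum_(0 <= k < m.*2.+1) 'C(m.*2, k))%N.
  rewrite (_ : 4 = 2 ^ 2)%N// -expnM mul2n big_mkord.
  rewrite -[X in (X ^ _)%N]/(1 + 1)%N expnDn.
  by apply: eq_bigr => i _; rewrite !exp1n !muln1.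
by rewrite [leqRHS](@big_cat_nat _ _ _ m) ?leq_addr//; lia.
Qed.

(** Bernoulli gives (1 + x)^w >= 2, and (1 - x)(1 + x) <= 1 turns this into (1 - x)^w <= 1/2. *)
Lemma geometric_decay (x : R) w k : 0 <= x <= 1 -> 1 <= w%:R * x ->
  (1 - x) ^+ (w * k) <= 2^-1 ^+ k.
Proof.
move=> /andP[x0 x1] wx; rewrite exprM; apply: lerXn2r.
- by rewrite nnegrE exprn_ge0// subr_ge0.
- by rewrite nnegrE.
have h : 1 + w%:R * x <= (1 + x) ^+ w.
  elim: w {wx} => [|w IH]; first by rewrite mul0r addr0 expr0.
  have wx : 0 <= w%:R * x by rewrite mulr_ge0.
  rewrite exprS (le_trans _ (ler_wpM2l _ IH))//; last lra.
  have wxx : 0 <= w%:R * x * x by rewrite mulr_ge0.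
  by rewrite -addn1 natrD; lra.
have h0 : 0 <= (1 - x) ^+ w by rewrite exprn_ge0// subr_ge0.
have h1 : (1 - x) ^+ w * (1 + x) ^+ w <= 1.
  by rewrite -exprMn exprn_ile1//; nra.
have h2 : 2 <= (1 + x) ^+ w by lra.
nra.
Qed.

Lemma step_poly (l r : R) (w k : nat) : -1 <= l -> l < r -> r <= 1 ->
  16 <= w%:R * (r - l) ^+ 2 ->
  exists E : {poly R}, (size E <= (w * k).*2.+1)%N /\
    forall t : R, -1 <= t <= 1 ->
      [/\ 0 <= E.[t] <= 1, t <= l -> E.[t] <= 2^-1 ^+ k
        & r <= t -> 1 - E.[t] <= 2^-1 ^+ k].
Proof.
move=> l1 lr r1 hw.
(* [q] maps [-1, 1] into [0, 1] and the midpoint of [l, r] to 1/2. Outside ]l, r[ its value u is at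
   least (r - l)/8 away from 1/2, whence 4u(1 - u) <= 1 - (r - l)^2/16; this is the origin of the
   constant 16. *)
pose q : {poly R} := 4^-1 *: 'X + (2^-1 - (l + r) / 8)%:P.
have qE t : q.[t] = 2^-1 + (t - (l + r) / 2) / 4.
  by rewrite /q hornerD hornerZ hornerX hornerC; lra.
exists (binomial_step (w * k) \Po q); split.
  rewrite (leq_trans (size_comp_poly_leq _ _))// ltnS.
  have hq : (size q <= 2)%N.
    rewrite (leq_trans (size_polyD _ _))// geq_max.
    rewrite (leq_trans (size_scale_leq _ _)) ?size_polyX//.
    by rewrite (leq_trans (size_polyC_leq1 _)).
  have hb := size_binomial_step (w * k).
  rewrite -[leqRHS]muln1 leq_mul//; first by rewrite -ltnS; case: (size _) hb.
  by rewrite -ltnS; case: (size q) hq.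
move=> t /andP[t0 t1]; rewrite horner_comp qE.
set u := 2^-1 + _.
have u01 : 0 <= u <= 1 by rewrite /u; apply/andP; split; lra.
have [u0 u1] := andP u01.
have x01 : 0 <= (r - l) ^+ 2 / 16 <= 1.
  apply/andP; split; first by rewrite divr_ge0// sqr_ge0.
  rewrite ler_pdivrMr// mul1r; nra.
have wx : 1 <= w%:R * ((r - l) ^+ 2 / 16) by lra.
have key : (t <= l) || (r <= t) -> (4 * u * (1 - u)) ^+ (w * k) <= 2^-1 ^+ k.
  move=> tlr; apply: le_trans (geometric_decay k x01 wx).
  have h : 4 * u * (1 - u) <= 1 - (r - l) ^+ 2 / 16.
    rewrite /u; case/orP: tlr => ?; nra.
  apply: lerXn2r; rewrite ?nnegrE//; first nra.
  by rewrite subr_ge0; case/andP: x01.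
split.
- by rewrite binomial_step_ge0// binomial_step_le1.
- move=> tl; rewrite (le_trans (binomial_step_left _ _ _)) ?key ?tl// /u.
  lra.
- move=> tl; rewrite (le_trans (binomial_step_right _ _ _)) ?key ?tl ?orbT//.
  by rewrite /u; lra.
Qed.

End polynomial_cutoffs.

(** * Exact cutoffs as fast limits of polynomials *)

Section cutoff_functions.
Context {R : realType}.

(** The sequences u n - 2C/2^n and u n + 2C/2^n are nondecreasing and nonincreasing, and the first
    stays below the second: its supremum is the limit, and the two enclose it with the stated
    error. *)
Lemma geometric_limit (u : nat -> R) (C : R) :
  (forall n, `|u n.+1 - u n| <= C * 2^-1 ^+ n) ->
  exists l, forall n, `|l - u n| <= 2 * C * 2^-1 ^+ n.
Proof.
move=> uC.
pose a n := u n - 2 * C * 2^-1 ^+ n.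
pose b n := u n + 2 * C * 2^-1 ^+ n.
have C0 : 0 <= C by have := uC 0%N; rewrite expr0 mulr1; apply: le_trans.
have stepab n : a n <= a n.+1 /\ b n.+1 <= b n.
  have := uC n; rewrite /a /b exprS ler_norml => /andP[h1 h2].
  by split; lra.
have ab n : a n <= b n.
  have : 0 <= C * 2^-1 ^+ n by rewrite mulr_ge0// exprn_ge0.
  by rewrite /a /b; lra.
have a_le : {homo a : m n / (m <= n)%N >-> m <= n}.
  by apply: homo_leq; [|exact: le_trans|by move=> n; exact: (stepab n).1].
have b_le : {homo b : m n / (m <= n)%N >-> n <= m}.
  apply: homo_leq => [x|y x z xy yz|n]; [exact: lexx|exact: le_trans yz xy|].
  exact: (stepab n).2.
have a_b m n : a m <= b n.
  rewrite (le_trans (a_le m (maxn m n) (leq_maxl _ _)))//.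
  by rewrite (le_trans (ab _))// b_le// leq_maxr.
have hs : has_sup (range a).
  split; first by exists (a 0%N), 0%N.
  by exists (b 0%N) => _ [n _ <-].
exists (sup (range a)) => n.
have h1 : a n <= sup (range a) by apply: ub_le_sup => //; case: hs.
have h2 : sup (range a) <= b n by apply: ge_sup => [|_ [m _ <-]]; [case: hs|].
by move: h1 h2; rewrite /a /b ler_norml => h1 h2; apply/andP; split; lra.
Qed.

(** Sharper and sharper steps at one fixed place would converge to a jump, without a uniform rate.
    Instead each stage corrects [P n] only near the two ends, on windows that move towards a and b.
    In between, the values change by 2^-n only, and the limit is exactly 0 and 1 outside. *)
Lemma cutoff (a b : R) : -1 <= a -> a < b -> b <= 1 ->
  exists (P : nat -> {poly R}) (s : R -> R) (K : nat),
    (forall n, (size (P n) <= K * n.+1 ^ 6)%N) /\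
    forall t : R, -1 <= t <= 1 ->
      [/\ forall n, `|s t - (P n).[t]| <= 8 * 2^-1 ^+ n,
        t <= a -> s t = 0 & b <= t -> s t = 1].
Proof.
move=> a1 ab b1.
have [W WE] : exists W, W = (b - a) / 2 by exists ((b - a) / 2).
have W0 : 0 < W by rewrite WE; lra.
have W2 : 0 < W ^+ 2 by rewrite exprn_gt0.
pose A := (Num.bound (16 / W ^+ 2)).
have hA : 16 <= A%:R * W ^+ 2.
  rewrite -ler_pdivrMr//; apply/ltW/archi_boundP.
  by rewrite divr_ge0// ltW.
have invn n : 0 < (n.+1%:R^-1 : R) <= 1.
  by rewrite invr_gt0 ltr0n/= invf_le1 ?ltr0n// ler1n.
have gap n : W / n.+1%:R - W / n.+2%:R = W / (n.+1%:R * n.+2%:R) :> R.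
  have h1 : (n.+1%:R : R) != 0 by rewrite pnatr_eq0.
  have h2 : (n.+2%:R : R) != 0 by rewrite pnatr_eq0.
  have -> : n.+2%:R = n.+1%:R + 1 :> R by rewrite -(addn1 n.+1) natrD.
  have {}h2 : n.+1%:R + 1 != 0 :> R by rewrite -(natrD _ n.+1 1) addn1.
  by move: (n.+1%:R : R) h1 h2 => x h1 h2; field; rewrite h1 h2.
(* The window of stage n has length W/((n+1)(n+2)), the gap between W/(n+1) and W/(n+2); [w n] is
   what [step_poly] requires for a step of that width. *)
pose w n := (A * (n.+1 * n.+2) ^ 2)%N.
have hw n : 16 <= (w n)%:R * (W / (n.+1%:R * n.+2%:R)) ^+ 2 :> R.
  rewrite /w natrM natrX natrM expr_div_n mulrACA mulfV ?mulr1//.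
have gap0 n : 0 < W / (n.+1%:R * n.+2%:R) :> R.
  by rewrite divr_gt0// mulr_gt0// ltr0n.
have lW n : 0 < W / n.+1%:R <= W.
  have /andP[h1 h2] := invn n.
  by rewrite mulr_gt0//= -[leRHS]mulr1 ler_pM2l.
have [e eE] : exists e : nat -> R, forall n, e n = W / n.+1%:R.
  by exists (fun n => W / n.+1%:R).
have [f fE] : exists f : nat -> R, forall n, f n = W / (n.+1%:R * n.+2%:R).
  by exists (fun n => W / (n.+1%:R * n.+2%:R)).
have {}gap n : e n - e n.+1 = f n by rewrite !eE fE gap.
have {}gap0 n : 0 < f n by rewrite fE gap0.
have {}hw n : 16 <= (w n)%:R * f n ^+ 2 by rewrite fE hw.
have {}lW n : 0 < e n <= W by rewrite eE lW.
(* Both [l] and [r] start at the midpoint of [a, b]; [l] decreases to a and [r] increases to b. *)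
pose l n := a + e n.
pose r n := b - e n.
have hEa n : exists E : {poly R}, (size E <= (w n * n).*2.+1)%N /\
    forall t : R, -1 <= t <= 1 ->
      [/\ 0 <= E.[t] <= 1, t <= l n.+1 -> E.[t] <= 2^-1 ^+ n
        & l n <= t -> 1 - E.[t] <= 2^-1 ^+ n].
  have g := gap n; have g0 := gap0 n.
  have /andP[k1 k2] := lW n; have /andP[k3 k4] := lW n.+1.
  apply: step_poly; rewrite /l; [lra|lra|lra|].
  by rewrite (_ : _ - _ = f n) ?hw//; lra.
have hEb n : exists E : {poly R}, (size E <= (w n * n).*2.+1)%N /\
    forall t : R, -1 <= t <= 1 ->
      [/\ 0 <= E.[t] <= 1, t <= r n -> E.[t] <= 2^-1 ^+ n
        & r n.+1 <= t -> 1 - E.[t] <= 2^-1 ^+ n].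
  have g := gap n; have g0 := gap0 n.
  have /andP[k1 k2] := lW n; have /andP[k3 k4] := lW n.+1.
  apply: step_poly; rewrite /r; [lra|lra|lra|].
  by rewrite (_ : _ - _ = f n) ?hw//; lra.
have {hEa} [Ea hEa] := boolp.choice hEa.
have {hEb} [Eb hEb] := boolp.choice hEb.
(* [Ea k] steps up on [l (k+1), l k] and forces the values to 0 on the left of it; [Eb k] steps up
   on [r k, r (k+1)] and forces them to 1 on the right. Between the windows [Ea k] is nearly 1 and
   [Eb k] nearly 0, so that [P k] is kept. As a convex-type combination it stays in [0, 1]. *)
pose P := fix P (n : nat) : {poly R} :=
  if n is k.+1 then Ea k * P k + Eb k * (1 - P k) else 0.
have PS n t : (P n.+1).[t] = (Ea n).[t] * (P n).[t] + (Eb n).[t] * (1 - (P n).[t]).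
  by rewrite /= !(hornerD, hornerM, hornerN, hornerC).
have P01 n (t : R) : -1 <= t <= 1 -> 0 <= (P n).[t] <= 1.
  move=> ht; elim: n => [|n /andP[h1 h2]]; first by rewrite horner0; apply/andP; split; lra.
  have [/andP[h3 h4] _ _] := (hEa n).2 t ht.
  have [/andP[h5 h6] _ _] := (hEb n).2 t ht.
  rewrite PS; apply/andP; split; nra.
have lr n : l n <= r n.
  by have /andP[h1 h2] := lW n; rewrite /l /r; lra.
have dl n : l n.+1 <= l n by have g := gap n; have g0 := gap0 n; rewrite /l; lra.
have dr n : r n <= r n.+1 by have g := gap n; have g0 := gap0 n; rewrite /r; lra.
have Pl n (t : R) : -1 <= t <= 1 -> t <= l n.+1 -> (P n.+1).[t] <= 2^-1 ^+ n.
  move=> ht tl; have /andP[h1 h2] := P01 n t ht.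
  have [/andP[h3 h4] /(_ tl) h7 _] := (hEa n).2 t ht.
  have [/andP[h5 h6] h8 _] := (hEb n).2 t ht.
  have {}h8 : (Eb n).[t] <= 2^-1 ^+ n.
    by apply: h8; rewrite (le_trans tl)// (le_trans (dl n)).
  rewrite PS; nra.
have Pr n (t : R) : -1 <= t <= 1 -> r n.+1 <= t -> 1 - (P n.+1).[t] <= 2^-1 ^+ n.
  move=> ht tr; have /andP[h1 h2] := P01 n t ht.
  have [/andP[h3 h4] _ h7] := (hEa n).2 t ht.
  have [/andP[h5 h6] _ /(_ tr) h8] := (hEb n).2 t ht.
  have {}h7 : 1 - (Ea n).[t] <= 2^-1 ^+ n.
    by apply: h7; rewrite (le_trans _ tr)// (le_trans (lr n)).
  rewrite PS; nra.
(* The change is Eb(1 - P) - (1 - Ea)P. At every t one of the two factors of each product is small: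
   either the step polynomial is already at its limit value, or [P] was made correct there at the
   stage before. *)
have hc n (t : R) : -1 <= t <= 1 -> `|(P n.+1).[t] - (P n).[t]| <= 4 * 2^-1 ^+ n.
  move=> ht; case: n => [|n].
    have /andP[h1 h2] := P01 1%N t ht.
    by rewrite [P 0]/(0 : {poly R}) horner0 subr0 expr0 ger0_norm//; lra.
  rewrite PS.
  have -> : 4 * 2^-1 ^+ n.+1 = 2 * 2^-1 ^+ n :> R by rewrite exprS; field.
  have q0 : 0 <= 2^-1 ^+ n :> R by rewrite exprn_ge0.
  have qS : 2^-1 ^+ n.+1 <= 2^-1 ^+ n :> R.
    by rewrite exprS; lra.
  have /andP[h1 h2] := P01 n.+1 t ht.
  have [/andP[h3 h4] _ h7] := (hEa n.+1).2 t ht.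
  have [/andP[h5 h6] h8 _] := (hEb n.+1).2 t ht.
  have k1 : 0 <= (1 - (Ea n.+1).[t]) * (P n.+1).[t] <= 2^-1 ^+ n.
    apply/andP; split; first nra.
    have [tl|/ltW tl] := leP t (l n.+1).
      have := Pl n t ht tl; nra.
    have := h7 tl; nra.
  have k2 : 0 <= (Eb n.+1).[t] * (1 - (P n.+1).[t]) <= 2^-1 ^+ n.
    apply/andP; split; first nra.
    have [tl|/ltW tl] := leP (r n.+1) t.
      have := Pr n t ht tl; nra.
    have := h8 tl; nra.
  have {k1} /andP[k1 k1'] := k1.
  have {k2} /andP[k2 k2'] := k2.
  rewrite ler_norml; apply/andP; split; lra.
have hs (t : R) : exists y, -1 <= t <= 1 -> forall n, `|y - (P n).[t]| <= 8 * 2^-1 ^+ n.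
  have [ht|_] := boolP (-1 <= t <= 1); last by exists 0.
  have [y hy] := geometric_limit (fun n => hc n t ht).
  by exists y => _ n; rewrite (le_trans (hy n))// -mulrA; lra.
have {hs} [s hs] := boolp.choice hs.
have small (x : R) : (forall n, `|x| <= 18 * 2^-1 ^+ n) -> x = 0.
  move=> hx; apply/eqP; rewrite -normr_le0 leNgt; apply/negP => x0.
  have h18 : (18 * `|x|^-1) < (Num.bound (18 * `|x|^-1))%:R.
    by apply: archi_boundP; rewrite mulr_ge0// invr_ge0.
  have := hx (Num.bound (18 * `|x|^-1)).
  set N := Num.bound _ in h18 *.
  have hN : N%:R < 2 ^+ N :> R by rewrite -natrX ltr_nat ltn_expl.
  rewrite exprVn ler_pdivlMr ?exprn_gt0// leNgt => /negP; apply.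
  rewrite -ltr_pdivrMl// mulrC; exact: lt_trans hN.
(* Stage n adds at most 2 n (w n) <= 8A(n+1)^5 to the degree, hence the total of order n^6. *)
exists P, s, (8 * A + 1)%N; split.
  move=> n; have : (size (P n) <= 8 * A * n ^ 6 + 1)%N.
    elim: n => [|n IH]; first by rewrite size_poly0.
    have hwn : ((w n * n).*2 <= 8 * A * n.+1 ^ 5)%N.
      rewrite /w -mul2n.
      have h1 : (n.+2 <= 2 * n.+1)%N by lia.
      have h2 : ((n.+1 * n.+2) ^ 2 <= (n.+1 * (2 * n.+1)) ^ 2)%N.
        by rewrite leq_exp2r// leq_mul2l h1 orbT.
      have -> : (8 * A * n.+1 ^ 5 = 2 * (A * (n.+1 * (2 * n.+1)) ^ 2 * n.+1))%N.
        by rewrite !expnS !expn0; ring.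
      by rewrite leq_mul2l/= leq_mul// leq_mul2l h2 orbT.
    have hn : (n ^ 6 + n.+1 ^ 5 <= n.+1 ^ 6)%N.
      rewrite (expnS n 5) (expnS n.+1 5) mulSn addnC leq_add2l leq_mul2l.
      by rewrite leq_exp2r ?leqnSn ?orbT.
    have hfin : ((w n * n).*2 + (8 * A * n ^ 6 + 1) <= 8 * A * n.+1 ^ 6 + 1)%N.
      rewrite addnA leq_add2r (leq_trans (leq_add hwn (leqnn _)))//.
      by rewrite -mulnDr leq_mul2l addnC hn orbT.
    apply: leq_trans hfin; rewrite [P n.+1]/(Ea n * P n + Eb n * (1 - P n)).
    have hM (E Q : {poly R}) : (size E <= (w n * n).*2.+1)%N ->
       (size Q <= 8 * A * n ^ 6 + 1)%N ->
       (size (E * Q)%R <= (w n * n).*2 + (8 * A * n ^ 6 + 1))%N.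
      move=> h1 h2; rewrite (leq_trans (size_polyMleq _ _))//.
      by move: (leq_add h1 h2); rewrite addSn; case: (size E + size Q)%N.
    have [[sEa _] [sEb _]] := (hEa n, hEb n).
    have s1P : (size (1 - P n)%R <= 8 * A * n ^ 6 + 1)%N.
      rewrite (leq_trans (size_polyD _ _))// geq_max size_polyN IH andbT.
      by rewrite size_poly1 addn1.
    by rewrite (leq_trans (size_polyD _ _))// geq_max !hM.
  move=> h; rewrite (leq_trans h)// mulnDl mul1n leq_add ?expn_gt0//.
  by rewrite leq_mul2l leq_exp2r// leqnSn orbT.
move=> t ht; split; first exact: hs.
- move=> ta; apply: small => n.
  have /andP[W1 _] := lW n.+1.
  have hn := Pl n t ht; have /andP[h0 _] := P01 n.+1 t ht.
  have {}hn : (P n.+1).[t] <= 2^-1 ^+ n by apply: hn; rewrite /l; lra.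
  have := hs t ht n.+1; rewrite exprS => h1.
  have q0 : 0 <= 2^-1 ^+ n :> R by rewrite exprn_ge0.
  move: h1; rewrite !ler_norml => /andP[? ?]; apply/andP; split; lra.
- move=> tb; apply/eqP; rewrite -subr_eq0; apply/eqP/small => n.
  have /andP[W1 _] := lW n.+1.
  have hn := Pr n t ht; have /andP[_ h0] := P01 n.+1 t ht.
  have {}hn : 1 - (P n.+1).[t] <= 2^-1 ^+ n by apply: hn; rewrite /r; lra.
  have := hs t ht n.+1; rewrite exprS => h1.
  have q0 : 0 <= 2^-1 ^+ n :> R by rewrite exprn_ge0.
  move: h1; rewrite !ler_norml => /andP[? ?]; apply/andP; split; lra.
Qed.

End cutoff_functions.

(** * Chebyshev polynomials *)

Section chebyshev.
Context {R : realType}.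

Fixpoint cheb (n : nat) : {poly R} :=
  if n is n1.+1 then
    if n1 is n2.+1 then 'X * cheb n1 *+ 2 - cheb n2 else 'X
  else 1.

Lemma chebSS n : cheb n.+2 = 'X * cheb n.+1 *+ 2 - cheb n.
Proof. by []. Qed.

Lemma nat_ind2 (P : nat -> Prop) : P 0%N -> P 1%N ->
  (forall n, P n -> P n.+1 -> P n.+2) -> forall n, P n.
Proof.
move=> P0 P1 PS n; suff [] : P n /\ P n.+1 by [].
by elim: n => // n [h1 h2]; split=> //; exact: PS.
Qed.

Lemma horner_cheb_cos n (x : R) : (cheb n).[cos x] = cos (n%:R * x).
Proof.
elim/nat_ind2: n => [||n h1 h2]; first by rewrite hornerC mul0r cos0.
  by rewrite hornerX mul1r.
rewrite chebSS hornerD hornerN hornerMn hornerM hornerX h1 h2.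
have -> : n.+2%:R * x = n.+1%:R * x + x by rewrite -(addn1 n.+1) natrD; ring.
have -> : n%:R * x = n.+1%:R * x - x by rewrite -(addn1 n) natrD; ring.
by rewrite cosB cosD; ring.
Qed.

Lemma size_cheb n : size (cheb n) = n.+1.
Proof.
elim/nat_ind2: n => [||n h1 h2]; [exact: size_poly1|exact: size_polyX|].
have X0 : cheb n.+1 != 0 by rewrite -size_poly_gt0 h2.
have h : size ('X * cheb n.+1 *+ 2) = n.+3.
  rewrite -scaler_nat size_scale ?pnatr_eq0// mulrC size_mulX ?h2//.
by rewrite chebSS size_polyDl ?h// size_polyN h1 ltnS.
Qed.

Lemma cheb_span D (Q : {poly R}) : (size Q <= D)%N ->
  exists c : nat -> R, Q = \sum_(k < D) c k *: cheb k.
Proof.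
elim: D Q => [|D IH] Q sQ.
  exists (fun=> 0); rewrite big_ord0; apply/eqP.
  by rewrite -size_poly_leq0.
pose a := Q`_D / lead_coef (cheb D).
have l0 : lead_coef (cheb D) != 0.
  by rewrite lead_coef_eq0 -size_poly_gt0 size_cheb.
have [|c hc] := IH (Q - a *: cheb D).
  apply/leq_sizeP => j; rewrite leq_eqVlt => /predU1P[<-|Dj].
    rewrite coefB coefZ /a.
    by rewrite /lead_coef size_cheb/= in l0 *; rewrite divfK ?subrr.
  rewrite coefB coefZ !nth_default ?mulr0 ?subr0// ?size_cheb//.
  exact: leq_trans sQ Dj.
exists (fun k => if k == D then a else c k).
rewrite big_ord_recr/= eqxx -[LHS](subrK (a *: cheb D)) hc; congr (_ + _).
by apply: eq_bigr => i _; rewrite ltn_eqF.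
Qed.

Lemma sin_D2pin (x : R) q : sin (x + q%:R * (2 * pi)) = sin x.
Proof.
elim: q => [|q IH]; first by rewrite mul0r addr0.
rewrite -(addn1 q) natrD mulrDl mul1r addrA.
by rewrite [2 * pi]mulr_natl sinD cos2pi sin2pi mulr1 mulr0 addr0 -[pi *+ 2]mulr_natl.
Qed.

(** Multiplication by 2 sin(a/2), with a = 2 pi q/n, makes the sum telescope to sin(na - a/2) +
    sin(a/2), which vanishes because na is a multiple of 2 pi. The condition 0 < q < n ensures
    sin(a/2) > 0. *)
Lemma sum_cos_nodes (n q : nat) : (0 < q)%N -> (q < n)%N ->
  \sum_(j < n) cos (q%:R * (j%:R * (2 * pi / n%:R))) = 0 :> R.
Proof.
move=> q0 qn; have n0 : n%:R != 0 :> R by rewrite pnatr_eq0; lia.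
pose a : R := q%:R * (2 * pi / n%:R).
have sa : 0 < sin (a / 2).
  have -> : a / 2 = (q%:R / n%:R) * pi by rewrite /a; field.
  apply: sin_gt0_pi; apply/andP; split.
    by rewrite mulr_gt0 ?pi_gt0// divr_gt0// ltr0n// (leq_trans _ qn).
  rewrite gtr_pMl ?pi_gt0// ltr_pdivrMr ?mul1r ?ltr_nat//.
  by rewrite ltr0n (leq_trans _ qn).
have E m : 2 * sin (a / 2) * \sum_(j < m) cos (q%:R * (j%:R * (2 * pi / n%:R))) =
    sin (m%:R * a - a / 2) + sin (a / 2).
  elim: m => [|m IH]; first by rewrite big_ord0 mulr0 mul0r sub0r sinN addNr.
  rewrite big_ord_recr/= mulrDr IH.
  have -> : q%:R * (m%:R * (2 * pi / n%:R)) = m%:R * a by rewrite /a; ring.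
  have -> : m.+1%:R * a - a / 2 = m%:R * a + a / 2.
    by rewrite -(addn1 m) natrD; field.
  by rewrite (sinD _ (a / 2)) sinB; ring.
have := E n.
have -> : n%:R * a - a / 2 = - (a / 2) + q%:R * (2 * pi) by rewrite /a; field.
rewrite sin_D2pin sinN addNr => /eqP; rewrite mulf_eq0 => /orP[|/eqP//].
by rewrite mulf_eq0 (gt_eqF sa) orbF pnatr_eq0.
Qed.

(** Discrete orthogonality of the cosines on n = 2D equally spaced nodes of the circle: for k, l < D
    the frequencies k + l and |k - l| stay below n, so that no aliasing occurs. A coefficient is
    thus twice a mean of values of modulus at most M, or the mean itself for l = 0. *)
Lemma cheb_coef_bound D (c : nat -> R) (M : R) :
  (forall t : R, -1 <= t <= 1 -> `|(\sum_(k < D) c k *: cheb k).[t]| <= M) ->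
  forall l, (l < D)%N -> `|c l| <= 2 * M.
Proof.
move=> hM l lD; pose n := (2 * D)%N.
have M0 : 0 <= M.
  by apply: le_trans (hM 0 _) => //; apply/andP; split; lra.
have n0 : (0 < n)%N by rewrite /n; lia.
have n0R : 0 < n%:R :> R by rewrite ltr0n.
pose th (j : nat) : R := j%:R * (2 * pi / n%:R).
pose g j := (\sum_(k < D) c k *: cheb k).[cos (th j)].
have gE j : g j = \sum_(k < D) c k * cos (k%:R * th j).
  rewrite /g horner_sum; apply: eq_bigr => k _.
  by rewrite hornerZ horner_cheb_cos.
have gM j : `|g j * cos (l%:R * th j)| <= M.
  rewrite normrM -[leRHS]mulr1 ler_pM//.
    by apply: hM; rewrite cos_geN1 cos_le1.
  by rewrite ler_norml cos_geN1 cos_le1.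
have ortho (k : nat) : (k < D)%N ->
    \sum_(j < n) cos (k%:R * th j) * cos (l%:R * th j) =
    if k == l then (if l == 0%N then n%:R else n%:R / 2) else 0.
  move=> kD.
  pose q := (maxn k l - minn k l)%N.
  have -> : \sum_(j < n) cos (k%:R * th j) * cos (l%:R * th j) =
    2^-1 * (\sum_(j < n) cos ((k + l)%:R * th j) + \sum_(j < n) cos (q%:R * th j)).
    rewrite -big_split mulr_sumr; apply: eq_bigr => j _ /=.
    have -> : cos (q%:R * th j) = cos (k%:R * th j - l%:R * th j).
      rewrite /q; have [kl|kl] := leqP k l.
        by rewrite natrB// -cosN; congr cos; ring.
      by rewrite natrB ?(ltnW kl)//; congr cos; ring.
    by rewrite natrD mulrDl cosD cosB; field.
  have [kl|kl] := eqVneq k l.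
    have -> : q = 0%N by rewrite /q kl; lia.
    rewrite kl.
    under [X in _ + X]eq_bigr do rewrite mul0r cos0.
    rewrite sumr_const card_ord.
    have [->|l0] := eqVneq l 0%N.
      under [X in X + _]eq_bigr do rewrite mul0r cos0.
      by rewrite sumr_const card_ord; field.
    by rewrite sum_cos_nodes ?add0r 1?mulrC//; rewrite /n; lia.
  by rewrite !sum_cos_nodes ?addr0 ?mulr0//; rewrite /n /q; lia.
have sE : \sum_(j < n) g j * cos (l%:R * th j) =
    c l * (if l == 0%N then n%:R else n%:R / 2).
  under eq_bigr do rewrite gE mulr_suml.
  rewrite exchange_big/= (bigD1 (Ordinal lD))//=.
  under eq_bigr do rewrite -mulrA.
  rewrite -mulr_sumr ortho// eqxx big1 ?addr0// => k kl.
  under eq_bigr do rewrite -mulrA.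
  by rewrite -mulr_sumr ortho// (negbTE (_ : val k != l)) ?mulr0.
have : `|c l * (if l == 0%N then n%:R else n%:R / 2)| <= n%:R * M.
  rewrite -sE (le_trans (ler_norm_sum _ _ _))//.
  rewrite (@le_trans _ _ (\sum_(j < n) M))//.
    by apply: ler_sum => j _; exact: gM.
  by rewrite sumr_const card_ord mulr_natl.
rewrite normrM; case: ifP => _.
  rewrite (gtr0_norm n0R) mulrC ler_pM2l// => /le_trans; apply.
  by rewrite mulr_natl mulr2n lerDl.
by rewrite (gtr0_norm (divr_gt0 n0R _))//; nra.
Qed.

End chebyshev.

(** * Localizable functions *)

Section complex_l1_norm.
Context {R : realType}.
Implicit Types z w : R[i].

(** The constant z will be represented by point masses at the origin whose phases are powers of i,
    which takes the total mass |Re z| + |Im z|. This norm is submultiplicative and has real values,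
    whereas [|z|] belongs to R[i]. *)
Definition norm1 z : R := `|complex.Re z| + `|complex.Im z|.

Lemma norm1_ge0 z : 0 <= norm1 z.
Proof. by rewrite addr_ge0. Qed.

Lemma norm1_0 : norm1 0 = 0.
Proof. by rewrite /norm1 /= normr0 addr0. Qed.

Lemma norm1_1 : norm1 1 = 1.
Proof. by rewrite /norm1 /= normr1 normr0 addr0. Qed.

Lemma norm1N z : norm1 (- z) = norm1 z.
Proof. by case: z => a b; rewrite /norm1 /= !normrN. Qed.

Lemma norm1D z w : norm1 (z + w) <= norm1 z + norm1 w.
Proof.
case: z w => a b [c d]; rewrite /norm1 /= addrACA.
by rewrite lerD// ler_normD.
Qed.

Lemma norm1B z w : norm1 (z - w) = norm1 (w - z).
Proof. by rewrite -norm1N opprB. Qed.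

Lemma norm1M z w : norm1 (z * w) <= norm1 z * norm1 w.
Proof.
case: z w => a b [c d]; rewrite /norm1 /=.
have := ler_normB (a * c) (b * d); have := ler_normD (a * d) (b * c).
rewrite !normrM => h1 h2; lra.
Qed.

Lemma norm1_real (x : R) : norm1 x%:C = `|x|.
Proof. by rewrite /norm1 /= normr0 addr0. Qed.

Lemma norm1_conj z : norm1 z^* = norm1 z.
Proof. by case: z => a b; rewrite /norm1 /= normrN. Qed.

Lemma norm1_eq0 z : norm1 z <= 0 -> z = 0.
Proof.
case: z => a b; rewrite /norm1 /= => h.
have ha := normr_ge0 a; have hb := normr_ge0 b.
have /eqP : `|a| = 0 by lra.
have /eqP : `|b| = 0 by lra.
by rewrite !normr_eq0 => /eqP -> /eqP ->.
Qed.

Definition modulus z : R := complex.Re `|z|.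

Lemma modulusE z : `|z| = (modulus z)%:C.
Proof. by rewrite /modulus normc_def. Qed.

Lemma modulus_ge0 z : 0 <= modulus z.
Proof. by rewrite -lecR -modulusE; exact: normr_ge0. Qed.

Lemma modulus1 : modulus 1 = 1.
Proof. by apply: complexI; rewrite -modulusE normr1. Qed.

Lemma modulusM z w : modulus (z * w) = modulus z * modulus w.
Proof. by apply: complexI; rewrite rmorphM -!modulusE normrM. Qed.

Lemma modulus_le_norm1 z : modulus z <= norm1 z.
Proof.
rewrite /modulus normc_def/= /norm1.
rewrite -[leRHS]ger0_norm ?addr_ge0// -sqrtr_sqr ler_wsqrtr//.
rewrite sqrrD !real_normK ?num_real// lerD2r lerDl.
by rewrite mulrn_wge0// mulr_ge0.
Qed.

Lemma norm1_le_modulus z : norm1 z <= 2 * modulus z.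
Proof.
rewrite mulr_natl mulr2n /modulus normc_def /norm1 lerD//=.
  by rewrite -[leLHS]sqrtr_sqr ler_wsqrtr// lerDl sqr_ge0.
by rewrite -[leLHS]sqrtr_sqr ler_wsqrtr// lerDr sqr_ge0.
Qed.

Definition series_to (F : nat -> R[i]) (l : R[i]) := forall e : R, 0 < e ->
  exists n0, forall n, (n0 <= n)%N -> norm1 (\sum_(j < n) F j - l) <= e.

Lemma series_to_unique F l l' : series_to F l -> series_to F l' -> l = l'.
Proof.
move=> h h'; apply/eqP; rewrite -subr_eq0; apply/eqP/norm1_eq0.
rewrite leNgt; apply/negP => d0.
have d3 : 0 < norm1 (l - l') / 3 by rewrite divr_gt0.
have [n0 /(_ (maxn _ _) (leq_maxl _ _)) hn0] := h _ d3.
have [n1 /(_ (maxn _ _) (leq_maxr _ _)) hn1] := h' _ d3.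
have := norm1D (l - \sum_(j < maxn n0 n1) F j) (\sum_(j < maxn n0 n1) F j - l').
rewrite addrA subrK norm1B; move: (hn0 n1) (hn1 n0); lra.
Qed.

Lemma series_to_finite F n : (forall j, (n <= j)%N -> F j = 0) ->
  series_to F (\sum_(j < n) F j).
Proof.
move=> F0 e e0; exists n => m nm.
have -> : \sum_(j < m) F j = \sum_(j < n) F j.
  rewrite -!(big_mkord predT) (@big_cat_nat _ _ _ n)//= [X in _ + X]big_nat_cond.
  by rewrite [X in _ + X]big1 ?addr0// => i; rewrite andbT => /andP[/F0].
by rewrite subrr norm1_0 ltW.
Qed.

Lemma series_to_cvg F l : series_to F l <->
  ((\sum_(j < n) complex.Re (F j)) @[n --> \oo] --> complex.Re l /\
   (\sum_(j < n) complex.Im (F j)) @[n --> \oo] --> complex.Im l).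
Proof.
have ReS n : complex.Re (\sum_(j < n) F j) = \sum_(j < n) complex.Re (F j).
  by elim: n => [|n IH]; rewrite ?big_ord0// !big_ord_recr/= -IH; case: (\sum_(_ < _) _) (F n) => ? ? [].
have ImS n : complex.Im (\sum_(j < n) F j) = \sum_(j < n) complex.Im (F j).
  by elim: n => [|n IH]; rewrite ?big_ord0// !big_ord_recr/= -IH; case: (\sum_(_ < _) _) (F n) => ? ? [].
have E n : norm1 (\sum_(j < n) F j - l) =
    `|complex.Re l - \sum_(j < n) complex.Re (F j)| +
    `|complex.Im l - \sum_(j < n) complex.Im (F j)|.
  rewrite -ReS -ImS; case: l (\sum_(_ < _) _) => a b [c d].
  by rewrite /norm1 /= (distrC c) (distrC d).
split=> [h|[/cvgrPdist_le h1 /cvgrPdist_le h2] e e0].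
  split; apply/cvgrPdist_le => e /h [n0 hn0]; exists n0 => // n /= /hn0; rewrite E;
    apply: le_trans; by rewrite ?lerDl ?lerDr.
have e2 : 0 < e / 2 by rewrite divr_gt0.
have [n0 _ hn0] := h1 _ e2; have [n1 _ hn1] := h2 _ e2.
exists (maxn n0 n1) => n; rewrite geq_max => /andP[/hn0/= h3 /hn1/= h4].
by rewrite E; lra.
Qed.

Lemma series_to_dominated F (r : nat -> R) s : (forall j, norm1 (F j) <= r j) ->
  (forall n, \sum_(j < n) r j <= s) -> exists l, series_to F l.
Proof.
move=> Fr rs.
have cvgF (f : R[i] -> R) : (forall z, `|f z| <= norm1 z) ->
    cvgn (fun n => \sum_(j < n) f (F j)).
  move=> fN; rewrite (_ : (fun n => _) = series (f \o F)); last first.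
    by apply/funext => n; rewrite /series/= big_mkord.
  apply: normed_cvg; apply: nondecreasing_is_cvgn.
    by apply: nondecreasing_series => n _ _; exact: normr_ge0.
  exists s => _ [n _ <-]; rewrite /normed_series_of /series/= big_mkord.
  rewrite (le_trans _ (rs n))//; apply: ler_sum => j _.
  exact: le_trans (Fr j).
exists (limn (fun n => \sum_(j < n) complex.Re (F j)) +i*
        limn (fun n => \sum_(j < n) complex.Im (F j))).
apply/series_to_cvg; split; apply: cvgF => z; by rewrite ?lerDl ?lerDr.
Qed.

End complex_l1_norm.

(** * Normed algebras of functions and stability of localizability *)

Section function_algebra.
Context {R : realType} {Y : Type}.
Variable N : (Y -> R[i]) -> R -> Prop.
Implicit Types (F G X v w : Y -> R[i]) (r s : R).

(** [N F r] reads: F is in the algebra and has norm at most r. A relation avoids the infimum over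
    the representing measures. [fan_series] is completeness and countable subadditivity in one;
    finite sums, limits and monotonicity in r are derived from it. The factor 2 in [fan_bound]
    accounts for the real and the imaginary part, each bounded by r. *)
Record function_algebra_norm : Prop := FunctionAlgebraNorm {
  fan_ge0 : forall F r, N F r -> 0 <= r;
  fan_cst : forall c, N (fun=> c) (norm1 c);
  fan_mul : forall F G r s, N F r -> N G s -> N (fun y => F y * G y) (r * s);
  fan_series : forall (F : nat -> Y -> R[i]) (r : nat -> R) G s,
    (forall j, N (F j) (r j)) -> (forall n, \sum_(j < n) r j <= s) ->
    (forall y, series_to (F^~ y) (G y)) -> N G s;
  fan_bound : forall F r, N F r -> forall y, norm1 (F y) <= 2 * r;
  fan_conj : forall F r, N F r -> N (fun y => (F y)^*) r }.

Hypothesis HN : function_algebra_norm.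

Lemma fan_eq F G r : F =1 G -> N F r -> N G r.
Proof. by move=> /funext ->. Qed.

Lemma fan_sum n (F : nat -> Y -> R[i]) (r : nat -> R) s :
  (forall j, (j < n)%N -> N (F j) (r j)) -> \sum_(j < n) r j <= s ->
  N (fun y => \sum_(j < n) F j y) s.
Proof.
move=> hF rs.
pose F' j := if (j < n)%N then F j else fun=> 0.
pose r' j := if (j < n)%N then r j else 0.
apply: (@fan_series HN F' r') => [j|m|y].
- rewrite /F' /r'; case: ifPn => [/hF//|_].
  by rewrite -[X in N _ X](@norm1_0 R); exact: (fan_cst HN).
- rewrite (le_trans _ rs)//.
  have r0 j : (j < n)%N -> 0 <= r j by move=> /hF; exact: (fan_ge0 HN).
  have -> : \sum_(j < n) r j = \sum_(j < n) r' j.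
    by apply: eq_bigr => j _; rewrite /r' ltn_ord.
  have r'0 j : 0 <= r' j by rewrite /r'; case: ifP => // /r0.
  have [mn|nm] := leqP m n.
    rewrite -!(big_mkord predT r') [leRHS](@big_cat_nat _ _ _ m)//= lerDl.
    by apply: sumr_ge0.
  rewrite -!(big_mkord predT r') [leLHS](@big_cat_nat _ _ _ n)//= 1?ltnW//.
  rewrite [X in _ + X]big_nat_cond [X in _ + X]big1 ?addr0// => i.
  by rewrite andbT /r' => /andP[]; rewrite leqNgt => /negbTE ->.
- have -> : \sum_(j < n) F j y = \sum_(j < n) F' j y.
    by apply: eq_bigr => j _; rewrite /F' ltn_ord.
  apply: (@series_to_finite _ (F'^~ y)) => j nj.
  by rewrite /F' ltnNge nj.
Qed.

Lemma fan_le F r s : N F r -> r <= s -> N F s.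
Proof.
move=> NF rs; have -> : F = fun y => \sum_(j < 1) F y.
  by apply/funext => y; rewrite big_ord1.
by apply: (@fan_sum 1%N (fun=> F) (fun=> r)) => //; rewrite big_ord1.
Qed.

Lemma fan_add F G r s : N F r -> N G s -> N (fun y => F y + G y) (r + s).
Proof.
move=> NF NG.
have -> : (fun y => F y + G y) = fun y => \sum_(j < 2) (if j == 0%N :> nat then F else G) y.
  by apply/funext => y; rewrite big_ord_recl big_ord1.
apply: (@fan_sum 2 (fun j => if j == 0%N then F else G) (fun j => if j == 0%N then r else s)).
  by case=> [|[|]].
by rewrite big_ord_recl big_ord1.
Qed.

Lemma fan_scale c F r : N F r -> N (fun y => c * F y) (norm1 c * r).
Proof. by move=> NF; exact: (fan_mul HN (fan_cst HN c) NF). Qed.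

Lemma fan_exp F r m : N F r -> N (fun y => F y ^+ m) (r ^+ m).
Proof.
move=> NF; elim: m => [|m IH].
  by rewrite expr0 -[X in N _ X](@norm1_1 R); exact: (fan_cst HN).
have -> : (fun y => F y ^+ m.+1) = fun y => F y * F y ^+ m.
  by apply/funext => y; rewrite exprS.
by rewrite exprS; exact: (fan_mul HN).
Qed.

Lemma fan_lim (F : nat -> Y -> R[i]) G (r : nat -> R) r0 s :
  N (F 0%N) r0 -> (forall j, N (fun y => F j.+1 y - F j y) (r j)) ->
  (forall n, \sum_(j < n) r j <= s) ->
  (forall y (e : R), 0 < e ->
    exists n0, forall n, (n0 <= n)%N -> norm1 (F n y - G y) <= e) ->
  N G (r0 + s).
Proof.
move=> N0 NF rs FG.
pose F' j := if j is k.+1 then fun y => F k.+1 y - F k y else F 0%N.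
pose r' j := if j is k.+1 then r k else r0.
have sE n y : \sum_(j < n.+1) F' j y = F n y.
  elim: n => [|n IH]; first by rewrite big_ord1.
  by rewrite big_ord_recr/= IH addrC subrK.
apply: (@fan_series HN F' r') => [[|j]|n|y e e0]; [exact: N0|exact: NF| |].
  case: n => [|n]; last by rewrite big_ord_recl lerD2l; exact: rs.
  rewrite big_ord0 addr_ge0 ?(fan_ge0 HN N0)//.
  by rewrite (le_trans _ (rs 0%N))// big_ord0.
have [n0 hn0] := FG y e e0; exists n0.+1 => -[//|n] nn.
by rewrite sE; exact: hn0.
Qed.

(* X behaves like a function supported where |v| <= r (small_supp). *)
Definition small X v r := exists C, forall m, N (fun y => X y * v y ^+ m) (C * r ^+ m).

Lemma small_eq X X' v v' r : X =1 X' -> v =1 v' -> small X v r -> small X' v' r.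
Proof. by move=> /funext -> /funext ->. Qed.

(** Expanding (v + w)^m, the product bounds r^(m-k) s^k with their binomial coefficients add up to
    exactly (r + s)^m: the radii behave like suprema on a common support. *)
Lemma small_add X X' v w r s : small X v r -> small X' w s ->
  small (fun y => X y * X' y) (fun y => v y + w y) (r + s).
Proof.
move=> [C hC] [C' hC']; exists (C * C') => m.
have -> : (fun y => X y * X' y * (v y + w y) ^+ m) =
    fun y => \sum_(k < m.+1)
      'C(m, k)%:R * ((X y * v y ^+ (m - k)) * (X' y * w y ^+ k)).
  apply/funext => y; rewrite exprDn mulr_sumr; apply: eq_bigr => k _.
  rewrite -mulr_natl; ring.
apply: (@fan_sum m.+1 (fun k y => 'C(m, k)%:R * ((X y * v y ^+ (m - k)) * (X' y * w y ^+ k)))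
  (fun k => 'C(m, k)%:R * ((C * r ^+ (m - k)) * (C' * s ^+ k)))).
  move=> k _; have -> : 'C(m, k)%:R = norm1 ('C(m, k)%:R : R[i]).
    have -> : ('C(m, k)%:R : R[i]) = ('C(m, k)%:R : R)%:C by rewrite rmorph_nat.
    by rewrite norm1_real normr_nat.
  apply: fan_scale; apply: (fan_mul HN); [exact: hC|exact: hC'].
rewrite exprDn mulr_sumr ler_sum// => k _.
rewrite -[in leRHS]mulr_natl le_eqVlt; apply/orP; left; apply/eqP; ring.
Qed.

Lemma small_cst c : small (fun=> 1) (fun=> c) (norm1 c).
Proof.
exists 1 => m; rewrite [1 * norm1 c ^+ m]mul1r.
by apply: (fan_eq _ (fan_exp m (fan_cst HN c))) => y; rewrite mul1r.
Qed.

Lemma small_self F r : N F r -> small (fun=> 1) F r.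
Proof.
move=> NF; exists 1 => m; rewrite mul1r.
by apply: (fan_eq _ (fan_exp m NF)) => y; rewrite mul1r.
Qed.

Lemma small_ge0 X v r : small X v r -> exists2 C, 0 <= C &
  forall m, N (fun y => X y * v y ^+ m) (C * r ^+ m).
Proof.
move=> [C hC]; exists C => //.
by have := fan_ge0 HN (hC 0%N); rewrite expr0 mulr1.
Qed.

Lemma small_le X v r s : 0 <= r -> r <= s -> small X v r -> small X v s.
Proof.
move=> r0 rs /small_ge0[C C0 hC]; exists C => m.
apply: (fan_le (hC m)); rewrite ler_wpM2l// lerXn2r ?nnegrE//.
exact: le_trans rs.
Qed.

Lemma small_scale c X v r : small X v r -> small X (fun y => c * v y) (norm1 c * r).
Proof.
move=> [C hC]; exists C => m.
have := fan_mul HN (fan_exp m (fan_cst HN c)) (hC m).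
by rewrite exprMn mulrCA => /fan_eq; apply => y; rewrite exprMn mulrCA.
Qed.

Lemma small_conj X v r : small X v r -> small (fun y => (X y)^*) (fun y => (v y)^*) r.
Proof.
move=> [C hC]; exists C => m.
by apply: (fan_eq _ (fan_conj HN (hC m))) => y; rewrite rmorphM rmorphXn.
Qed.

Lemma power_bounded (a b C : R) : 0 < a -> 0 <= b -> (forall m, a * b ^+ m <= C) -> b <= 1.
Proof.
move=> a0 b0 hC; rewrite leNgt; apply/negP => b1.
have [x bE] : exists x, b = 1 + x by exists (b - 1); ring.
have x0 : 0 < x by lra.
have bern m : 1 + m%:R * x <= b ^+ m.
  elim: m => [|m IH]; first by rewrite mul0r addr0 expr0.
  have mx : 0 <= m%:R * x * x by rewrite !mulr_ge0// ltW.
  rewrite exprS (le_trans _ (ler_wpM2l b0 IH))// bE -(addn1 m) natrD.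
  lra.
have C0 : 0 <= C by rewrite (le_trans _ (hC 0%N))// mulr_ge0// ltW.
have := archi_boundP (divr_ge0 C0 (ltW (mulr_gt0 a0 x0))).
set m := Num.bound _; rewrite ltr_pdivrMr ?mulr_gt0// ltNge => /negP; apply.
have := hC m; apply: le_trans.
rewrite mulrCA ler_pM2l// (le_trans _ (bern m))//; lra.
Qed.

(** The norm bounds values, so |X(y)| (|v(y)|/r)^m is bounded in m; if X(y) is nonzero, the ratio
    cannot exceed 1. *)
Lemma small_supp X v r : 0 < r -> small X v r ->
  forall y, X y != 0 -> modulus (v y) <= r.
Proof.
move=> r0 /small_ge0[C C0 hC] y Xy.
have Xy0 : 0 < modulus (X y) by rewrite -ltcR -modulusE normr_gt0.
have h m : modulus (X y) * (modulus (v y) / r) ^+ m <= 2 * C.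
  rewrite expr_div_n [modulus _ * _]mulrA ler_pdivrMr ?exprn_gt0//.
  have := fan_bound HN (hC m) y.
  rewrite mulrA => /(le_trans _); apply.
  have := modulus_le_norm1 (X y * v y ^+ m).
  suff -> : modulus (X y * v y ^+ m) = modulus (X y) * modulus (v y) ^+ m by [].
  by rewrite modulusM; congr (_ * _); elim: m => [|m IH];
    rewrite ?modulus1// !exprS modulusM IH.
have := power_bounded Xy0 (divr_ge0 (modulus_ge0 _) (ltW r0)) h.
by rewrite ler_pdivrMr// mul1r.
Qed.

(* A partition of unity X_i into functions of the algebra with F within d of x_i on
   the support of X_i, in the strong sense of small. *)
Definition localizable F := forall d : R, 0 < d ->
  exists (I : finType) (X : I -> Y -> R[i]) (x : I -> R[i]),
    (forall y, \sum_i X i y = 1) /\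
    forall i, small (X i) (fun y => F y - x i) d.

Lemma localizable_add F G : localizable F -> localizable G ->
  localizable (fun y => F y + G y).
Proof.
move=> hF hG d d0; have d2 : 0 < d / 2 by rewrite divr_gt0.
have [I [X [x [X1 Xs]]]] := hF _ d2; have [J [Z [z [Z1 Zs]]]] := hG _ d2.
exists (I * J)%type, (fun k y => X k.1 y * Z k.2 y), (fun k => x k.1 + z k.2).
split=> [y|[i j]/=].
  rewrite -(pair_bigA _ (fun i j => X i y * Z j y))/= -[RHS](X1 y).
  by apply: eq_bigr => i _; rewrite -mulr_sumr Z1 mulr1.
have := small_add (Xs i) (Zs j); rewrite -splitr.
by move=> /small_eq; apply=> // y; rewrite addrACA opprD.
Qed.

Lemma localizable_scale c F : localizable F -> localizable (fun y => c * F y).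
Proof.
move=> hF d d0.
have c0 : 0 < norm1 c + 1 by rewrite ltr_pwDr ?norm1_ge0.
have [I [X [x [X1 Xs]]]] := hF _ (divr_gt0 d0 c0).
exists I, X, (fun i => c * x i); split=> // i.
have := small_scale c (Xs i).
have -> : (fun y => c * (F y - x i)) = fun y => c * F y - c * x i.
  by apply/funext => y; rewrite mulrBr.
apply: small_le.
  by rewrite mulr_ge0 ?norm1_ge0// divr_ge0 ?ltW.
by rewrite mulrA ler_pdivrMr// mulrC ler_pM2l// lerDl.
Qed.

Lemma localizable_conj F : localizable F -> localizable (fun y => (F y)^*).
Proof.
move=> hF d d0; have [I [X [x [X1 Xs]]]] := hF _ d0.
exists I, (fun i y => (X i y)^*), (fun i => (x i)^*); split=> [y|i].
  by rewrite -rmorph_sum X1 rmorph1.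
by apply: (small_eq _ _ (small_conj (Xs i))) => // y; rewrite rmorphB.
Qed.

(** F differs from G by an element of norm e, which is small of radius e with X = 1. The partition
    of unity of G therefore serves F as well, the two radii being added. *)
Lemma localizable_lim F :
  (forall e : R, 0 < e -> exists2 G, localizable G & N (fun y => F y - G y) e) ->
  localizable F.
Proof.
move=> hF d d0; have d2 : 0 < d / 2 by rewrite divr_gt0.
have [G lG NG] := hF _ d2; have [I [X [x [X1 Xs]]]] := lG _ d2.
exists I, X, x; split=> // i.
have := small_add (small_self NG) (Xs i); rewrite -splitr.
by move=> /small_eq; apply=> y; rewrite ?mul1r// addrA subrK.
Qed.

Lemma localizable_cst c : localizable (fun=> c).
Proof.
move=> d d0; exists 'I_1, (fun _ _ => 1), (fun=> c); split=> [y|i].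
  by rewrite big_ord1.
apply: (@small_le _ _ 0) => //; first exact: ltW.
rewrite -(@norm1_0 R); apply: (small_eq _ _ (small_cst 0)) => // y.
by rewrite subrr.
Qed.

Lemma localizable_sum n (F : nat -> Y -> R[i]) :
  (forall j, (j < n)%N -> localizable (F j)) ->
  localizable (fun y => \sum_(j < n) F j y).
Proof.
elim: n => [|n IH] h.
  by under eq_fun do rewrite big_ord0; exact: localizable_cst.
under eq_fun do rewrite big_ord_recr/=.
apply: localizable_add; last exact: h.
by apply: IH => j jn; apply: h; rewrite ltnS ltnW.
Qed.

End function_algebra.

(** * Chebyshev calculus of tempered functions *)

Section tempered_functions.
Context {R : realType} {Y : Type}.
Variable N : (Y -> R[i]) -> R -> Prop.
Hypothesis HN : function_algebra_norm N.

(* The Chebyshev polynomial T_k(cos t) = cos(k t) plays the part of exp(i k t) in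
   the usual calculus of elements whose group exp(i k p) has polynomial growth. *)
Definition tempered (p : Y -> R) := (forall y, -1 <= p y <= 1) /\
  exists (C : R) (a : nat), forall k,
    N (fun y => ((cheb k).[p y])%:C) (C * k.+1%:R ^+ a).

Lemma tempered_poly (p : Y -> R) : tempered p -> exists (C : R) (a : nat), 0 <= C /\
  forall D (Q : {poly R}) (M : R), (size Q <= D)%N ->
    (forall t : R, -1 <= t <= 1 -> `|Q.[t]| <= M) ->
    N (fun y => (Q.[p y])%:C) (C * D%:R ^+ a * M).
Proof.
move=> [p1 [C [a hC]]].
have C0 : 0 <= C.
  by have := fan_ge0 HN (hC 0%N); rewrite expr1n mulr1.
exists (2 * C), a.+1; split; first by rewrite mulr_ge0.
move=> D Q M sQ QM; have [c cE] := cheb_span sQ.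
have M0 : 0 <= M by apply: le_trans (QM 0 _) => //; apply/andP; split; lra.
have cM : forall l, (l < D)%N -> `|c l| <= 2 * M.
  by apply: cheb_coef_bound => t; rewrite -cE; exact: QM.
have -> : (fun y => (Q.[p y])%:C) =
    fun y => \sum_(k < D) ((c k)%:C * ((cheb k).[p y])%:C).
  apply/funext => y; rewrite {1}cE horner_sum rmorph_sum.
  by apply: eq_bigr => k _; rewrite hornerZ rmorphM.
apply: (@fan_sum _ _ _ HN D (fun k y => (c k)%:C * ((cheb k).[p y])%:C)
  (fun k => 2 * M * (C * D%:R ^+ a))).
  move=> k kD; apply: (fan_le HN (fan_scale HN (c k)%:C (hC k))).
  rewrite norm1_real; apply: ler_pM => //; first by rewrite mulr_ge0 ?exprn_ge0.
    exact: cM.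
  by rewrite ler_wpM2l// lerXn2r ?nnegrE// ler_nat.
rewrite sumr_const card_ord -mulr_natl exprS.
by rewrite le_eqVlt; apply/orP; left; apply/eqP; ring.
Qed.

(** (n+1)^a is at most the falling factorial (a+n)...(n+1), that is a! times a binomial coefficient
    below 2^(a+n). In this form the polynomial loss in the degree is paid by a geometric gain in
    accuracy. *)
Lemma pow_le_exp2 a : exists2 C : R, 0 <= C & forall n, n.+1%:R ^+ a <= C * 2 ^+ n.
Proof.
exists (a`!%:R * 2 ^+ a); first by rewrite mulr_ge0// exprn_ge0.
move=> n; rewrite -mulrA -exprD -!natrX -natrM ler_nat.
have h : (n.+1 ^ a <= (a + n) ^_ a)%N.
  elim: a => [|a IH]; first by rewrite ffactn0.
  by rewrite expnS addSn ffactSS leq_mul// ltnS leq_addl.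
rewrite (leq_trans h)// -bin_ffact mulnC leq_mul2l; apply/orP; right.
have -> : (2 ^ (a + n) = \sum_(i < (a + n).+1) 'C(a + n, i))%N.
  rewrite -[X in (X ^ _)%N]/(1 + 1)%N expnDn.
  by apply: eq_bigr => i _; rewrite !exp1n !muln1.
have h1 : (a < (a + n).+1)%N by rewrite ltnS leq_addr.
by rewrite (bigD1 (Ordinal h1))//= leq_addr.
Qed.

Lemma half_pow_small (B e : R) : 0 < e -> exists n0, forall n, (n0 <= n)%N ->
  B * 2^-1 ^+ n <= e.
Proof.
move=> e0; exists (Num.bound (`|B| / e)) => n hn.
have h := archi_boundP (divr_ge0 (normr_ge0 B) (ltW e0)).
rewrite (le_trans (ler_norm _))// normrM (ger0_norm (exprn_ge0 _ _))// exprVn.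
rewrite ler_pdivrMr ?exprn_gt0// mulrC -ler_pdivrMr//.
rewrite (le_trans (ltW h))// -natrX ler_nat (leq_trans hn)// ltnW//.
exact: ltn_expl.
Qed.

Lemma half_sum n : \sum_(j < n) 2^-1 ^+ j = 2 - 2 * 2^-1 ^+ n :> R.
Proof.
elim: n => [|n IH]; first by rewrite big_ord0 expr0; lra.
by rewrite big_ord_recr/= IH exprS; lra.
Qed.

(** The exponent 6 is the one that [cutoff] provides. *)
Definition approximable (chi : R -> R) := exists (P : nat -> {poly R}) (K : nat) (A : R),
  (forall n, (size (P n) <= K * n.+1 ^ 6)%N) /\
  forall (t : R) n, -1 <= t <= 1 -> `|chi t - (P n).[t]| <= A * 2^-1 ^+ n.

Lemma approximable_cst (c : R) : approximable (fun=> c).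
Proof.
exists (fun=> c%:P), 1%N, 0; split=> [n|t n _].
  by rewrite (leq_trans (size_polyC_leq1 _))// mul1n expn_gt0.
by rewrite hornerC subrr normr0 mul0r.
Qed.

Lemma approximable_sub (f g : R -> R) : approximable f -> approximable g ->
  approximable (fun t => f t - g t).
Proof.
move=> [P [K [A [sP hP]]]] [Q [L [B [sQ hQ]]]].
exists (fun n => P n - Q n), (K + L)%N, (A + B); split=> [n|t n ht].
  rewrite (leq_trans (size_polyD _ _))// size_polyN geq_max mulnDl.
  by rewrite (leq_trans (sP n)) ?leq_addr// (leq_trans (sQ n)) ?leq_addl.
rewrite hornerD hornerN mulrDl.
have -> : f t - g t - ((P n).[t] - (Q n).[t]) =
  (f t - (P n).[t]) - (g t - (Q n).[t]) by ring.
by rewrite (le_trans (ler_normB _ _))// lerD ?hP ?hQ.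
Qed.

Lemma poly_bounded (P : {poly R}) : exists B : R, forall t : R, -1 <= t <= 1 ->
  `|P.[t]| <= B.
Proof.
exists (\sum_(i < size P) `|P`_i|) => t ht.
rewrite horner_coef (le_trans (ler_norm_sum _ _ _))//; apply: ler_sum => i _.
rewrite normrM normrX ler_piMr// exprn_ile1// ler_norml//.
Qed.

(** The polynomial approximation of chi(t)(t - x)^m starts at accuracy d^m instead of a fixed one,
    so that the approximants are O(d^m) in supremum norm. Passing to the norm of the algebra costs a
    power of the degree, absorbed in a constant times 2^(m+j): this turns d into 2d. *)
Lemma small_cutoff (p : Y -> R) (chi : R -> R) (x d : R) : tempered p ->
  approximable chi -> -1 <= x <= 1 -> 0 < d -> d <= 1 ->
  (forall t : R, -1 <= t <= 1 -> d < `|t - x| -> chi t = 0) ->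
  small N (fun y => (chi (p y))%:C) (fun y => (p y)%:C - x%:C) (2 * d).
Proof.
move=> tp [P [K [A [sP hP]]]] x1 d0 d1 chi0.
have p1 := tp.1.
have z1 : -1 <= (0 : R) <= 1 by apply/andP; split; lra.
have A0 : 0 <= A.
  by have := hP 0 0%N z1; rewrite expr0 mulr1; exact: le_trans.
have [B hB] := poly_bounded (P 0%N).
have chiB t : -1 <= t <= 1 -> `|chi t| <= A + B.
  move=> ht; have := hP t 0%N ht; have := hB t ht.
  have := ler_normD (chi t - (P 0%N).[t]) (P 0%N).[t].
  by rewrite subrK expr0; lra.
have AB0 : 0 <= A + B by apply: le_trans (chiB 0 z1).
have [L0 hL0] := half_pow_small 4 d0.
pose L := maxn L0 2.
pose rho : R := 2^-1 ^+ L.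
have rho0 : 0 < rho by rewrite exprn_gt0.
have rhod : 4 * rho <= d by apply: hL0; rewrite leq_maxl.
have rj j : 2^-1 ^+ (L * j) = rho ^+ j :> R by rewrite exprM.
have [C [a [C0 hC]]] := tempered_poly tp.
pose K' := (K * L.+1 ^ 6).+1.
have [C2 C20 hC2] := pow_le_exp2 (6 * a).
pose C3 := C * K'%:R ^+ a * C2.
have C30 : 0 <= C3 by rewrite !mulr_ge0// exprn_ge0.
have polyN (n : nat) (Q : {poly R}) (M : R) : (size Q <= K' * n.+1 ^ 6)%N ->
    (forall t : R, -1 <= t <= 1 -> `|Q.[t]| <= M) ->
    N (fun y => (Q.[p y])%:C) (C3 * 2 ^+ n * M).
  move=> sQ QM; apply: (fan_le HN (hC _ Q M sQ QM)).
  have M0 : 0 <= M by apply: le_trans (QM 0 z1).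
  apply: ler_wpM2r => //; rewrite /C3 -!mulrA; apply: ler_wpM2l => //.
  rewrite natrM exprMn; apply: ler_wpM2l; first exact: exprn_ge0.
  by rewrite natrX -exprM.
(* The index grows with m as well as with j: the error is then A (2 rho)^m rho^j, already below A
   d^m at j = 0. *)
pose Q m j := ('X - x%:P) ^+ m * P (L * (m + j))%N.
have sQ m j : (size (Q m j) <= K' * (m + j).+1 ^ 6)%N.
  rewrite (leq_trans (size_polyMleq _ _))// size_exp_XsubC addSn/=.
  rewrite /K' mulSn leq_add//.
    rewrite (@leq_trans (m + j).+1)//; first by rewrite leqW// leq_addr.
    by rewrite -[leqLHS]expn1 leq_pexp2l.
  rewrite (leq_trans (sP _))// -mulnA -expnMn leq_mul2l leq_exp2r//.
  apply/orP; right; rewrite mulSn addSn ltnS (leq_trans _ (leq_addl _ _))//.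
  by rewrite leq_mul2l leqnSn orbT.
have hx m (t : R) : -1 <= t <= 1 -> `|t - x| ^+ m <= 2 ^+ m.
  move=> /andP[t0 t1]; move/andP: x1 => [x0 x1].
  by rewrite lerXn2r ?nnegrE// ler_norml; apply/andP; split; lra.
have hQ m j (t : R) : -1 <= t <= 1 ->
    `|chi t * (t - x) ^+ m - (Q m j).[t]| <= A * (2 * rho) ^+ m * rho ^+ j.
  move=> ht; rewrite /Q hornerM horner_exp hornerXsubC.
  rewrite [_ ^+ m * _.[_]]mulrC -mulrBl normrM normrX.
  have -> : A * (2 * rho) ^+ m * rho ^+ j = (A * rho ^+ (m + j)) * 2 ^+ m.
    by rewrite exprMn exprD; ring.
  by apply: ler_pM => //; [rewrite -rj; exact: hP|exact: hx].
have rho1 : 2 * rho <= 2^-1 by lra.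
exists (C3 * (A + A + B) + 8 * (C3 * A)) => m.
have N0 : N (fun y => ((Q m 0%N).[p y])%:C) (C3 * 2 ^+ m * ((A + A + B) * d ^+ m)).
  have := sQ m 0%N; rewrite addn0 => /polyN; apply => t ht.
  have h := hQ m 0%N t ht; rewrite expr0 mulr1 in h.
  have h1 : A * (2 * rho) ^+ m <= A * d ^+ m.
    by apply: ler_wpM2l => //; rewrite lerXn2r ?nnegrE//; lra.
  have h2 : `|chi t * (t - x) ^+ m| <= (A + B) * d ^+ m.
    have [td|td] := ltP d `|t - x|.
      by rewrite chi0// mul0r normr0 mulr_ge0// exprn_ge0// ltW.
    by rewrite normrM normrX ler_pM ?chiB// lerXn2r ?nnegrE// ltW.
  have := ler_normB (chi t * (t - x) ^+ m) (chi t * (t - x) ^+ m - (Q m 0%N).[t]).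
  by rewrite subKr; lra.
have ND j : N (fun y => ((Q m j.+1).[p y])%:C - ((Q m j).[p y])%:C)
    (C3 * 2 ^+ (m + j).+1 * (2 * (A * (2 * rho) ^+ m * rho ^+ j))).
  have := @polyN (m + j).+1 (Q m j.+1 - Q m j) (2 * (A * (2 * rho) ^+ m * rho ^+ j)).
  have -> : (fun y => ((Q m j.+1 - Q m j).[p y])%:C) =
      fun y => ((Q m j.+1).[p y])%:C - ((Q m j).[p y])%:C.
    by apply/funext => y; rewrite hornerD hornerN rmorphB.
  apply.
    rewrite (leq_trans (size_polyD _ _))// size_polyN geq_max -addnS sQ/=.
    by rewrite (leq_trans (sQ _ _))// leq_mul2l leq_exp2r// addnS leqnSn orbT.
  move=> t ht; have h := hQ m j t ht; have h1 := hQ m j.+1 t ht.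
  have h2 : A * (2 * rho) ^+ m * rho ^+ j.+1 <= A * (2 * rho) ^+ m * rho ^+ j.
    rewrite exprS ler_wpM2l ?ler_piMl ?exprn_ge0 ?mulr_ge0 ?exprn_ge0//; lra.
  rewrite hornerD hornerN.
  have := ler_normB (chi t * (t - x) ^+ m - (Q m j).[t])
    (chi t * (t - x) ^+ m - (Q m j.+1).[t]).
  have -> : chi t * (t - x) ^+ m - (Q m j).[t] -
    (chi t * (t - x) ^+ m - (Q m j.+1).[t]) = (Q m j.+1).[t] - (Q m j).[t] by ring.
  lra.
have h := @fan_lim _ _ _ HN (fun j y => ((Q m j).[p y])%:C)
  (fun y => (chi (p y))%:C * ((p y)%:C - x%:C) ^+ m) _ _ (8 * (C3 * A) * d ^+ m) N0 ND.
apply: (fan_le HN (h _ _)).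
- move=> n.
  have E j : C3 * 2 ^+ (m + j).+1 * (2 * (A * (2 * rho) ^+ m * rho ^+ j)) <=
      4 * (C3 * A) * d ^+ m * 2^-1 ^+ j.
    have -> : C3 * 2 ^+ (m + j).+1 * (2 * (A * (2 * rho) ^+ m * rho ^+ j)) =
        4 * (C3 * A) * ((4 * rho) ^+ m * (2 * rho) ^+ j).
      have -> : 4 * rho = 2 * (2 * rho) by ring.
      by rewrite !exprMn exprS exprD; ring.
    rewrite -[leRHS]mulrA; apply: ler_wpM2l; first by rewrite !mulr_ge0.
    have [r4 r2 d0'] : [/\ 0 <= 4 * rho, 0 <= 2 * rho & 0 <= d] by split; lra.
    by apply: ler_pM; rewrite ?exprn_ge0//; apply: lerXn2r; rewrite ?nnegrE.
  rewrite (@le_trans _ _ (\sum_(j < n) 4 * (C3 * A) * d ^+ m * 2^-1 ^+ j))//.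
    by apply: ler_sum => j _; exact: E.
  rewrite -mulr_sumr half_sum.
  have : 0 <= C3 * A * d ^+ m by rewrite !mulr_ge0// exprn_ge0// ltW.
  have : 0 <= 2^-1 ^+ n :> R by rewrite exprn_ge0.
  nra.
- move=> y e e0.
  have [n0 hn0] := half_pow_small (A * (2 * rho) ^+ m) e0.
  exists n0 => n /hn0; apply: le_trans.
  rewrite -rmorphB -rmorphXn -rmorphM -rmorphB norm1_real distrC.
  apply: (le_trans (hQ _ _ _ (p1 y))); have r2 : 0 <= 2 * rho by lra.
  apply: ler_wpM2l; first by rewrite mulr_ge0// exprn_ge0.
  by apply: lerXn2r; rewrite ?nnegrE; lra.
have d2 : 2 ^+ m * d ^+ m = (2 * d) ^+ m by rewrite exprMn.
have d3 : d ^+ m <= (2 * d) ^+ m.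
  by apply: lerXn2r; rewrite ?nnegrE; lra.
have : 8 * (C3 * A) * d ^+ m <= 8 * (C3 * A) * (2 * d) ^+ m.
  by rewrite ler_wpM2l ?mulr_ge0.
by rewrite -d2; lra.
Qed.

End tempered_functions.

Section tempered_localizable.
Context {R : realType} {Y : Type}.
Variable N : (Y -> R[i]) -> R -> Prop.
Hypothesis HN : function_algebra_norm N.

Lemma tempered_localizable (p : Y -> R) : tempered N p ->
  localizable N (fun y => (p y)%:C).
Proof.
move=> tp d d0.
(* The mesh of the subdivision of [-1, 1] is 2/n; the other factor 2 is the one lost in
   [small_cutoff]. *)
have [n [n2 nd]] : exists n, (2 <= n)%N /\ 2 * (2 / n%:R) <= d :> R.
  exists (maxn 2 (Num.bound (4 / d))); split; first exact: leq_maxl.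
  have h := archi_boundP (divr_ge0 (ler0n R 4) (ltW d0)).
  set k := maxn _ _.
  have k0 : 0 < k%:R :> R by rewrite ltr0n /k; lia.
  rewrite mulrA -natrM ler_pdivrMr// mulrC -ler_pdivrMr//.
  by rewrite (le_trans (ltW h))// ler_nat leq_maxr.
have n0 : 0 < n%:R :> R by rewrite ltr0n; lia.
pose w : R := 2 / n%:R; have w0 : 0 < w by rewrite divr_gt0.
have nw : n%:R * w = 2 by rewrite /w mulrCA divff ?mulr1// gt_eqF.
have w1 : w <= 1 by rewrite ler_pdivrMr// mul1r ler_nat.
pose g (k : nat) : R := -1 + k%:R * w.
have gS k : g k.+1 = g k + w by rewrite /g -(addn1 k) natrD; ring.
have g_le k l : (k <= l)%N -> g k <= g l.
  by move=> kl; rewrite /g lerD2l ler_pM2r// ler_nat.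
have g0 : g 0%N = -1 by rewrite /g mul0r addr0.
have gn : g n = 1 by rewrite /g nw; lra.
(* [s k] rises from 0 at g k - w to 1 at g k. With s 0 = 1 and s (n+1) = 0 on [-1, 1] the
   differences s i - s (i+1) telescope to 1, and each vanishes at distance more than w from g i. *)
have hs k : exists s : R -> R, (k <= n.+1)%N -> approximable s /\
    forall t : R, -1 <= t <= 1 -> (t <= g k - w -> s t = 0) /\ (g k <= t -> s t = 1).
  case: k => [|k].
    exists (fun=> 1) => _; split; first exact: approximable_cst.
    by move=> t /andP[t0 t1]; rewrite g0; split=> // ?; lra.
  have [kn|nk|->] := ltngtP k n; last first.
  - exists (fun=> 0) => _; split; first exact: approximable_cst.
    by move=> t /andP[t0 t1]; rewrite gS gn; split=> // ?; lra.
  - by exists (fun=> 0); rewrite ltnS leqNgt nk.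
  have := @cutoff R (g k) (g k.+1).
  have := g_le _ _ (leq0n k); have := g_le _ _ kn; have := gS k.
  rewrite g0 gn => e h1 h2 [//||//|P [s [K [sP hP]]]]; first by lra.
  exists s => _; split; first exists P, K, 8.
    by split=> // t m ht; have [] := hP t ht.
  move=> t ht; have [_ h3 h4] := hP t ht; split=> // ?; apply: h3; lra.
have {hs} [s hs] := boolp.choice hs.
exists 'I_n.+1, (fun (i : 'I_n.+1) y => (s i (p y) - s i.+1 (p y))%:C),
  (fun i : 'I_n.+1 => (g i)%:C).
split=> [y|[i/= ilt]].
  rewrite -rmorph_sum.
  have tel m : \sum_(i < m) (s i (p y) - s i.+1 (p y)) = s 0%N (p y) - s m (p y).
    elim: m => [|m IH]; first by rewrite big_ord0 subrr.
    by rewrite big_ord_recr/= IH addrA subrK.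
  rewrite tel.
  have [_ h0] := hs 0%N isT; have [_ h1] := hs n.+1 (leqnn _).
  have py := tp.1 y; have /andP[p0 p1] := py.
  rewrite (h0 _ py).2 ?g0// (h1 _ py).1 ?subr0//.
  by rewrite gS gn; lra.
have w2 : 0 <= 2 * w by rewrite mulr_ge0// ltW.
apply: (small_le HN w2 nd).
have [ai hi] := hs i (ltnW ilt); have [aS hS] := hs i.+1 ilt.
have gi : -1 <= g i <= 1.
  by rewrite -{1}g0 -gn !g_le.
apply: (@small_cutoff _ _ _ HN p (fun t => s i t - s i.+1 t)) => //.
  exact: approximable_sub.
move=> t ht wt.
have [h1 h2] := hi t ht; have [h3 h4] := hS t ht.
move: wt; have [ti|ti] := leP 0 (t - g i) => wt.
  rewrite (ger0_norm ti) in wt; have e := gS i.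
  by rewrite h2 ?h4 ?subrr//; lra.
rewrite (ltr0_norm ti) in wt; have e := gS i.
by rewrite h1 ?h3 ?subrr//; lra.
Qed.

End tempered_localizable.

(** * Functional calculus *)

Section power_series.
Context {R : realType}.

Lemma norm_lt_parts (z : R[i]) (e : R) : `|z| < e%:C ->
  `|complex.Re z| <= e /\ `|complex.Im z| <= e.
Proof.
move=> ze; have h := ltW ze; split.
  by rewrite -lecR (le_trans _ h)//; exact: normc_ge_Re.
rewrite -lecR (le_trans _ h)// normc_def lecR -[leLHS]sqrtr_sqr ler_wsqrtr// lerDr.
exact: sqr_ge0.
Qed.

Lemma norm_lt_norm1 (z : R[i]) (e : R) : `|z| < e%:C -> norm1 z <= 2 * e.
Proof. by move=> /norm_lt_parts[h1 h2]; rewrite /norm1; lra. Qed.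

Lemma partial_sumE (I : choiceType) (x : I -> R[i]) (A : {fset I}) :
  partial_sum x A = \sum_(i <- A) x i.
Proof. by rewrite /partial_sum big_seq_fsetE. Qed.

Lemma partial_sum_fset (I : choiceType) (x : I -> R[i]) (s : seq I) : uniq s ->
  partial_sum x [fset i in s]%fset = \sum_(i <- s) x i.
Proof.
rewrite partial_sumE; elim: s => [|a s IH] /=; first by rewrite fset_nil !big_nil.
move=> /andP[sa us]; rewrite big_cons -IH// fset_cons big_fsetU1//.
by rewrite inE.
Qed.

(** The pairs of total degree below n, listed by antidiagonals. Along these finite sets the
    unordered sum becomes an ordinary series indexed by the total degree. *)
Definition triangle (n : nat) : seq (nat * nat) :=
  [seq (k, (j - k)%N) | j <- iota 0 n, k <- iota 0 j.+1].

Lemma triangle_uniq n : uniq (triangle n).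
Proof.
apply: allpairs_uniq_dep; first exact: iota_uniq.
  by move=> x _; exact: iota_uniq.
move=> _ _ /allpairsPdep[j [k [_ hk ->]]] /allpairsPdep[j' [k' [_ hk' ->]]] /=.
move: hk hk'; rewrite !mem_iota !add0n => /andP[_ hk] /andP[_ hk'] [kk jj].
by move: hk hk' jj; rewrite -kk => hk hk' jj; have -> : j = j' by lia.
Qed.

Lemma mem_triangle n (p : nat * nat) : (p \in triangle n) = (p.1 + p.2 < n)%N.
Proof.
case: p => a b /=; apply/allpairsPdep/idP => [[j [k [hj hk [-> ->]]]]|h].
  by move: hj hk; rewrite !mem_iota !add0n => /andP[_ ?] /andP[_ ?]; lia.
exists (a + b)%N, a; rewrite !mem_iota !add0n; split=> //; first by lia.
by rewrite addKn.
Qed.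

Lemma partial_sum_triangle (f : nat -> nat -> R[i]) n :
  partial_sum (fun p : nat * nat => f p.1 p.2) [fset p in triangle n]%fset =
  \sum_(j < n) \sum_(k < j.+1) f k (j - k)%N.
Proof.
rewrite partial_sum_fset ?triangle_uniq// big_allpairs_dep/=.
rewrite -(big_mkord predT (fun j => \sum_(k < j.+1) f k (j - k)%N)).
rewrite /index_iota subn0; apply: eq_bigr => j _.
by rewrite -(big_mkord predT (fun k => f k (j - k)%N)) /index_iota subn0.
Qed.

Lemma totally_series_to (f : nat -> nat -> R[i]) (l : R[i]) :
  partial_sum (fun p : nat * nat => f p.1 p.2) @ totally --> (l : R[i]^o) ->
  series_to (fun j => \sum_(k < j.+1) f k (j - k)%N) l.
Proof.
move=> /(@cvgrPdist_lt _ R[i]^o) h e e0.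
have e2 : 0 < (e / 2)%:C :> R[i] by rewrite ltcR divr_gt0.
have [A _ hA] := h (@filter_filter _ _ totally_filter) _ e2.
(* This bound exceeds the total degree of every pair of [A], so that the triangle contains [A]. *)
exists (\sum_(p : A) ((val p).1 + (val p).2).+1)%N => n hn.
have sA : (A `<=` [fset p in triangle n])%fset.
  apply/fsubsetP => p pA; rewrite inE/= mem_triangle (leq_trans _ hn)//.
  by rewrite (bigD1 [` pA]%fset)//= leq_addr.
have := hA _ sA; rewrite /= partial_sum_triangle => /norm_lt_norm1.
by rewrite norm1B mulrC divfK ?pnatr_eq0.
Qed.

(** A term outside a suitable finite set A is the difference of two partial sums, over A and over A
    with one more index, both within 1 of the limit; [norm1] at most doubles these distances, whence
    4. The finitely many terms in A are bounded by their sum. *)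
Lemma totally_terms_bounded (f : nat -> nat -> R[i]) (l : R[i]) :
  partial_sum (fun p : nat * nat => f p.1 p.2) @ totally --> (l : R[i]^o) ->
  exists B : R, forall k n, norm1 (f k n) <= B.
Proof.
move=> /(@cvgrPdist_lt _ R[i]^o) h.
have e2 : 0 < (1 : R)%:C :> R[i] by rewrite ltcR.
have [A _ hA] := h (@filter_filter _ _ totally_filter) _ e2.
exists (4 + \sum_(p : A) norm1 (f (val p).1 (val p).2)) => k n.
have S0 : 0 <= \sum_(p : A) norm1 (f (val p).1 (val p).2).
  by apply: sumr_ge0 => p _; exact: norm1_ge0.
have [kA|kA] := boolP ((k, n) \in A).
  rewrite (bigD1 [` kA]%fset)//= addrCA lerDl addr_ge0//.
  by apply: sumr_ge0 => p _; exact: norm1_ge0.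
have h1 := norm_lt_norm1 (hA _ (fsubset_refl A)).
have h2 := norm_lt_norm1 (hA _ (fsubsetUr [fset (k, n)] A)%fset).
move: h1 h2; rewrite !partial_sumE.
rewrite big_fsetU1//=; set S := \sum_(i <- A) _ => h1 h2.
have := norm1D (l - S) (- (l - (f k n + S))).
have -> : l - S + - (l - (f k n + S)) = f k n by ring.
rewrite norm1N; lra.
Qed.

Lemma min_pos (T : eqType) (s : seq T) (rho : T -> R) :
  (forall x, x \in s -> 0 < rho x) ->
  exists2 e : R, 0 < e & forall x, x \in s -> e <= rho x.
Proof.
elim: s => [|a s IH] h; first by exists 1.
have [|e e0 he] := IH; first by move=> x xs; apply: h; rewrite inE xs orbT.
have a0 : 0 < rho a by apply: h; rewrite mem_head.
exists (Num.min e (rho a)); first by rewrite lt_min e0.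
move=> x; rewrite inE => /predU1P[->|xs]; first by rewrite ge_min lexx orbT.
by rewrite ge_min he.
Qed.

End power_series.

(** * Power series on the cells of a partition of unity *)

Section functional_calculus.
Context {R : realType} {Y : Type}.
Variable N : (Y -> R[i]) -> R -> Prop.
Hypothesis HN : function_algebra_norm N.

Lemma fan_fin_sum (I : finType) (G : I -> Y -> R[i]) :
  (forall i, exists s, N (G i) s) -> exists s, N (fun y => \sum_i G i y) s.
Proof.
move=> h; elim: (index_enum I) => [|i r [s hs]].
  exists (norm1 (0 : R[i])); apply: (fan_eq _ (fan_cst HN 0)) => y.
  by rewrite big_nil.
have [t ht] := h i; exists (t + s).
by apply: (fan_eq _ (fan_add HN ht hs)) => y; rewrite big_cons.
Qed.

Lemma localizable_Re (F : Y -> R[i]) : localizable N F ->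
  localizable N (fun y => (complex.Re (F y))%:C).
Proof.
move=> lF.
have := localizable_scale HN 2^-1%:C (localizable_add HN lF (localizable_conj HN lF)).
congr localizable; apply/funext => y; case: (F y) => a b.
apply/eqP; rewrite eq_complex/= !mul0r !subr0 addr0 subrr mulr0 eqxx andbT.
by apply/eqP; field.
Qed.

Lemma localizable_Im (F : Y -> R[i]) : localizable N F ->
  localizable N (fun y => (complex.Im (F y))%:C).
Proof.
move=> lF.
have := localizable_add HN (localizable_scale HN (0 +i* (- 2^-1)) lF)
  (localizable_scale HN (0 +i* 2^-1) (localizable_conj HN lF)).
congr localizable; apply/funext => y; case: (F y) => a b.
apply/eqP; by rewrite eq_complex/=; apply/andP; split; apply/eqP; lra.
Qed.

Lemma series_to_zero (F : nat -> R[i]) : (forall j, F j = 0) -> series_to F 0.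
Proof.
move=> F0; have -> : 0 = \sum_(j < 0) F j by rewrite big_ord0.
by apply: series_to_finite.
Qed.

Lemma series_to_scale (c : R[i]) (F : nat -> R[i]) l : series_to F l ->
  series_to (fun j => c * F j) (c * l).
Proof.
move=> h e e0; have c0 : 0 < norm1 c + 1 by have := norm1_ge0 c; lra.
have [n0 hn0] := h _ (divr_gt0 e0 c0); exists n0 => n /hn0 hn.
rewrite -mulr_sumr -mulrBr (le_trans (norm1M _ _))//.
rewrite (le_trans (ler_wpM2l (norm1_ge0 _) hn))// mulrCA ler_piMr ?(ltW e0)//.
by rewrite ler_pdivrMr// mul1r lerDl.
Qed.

(** The antidiagonal j has j + 1 terms, each of norm at most a constant times 4^-j; as j + 1 <= 2^j,
    its norm is O(2^-j). The factor 4 in the hypothesis leaves room for this count. *)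
Lemma small_series (X Z u v : Y -> R[i]) (c : nat -> nat -> R[i]) (rho B : R) :
  0 < rho -> small N X u rho -> small N Z v rho ->
  (forall k l, norm1 (c k l) * (4 * rho) ^+ (k + l) <= B) ->
  exists G s, N G s /\ forall y, series_to (fun j =>
    X y * Z y * \sum_(k < j.+1) c k (j - k)%N * (u y ^+ k * v y ^+ (j - k))) (G y).
Proof.
move=> rho0 /(small_ge0 HN)[C C0 hC] /(small_ge0 HN)[D D0 hD] hB.
have B0 : 0 <= B.
  by apply: le_trans (hB 0%N 0%N); rewrite expr0 mulr1 norm1_ge0.
pose F j y := X y * Z y * \sum_(k < j.+1) c k (j - k)%N * (u y ^+ k * v y ^+ (j - k)).
pose M : R := B * (C * D).
have M0 : 0 <= M by rewrite !mulr_ge0.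
have NF j : N (F j) (M * 2^-1 ^+ j).
  have -> : F j = fun y => \sum_(k < j.+1)
      c k (j - k)%N * ((X y * u y ^+ k) * (Z y * v y ^+ (j - k))).
    apply/funext => y; rewrite /F mulr_sumr; apply: eq_bigr => k _; ring.
  apply: (@fan_sum _ _ _ HN j.+1
    (fun k y => c k (j - k)%N * ((X y * u y ^+ k) * (Z y * v y ^+ (j - k))))
    (fun k => M * 4^-1 ^+ j)).
    move=> k; rewrite ltnS => kj.
    apply: (fan_le HN (fan_scale HN _ (fan_mul HN (hC k) (hD (j - k)%N)))).
    have -> : norm1 (c k (j - k)%N) * (C * rho ^+ k * (D * rho ^+ (j - k))) =
      norm1 (c k (j - k)%N) * (4 * rho) ^+ (k + (j - k)) * (C * D) * 4^-1 ^+ j.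
      have e4 : 4 ^+ j * 4^-1 ^+ j = 1 :> R by rewrite -exprMn divff ?expr1n.
      transitivity (norm1 (c k (j - k)%N) * (C * D) * (rho ^+ k * rho ^+ (j - k))
        * (4 ^+ j * 4^-1 ^+ j)); first by rewrite e4; ring.
      by rewrite -exprD subnKC// exprMn; ring.
    by rewrite /M ler_wpM2r ?exprn_ge0// ler_wpM2r ?mulr_ge0// hB.
  rewrite sumr_const card_ord -[_ *+ j.+1]mulr_natl mulrCA ler_wpM2l//.
  have -> : 4^-1 ^+ j = 2^-1 ^+ j * 2^-1 ^+ j :> R.
    by rewrite -exprMn; congr (_ ^+ _); field.
  rewrite mulrA ler_piMl ?exprn_ge0// exprVn ler_pdivrMr ?exprn_gt0// mul1r.
  by rewrite -natrX ler_nat ltn_expl.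
have sM n : \sum_(j < n) M * 2^-1 ^+ j <= M * 2.
  rewrite -mulr_sumr half_sum ler_wpM2l//.
  by rewrite lerBlDr lerDl mulr_ge0// exprn_ge0.
have hG y : exists l, series_to (F^~ y) l.
  apply: (@series_to_dominated _ _ (fun j => 2 * (M * 2^-1 ^+ j)) (2 * (M * 2))).
    by move=> j; exact: (fan_bound HN (NF j)).
  by move=> n; rewrite -mulr_sumr ler_wpM2l.
have {hG} [G hG] := boolp.choice hG.
exists G, (M * 2); split=> //.
exact: (fan_series HN NF sM hG).
Qed.

Lemma small_shift (X v : Y -> R[i]) (w z : R[i]) (r s t : R) : 0 <= r ->
  norm1 (w - z) <= s -> r + s <= t -> small N X (fun y => v y - w) r ->
  small N X (fun y => v y - z) t.
Proof.
move=> r0 wz rst hs.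
have := small_add HN hs (small_cst HN (w - z)).
move=> /(small_le HN (addr_ge0 r0 (norm1_ge0 _)) _) h.
have {}h := h t (le_trans _ rst).
apply: small_eq (h _); last by rewrite lerD2l.
- by move=> y; rewrite mulr1.
- by move=> y /=; rewrite addrA subrK.
Qed.

Theorem functional_calculus (F : Y -> R[i]) (K : set R[i]^o) (h : R[i] -> R[i]) :
  localizable N F -> compact K ->
  (exists V : set R[i]^o, [/\ open V, K `<=` V & real_analytic_on V h]) ->
  exists G s, N G s /\ forall y, K (F y) -> G y = h (F y).
Proof.
move=> lF cK [V [oV KV hV]].
have hz (z : R[i]) : exists rc : R * (nat -> nat -> R[i]), V z -> 0 < rc.1 /\
    forall xi eta : R,
      (xi - complex.Re z) ^+ 2 + (eta - complex.Im z) ^+ 2 < rc.1 ^+ 2 ->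
      partial_sum (fun kn : nat * nat => rc.2 kn.1 kn.2 *
        ((xi - complex.Re z) ^+ kn.1 * (eta - complex.Im z) ^+ kn.2)%:C)
        @ totally --> (h (xi +i* eta) : R[i]^o).
  have [Vz|nVz] := pselect (V z); last by exists (1, fun _ _ => 0).
  by have [r [c [r0 hc]]] := hV z Vz; exists (r, c).
have {hz} [rc hrc] := boolp.choice hz.
(* A cell that meets the preimage of K near z has its centre within 2e + rho <= 3 rho of z in each
   coordinate, so it is small of radius 4 rho about z. [small_series] needs coefficient bounds at t
   = 16 rho, which come from convergence at the point with both offsets t; as 2t^2 < (2t)^2, radius
   2t = 32 rho is enough. *)
pose rho z : R := (rc z).1 / 32.
have rho0 z : V z -> 0 < rho z by move=> /hrc[r0 _]; rewrite divr_gt0.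
pose f (z : R[i]) : set R[i]^o := ((ball (z : R[i]^o) (rho z)%:C)^°)%classic.
have [D' D'K Kcov] : finite_subset_cover K f K.
  move: cK; rewrite compact_cover; apply.
    by move=> z _; exact: open_interior.
  move=> z Kz; exists z => //; apply: nbhsx_ballx; rewrite ltcR.
  exact/rho0/KV.
have [e e0 he] : exists2 e : R, 0 < e & forall z, z \in (D' : seq _) -> e <= rho z.
  apply: min_pos => z zD; apply/rho0/KV.
  by have := D'K z zD; rewrite inE.
have [I [X [x [X1 Xs]]]] := localizable_Re lF e0.
have [J [Z [w [Z1 Zs]]]] := localizable_Im lF e0.
pose cell i j (y : Y) := X i y * Z j y.
have hcell (p : I * J) : exists Gs : (Y -> R[i]) * R, N Gs.1 Gs.2 /\
    forall y, K (F y) -> Gs.1 y = cell p.1 p.2 y * h (F y).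
  case: p => i j /=.
  (* A cell that is 0 wherever F is in K contributes 0. For any other cell the point [y0] selects
     the disc, and thereby the expansion, to be used on the whole cell. *)
  have [[y0 [Ky0 cy0]]|nc] := pselect (exists y0, K (F y0) /\ cell i j y0 != 0);
      last first.
    exists (fun=> 0, norm1 (0 : R[i])); split; first exact: (fan_cst HN).
    move=> y Ky /=; have [->|cy] := eqVneq (cell i j y) 0; first by rewrite mul0r.
    by exfalso; apply: nc; exists y.
  have [z zD /interior_subset] := Kcov _ Ky0.
  rewrite -ball_normE /= => /norm_lt_parts[hre him].
  have Vz : V z by apply: KV; have := D'K z zD; rewrite inE.
  have [r0 hr] := hrc z Vz; have ez := he z zD.
  move: cy0; rewrite mulf_eq0 negb_or => /andP[Xy0 Zy0].
  have hx := small_supp HN e0 (Xs i) Xy0.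
  have hw := small_supp HN e0 (Zs j) Zy0.
  have rz0 := rho0 z Vz.
  have part (a b : R) (c : R[i]) : modulus (a%:C - c) <= e -> `|b - a| <= rho z ->
      norm1 (c - b%:C) <= 3 * rho z.
    move=> h1 h2; have := norm1_le_modulus (a%:C - c).
    have := norm1D (c - a%:C) (a%:C - b%:C).
    by rewrite addrA subrK norm1B -[a%:C - b%:C]rmorphB norm1_real distrC; lra.
  have e3 : e + 3 * rho z <= 4 * rho z by lra.
  have re_part : `|complex.Re z - complex.Re (F y0)| <= rho z.
    by move: hre; case: (z) (F y0) => ? ? [].
  have im_part : `|complex.Im z - complex.Im (F y0)| <= rho z.
    by move: him; case: (z) (F y0) => ? ? [].
  have sX : small N (X i) (fun y => (complex.Re (F y))%:C - (complex.Re z)%:C) (4 * rho z).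
    exact: (small_shift (ltW e0) (part _ _ _ hx re_part) e3 (Xs i)).
  have sZ : small N (Z j) (fun y => (complex.Im (F y))%:C - (complex.Im z)%:C) (4 * rho z).
    exact: (small_shift (ltW e0) (part _ _ _ hw im_part) e3 (Zs j)).
  (* Cauchy-type bound: the terms of the series, convergent at offsets (t, t), are bounded. *)
  have [B hB] : exists B : R, forall k l,
      norm1 ((rc z).2 k l) * (4 * (4 * rho z)) ^+ (k + l) <= B.
    pose t : R := 4 * (4 * rho z).
    have tp : 0 < t by rewrite /t; lra.
    have t0 := ltW tp.
    have tr : 2 * t = (rc z).1 by rewrite /t /rho; field.
    have := hr (complex.Re z + t) (complex.Im z + t).
    rewrite ![_ + t]addrC !addrK -tr => /(_ _)/(@totally_terms_bounded R
      (fun k l => (rc z).2 k l * (t ^+ k * t ^+ l)%:C))[].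
      by rewrite !expr2; have := mulr_gt0 tp tp; lra.
    move=> B hB; exists B => k l; have := hB k l.
    rewrite /= -exprD.
    have -> : norm1 ((rc z).2 k l * (t ^+ (k + l))%:C) =
        norm1 ((rc z).2 k l) * t ^+ (k + l).
      case: ((rc z).2 k l) => a b; rewrite /norm1/= !mulr0 subr0 add0r.
      by rewrite !normrM !(ger0_norm (exprn_ge0 _ t0)); ring.
    by [].
  have rz4 : 0 < 4 * rho z by lra.
  have [G [s [NG hG]]] := small_series rz4 sX sZ hB.
  exists (G, s); split=> // y Ky /=.
  have [c0|cy] := eqVneq (cell i j y) 0.
    rewrite c0 mul0r; apply: series_to_unique (hG y) _.
    apply: series_to_zero => j0.
    by rewrite -/(cell i j y) c0 mul0r.
  apply: series_to_unique (hG y) _; apply: series_to_scale.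
  move: cy; rewrite mulf_eq0 negb_or => /andP[Xy Zy].
  have bX := small_supp HN rz4 sX Xy; rewrite -rmorphB in bX.
  have bZ := small_supp HN rz4 sZ Zy; rewrite -rmorphB in bZ.
  have modulus_real (a : R) : modulus a%:C = `|a|.
    by rewrite /modulus normc_def/= expr0n/= addr0 sqrtr_sqr.
  have hF : complex.Re (F y) +i* complex.Im (F y) = F y by case: (F y).
  rewrite !modulus_real in bX bZ.
  have rE : (rc z).1 = 32 * rho z by rewrite /rho; field.
  have := hr (complex.Re (F y)) (complex.Im (F y)); rewrite hF rE => hc.
  have := @totally_series_to R (fun k l => (rc z).2 k l *
    ((complex.Re (F y) - complex.Re z) ^+ k *
     (complex.Im (F y) - complex.Im z) ^+ l)%:C) (h (F y)).
  rewrite (_ : (fun j0 : nat => \sum_(k < j0.+1) _) = (fun j0 : nat => \sum_(k < j0.+1)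
    (rc z).2 k (j0 - k)%N *
      (((complex.Re (F y))%:C - (complex.Re z)%:C) ^+ k *
       ((complex.Im (F y))%:C - (complex.Im z)%:C) ^+ (j0 - k)))).
    apply; apply: hc.
    rewrite -(real_normK (num_real (_ - complex.Re z))).
    rewrite -(real_normK (num_real (_ - complex.Im z))).
    have b1 := normr_ge0 (complex.Re (F y) - complex.Re z).
    have b2 := normr_ge0 (complex.Im (F y) - complex.Im z).
    rewrite !expr2; nra.
  apply/funext => j0; apply: eq_bigr => k _.
  by rewrite -!rmorphB rmorphM !rmorphXn.
have {hcell} [Gs hGs] := boolp.choice hcell.
have [s hs] : exists s, N (fun y => \sum_p (Gs p).1 y) s.
  by apply: fan_fin_sum => p; exists (Gs p).2; exact: (hGs p).1.
exists (fun y => \sum_p (Gs p).1 y), s; split=> // y Ky.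
rewrite (eq_bigr _ (fun p _ => (hGs p).2 y Ky)) -mulr_suml.
rewrite -(pair_bigA _ (fun i j => cell i j y))/=.
rewrite (eq_bigr (X^~ y)) ?X1 ?mul1r// => i _.
by rewrite -mulr_sumr Z1 mulr1.
Qed.

End functional_calculus.

(** * Integrals against finite measures *)

Section measure_constructions.
Context {d} {T : measurableType d} {R : realType}.

Section finite_copy.
Variables (m : {measure set T -> \bar R}) (moo : (m setT < +oo)%E).

(** The proof of finiteness is an argument so that the finite-measure structure can be attached to
    the term itself. *)
Definition finite_copy_fun of (m setT < +oo)%E : set T -> \bar R := m.

HB.instance Definition _ := Measure.copy (finite_copy_fun moo) m.

Let finite_copy_finite : fin_num_fun (finite_copy_fun moo).
Proof. exact: lty_fin_num_fun. Qed.

HB.instance Definition _ :=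
  Measure_isFinite.Build _ _ _ (finite_copy_fun moo) finite_copy_finite.

Definition finite_copy : {finite_measure set T -> \bar R} := finite_copy_fun moo.

End finite_copy.

Definition push_measure {d'} {T' : measurableType d'} (m : {measure set T -> \bar R})
    (f : T -> T') (mf : measurable_fun setT f) : {measure set T' -> \bar R} :=
  @measure_function_pushforward__canonical__measure_function_Measure _ _ _ _ _ m f mf.

End measure_constructions.

(** * Lebesgue measure under translations and reflections *)

Section affine_invariance.
Context {R : realType}.

Definition affine_tuple n (s : R) (v t : n.-tuple R) : n.-tuple R :=
  [tuple s * tnth t i + tnth v i | i < n].

Lemma measurable_affine_tuple n s (v : n.-tuple R) :
  measurable_fun setT (affine_tuple s v).
Proof.
apply/measurable_fun_tnthP => i.
rewrite (_ : _ \o _ = fun t => s * tnth t i + tnth v i); last first.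
  by apply/funext => t /=; rewrite tnth_mktuple.
by apply: measurable_funD => //; apply: measurable_funM => //; exact: measurable_tnth.
Qed.

Lemma measurable_affine (s v : R) : measurable_fun setT (fun x : R => s * x + v).
Proof. by apply: measurable_funD => //; exact: measurable_funM. Qed.

(** Half-open intervals determine Lebesgue measure. With s = 1 or -1 one statement serves
    translations, needed for convolution, and reflections, needed for conjugation and parity; a
    reflection moves the closed end, which does not change the length. *)
Lemma lebesgue_line_affine (s v : R) A : s = 1 \/ s = -1 -> measurable A ->
  lebesgue_line ((fun x : R => s * x + v) @^-1` A) = lebesgue_line A.
Proof.
move=> hs mA.
have mf : measurable_fun [set: measurableTypeR R]
  ((fun x : R => s * x + v) : measurableTypeR R -> measurableTypeR R).
  exact: measurable_affine.
rewrite /lebesgue_line; apply/esym.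
apply: (@lebesgue_measure_unique R (push_measure (@lebesgue_measure R) mf)) => //.
move=> X [[a b]] _ <-.
rewrite lebesgue_measure_itv/= /pushforward.
case: hs => ->.
  rewrite (_ : _ @^-1` _ = `]a - v, b - v]%classic); last first.
    apply/seteqP; split=> x /=; rewrite !in_itv/= mul1r => /andP[h1 h2];
      apply/andP; split; lra.
  rewrite lebesgue_measure_itv/= !lte_fin ltrD2r; case: ifPn => // _.
  by rewrite -!EFinB; congr EFin; ring.
rewrite (_ : _ @^-1` _ = `[v - b, v - a[%classic); last first.
  apply/seteqP; split=> x /=; rewrite !in_itv/= mulN1r => /andP[h1 h2];
    apply/andP; split; lra.
rewrite lebesgue_measure_itv/= !lte_fin ltrD2l ltrN2; case: ifPn => // _.
by rewrite -!EFinB; congr EFin; ring.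
Qed.

(** Induction on the dimension: the measure is the integral over the first coordinate of the
    measures of the sections. The induction hypothesis treats the sections, the case of the line the
    outer integral. *)
Lemma lebesgue_tuple_affine n (s : R) (v : n.-tuple R) A : s = 1 \/ s = -1 ->
  measurable A ->
  lebesgue_tuple n (affine_tuple s v @^-1` A) = lebesgue_tuple n A.
Proof.
move=> hs; elim: n v A => [|n IHn] v A mA.
  by congr (_ _); apply/funext => t; rewrite /preimage/= (tuple0 t) (tuple0 (affine_tuple _ _ _)).
have mB : measurable (@cons_pair R n @^-1` A).
  by rewrite -[X in measurable X]setTI; exact: measurable_cons_pair.
set B := _ @^-1` A in mB.
rewrite /= /lebesgue_prod /pushforward -/B.
have -> : @cons_pair R n @^-1` (affine_tuple s v @^-1` A) =
    [set p | B (s * p.1 + thead v, affine_tuple s [tuple of behead v] p.2)].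
  apply/funext => -[x t]; rewrite /B /preimage /mkset /=; congr A.
  apply: eq_from_tnth => i; rewrite tnth_mktuple.
  have [j ->|->] := unliftP ord0 i; rewrite ?tnthS ?tnth0//.
    by rewrite /= tnth_mktuple [in LHS](tuple_eta v) tnthS.
rewrite [LHS]/product_measure1 [RHS]/product_measure1.
pose F x := lebesgue_tuple n (xsection B x).
have mF : measurable_fun setT F by exact: measurable_fun_xsection.
transitivity (\int[lebesgue_line]_x F (s * x + thead v)%R)%E.
  apply: eq_integral => x _; rewrite /F /=.
  rewrite -(IHn [tuple of behead v] (xsection B (s * x + thead v)))//; last exact: measurable_xsection.
pose nu := push_measure lebesgue_line (measurable_affine s (thead v)).
have -> : (\int[lebesgue_line]_x F x = \int[nu]_x F x)%E.
  apply: eq_measure_integral => C mC _.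
  by apply/esym; exact: lebesgue_line_affine.
by rewrite /nu ge0_integral_pushforward//; exact: measurable_affine.
Qed.

End affine_invariance.

Section finite_measure_integrals.
Context {R : realType} {disp : measure_display} {T : measurableType disp}.
Implicit Types (f g : T -> R) (m : {measure set T -> \bar R}).

Lemma bounded_integrable m f (C : R) : (m setT < +oo)%E -> measurable_fun setT f ->
  (forall x, `|f x| <= C) -> m.-integrable setT (EFin \o f).
Proof.
move=> moo mf fC; apply: measurable_bounded_integrable => //.
exists C; split; first exact: num_real.
by move=> M CM x _ /=; rewrite (le_trans (fC x))// ltW.
Qed.

Lemma norm_Rintegral_le m f (C : R) : (m setT < +oo)%E -> measurable_fun setT f ->
  (forall x, `|f x| <= C) -> `|\int[m]_x f x| <= C * fine (m setT).
Proof.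
move=> moo mf fC; have fi := bounded_integrable moo mf fC.
rewrite (le_trans (le_normr_Rintegral measurableT fi))//.
have <- : \int[m]_x (cst C x) = C * fine (m setT) by rewrite Rintegral_cst.
apply: le_Rintegral => //; first exact: integrable_norm.
apply: (bounded_integrable (C := `|C|)) => //.
Qed.

Lemma Rintegral_push {d'} {T' : measurableType d'} m (f : T -> T')
    (mf : measurable_fun setT f) (g : T' -> R) (C : R) : (m setT < +oo)%E ->
  measurable_fun setT g -> (forall x, `|g x| <= C) ->
  \int[push_measure m mf]_x g x = \int[m]_x g (f x).
Proof.
move=> moo mg gC; congr fine.
have mgf : measurable_fun setT (g \o f) by exact: measurableT_comp.
rewrite (integral_pushforward mf (f := EFin \o g))//.
  exact/measurable_EFinP.
by rewrite preimage_setT; exact: (bounded_integrable moo mgf (fun x => gC (f x))).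
Qed.

Lemma Rintegral_measure_add m (n : {measure set T -> \bar R}) f (C : R) :
  (m setT < +oo)%E -> (n setT < +oo)%E ->
  measurable_fun setT f -> (forall x, `|f x| <= C) ->
  \int[measure_add m n]_x f x = \int[m]_x f x + \int[n]_x f x.
Proof.
move=> moo noo mf fC.
have mi := bounded_integrable moo mf fC; have ni := bounded_integrable noo mf fC.
rewrite /Rintegral (integral_measure_add measurableT mi ni).
by rewrite fineD//; exact: integrable_fin_num.
Qed.

Lemma Rintegral_series (m : {measure set T -> \bar R}^nat) f (C s : R) :
  (forall j, (m j setT < +oo)%E) ->
  (forall n, \sum_(j < n) fine (m j setT) <= s) ->
  measurable_fun setT f -> (forall x, `|f x| <= C) ->
  (\sum_(j < n) \int[m j]_x f x) @[n --> \oo] --> \int[mseries m 0]_x f x.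
Proof.
move=> moo ms mf fC.
have C0 : 0 <= C by apply: le_trans (fC point).
have fi j := bounded_integrable (moo j) mf fC.
(* Integration against a series of measures needs summability for the positive and the negative part
   separately; both lie between 0 and C. *)
have bd (g : T -> \bar R) : measurable_fun setT g -> (forall x, 0 <= g x)%E ->
    (forall x, g x <= C%:E)%E ->
    (\sum_(n <oo) `|\int[m n]_x g x| < +oo)%E.
  move=> mg g0 gC; apply: (@le_lt_trans _ _ (C * s)%:E); last exact: ltry.
  apply: lime_le; first by apply: is_cvg_nneseries => n *; exact: abse_ge0.
  apply: nearW => n; rewrite big_mkord.
  apply: (@le_trans _ _ (\sum_(j < n) (C * fine (m j setT))%:E)%E); last first.
    by rewrite sumEFin lee_fin -mulr_sumr ler_wpM2l.
  apply: lee_sum => j _; rewrite gee0_abs; last by apply: integral_ge0 => x _.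
  rewrite EFinM fineK ?ge0_fin_numE//.
  rewrite -integral_cst//; apply: ge0_le_integral => //.
have E : (\int[mseries m 0]_x (f x)%:E = \sum_(n <oo) \int[m n]_x (f x)%:E)%E.
  apply: integral_measure_series => //.
  - exact/measurable_EFinP.
  - apply: bd; first by apply: measurable_funeneg; exact/measurable_EFinP.
      by [].
    move=> x; rewrite funenegE ge_max -EFinN !lee_fin C0 andbT.
    by rewrite (le_trans _ (fC x))// -normrN ler_norm.
  - apply: bd; first by apply: measurable_funepos; exact/measurable_EFinP.
      by [].
    move=> x; rewrite funeposE ge_max !lee_fin C0 andbT.
    by rewrite (le_trans _ (fC x))// ler_norm.
rewrite /Rintegral E.
have -> : (fun n => \sum_(j < n) fine (\int[m j]_x (f x)%:E)%E) =
    series (fun j => fine (\int[m j]_x (f x)%:E)%E).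
  by apply/funext => n; rewrite /series/= big_mkord.
have cv : cvgn (series (fun j => fine (\int[m j]_x (f x)%:E)%E)).
  apply: normed_cvg; apply: nondecreasing_is_cvgn.
    by apply: nondecreasing_series => n _ _; exact: normr_ge0.
  exists (C * s) => _ [n _ <-]; rewrite /normed_series_of /series/= big_mkord.
  rewrite (@le_trans _ _ (\sum_(j < n) C * fine (m j setT)))//.
    by apply: ler_sum => j _; exact: norm_Rintegral_le.
  by rewrite -mulr_sumr ler_wpM2l.
suff -> : (\sum_(n <oo) \int[m n]_x (f x)%:E)%E =
    (limn (series (fun j => fine (\int[m j]_x (f x)%:E)%E)))%:E by [].
rewrite -EFin_lim//; congr (limn _); apply/funext => n /=.
rewrite /series/= -sumEFin; apply: eq_bigr => j _.
by rewrite fineK//; exact: integrable_fin_num.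
Qed.

End finite_measure_integrals.

(** * Products of finite measures and null sections *)

Section product_integrals.
Context {R : realType} {d1 d2 : measure_display}.
Context {T1 : measurableType d1} {T2 : measurableType d2}.

Lemma product_finite (m1 : {finite_measure set T1 -> \bar R})
    (m2 : {finite_measure set T2 -> \bar R}) :
  (m1 \x m2)%E setT = (m1 setT * m2 setT)%E.
Proof. by rewrite -setXTT product_measure1E. Qed.

Lemma product_finite_lty (m1 : {finite_measure set T1 -> \bar R})
    (m2 : {finite_measure set T2 -> \bar R}) : ((m1 \x m2)%E setT < +oo)%E.
Proof.
rewrite product_finite lte_mul_pinfty//.
  by rewrite fin_num_measure.
by rewrite ltey_eq fin_num_measure.
Qed.

Lemma Rintegral_prod (m1 : {finite_measure set T1 -> \bar R})
    (m2 : {finite_measure set T2 -> \bar R}) (f : T1 -> R) (g : T2 -> R) (C D : R) :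
  measurable_fun setT f -> (forall x, `|f x| <= C) ->
  measurable_fun setT g -> (forall x, `|g x| <= D) ->
  \int[(m1 \x m2)%E]_p (f p.1 * g p.2) = (\int[m1]_x f x) * (\int[m2]_x g x).
Proof.
move=> mf fC mg gD.
have m1oo : (m1 setT < +oo)%E by rewrite ltey_eq fin_num_measure.
have m2oo : (m2 setT < +oo)%E by rewrite ltey_eq fin_num_measure.
have mfg : measurable_fun setT (fun p : T1 * T2 => f p.1 * g p.2).
  by apply: measurable_funM; exact: measurableT_comp.
have fgi := @bounded_integrable R _ _ (m1 \x m2)%E (fun p => f p.1 * g p.2) (C * D)
  (product_finite_lty m1 m2) mfg.
have fi := bounded_integrable m1oo mf fC.
have gi := bounded_integrable m2oo mg gD.
rewrite [LHS]/Rintegral -(integral12_prod_meas1 (f := EFin \o (fun p : T1 * T2 => f p.1 * g p.2)))//; last first.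
  apply: fgi => p; rewrite normrM ler_pM//.
rewrite -RintegralZr//; congr fine; apply: eq_integral => x _.
rewrite /fubini_F /=.
under eq_integral do rewrite EFinM.
rewrite integralZl//= EFinM fineK//.
exact: integrable_fin_num.
Qed.

(** By Tonelli the integral over x of the measures of the sections is 0. It will be applied to the
    pairs whose sum lies in a Lebesgue-null set, where the sections at fixed y are translates of
    that set. *)
Lemma null_sections (m1 : {sigma_finite_measure set T1 -> \bar R})
    (m2 : {sigma_finite_measure set T2 -> \bar R}) (B : set (T1 * T2)) :
  measurable B -> (forall y, m1 (ysection B y) = 0%E) ->
  m1 [set x | m2 (xsection B x) != 0%E] = 0%E.
Proof.
move=> mB B0.
have mphi : measurable_fun setT (fun x => m2 (xsection B x)).
  exact: measurable_fun_xsection.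
have phi_int : (\int[m1]_x `|m2 (xsection B x)| = 0)%E.
  transitivity (\int[m1]_x m2 (xsection B x))%E.
    by apply: eq_integral => x _; rewrite gee0_abs.
  have := indic_fubini_tonelli m1 m2 mB.
  rewrite indic_fubini_tonelli_FE// indic_fubini_tonelli_GE// => ->.
  by apply: integral0_eq => y _ /=; rewrite B0.
have /ae_eq_integral_abs := phi_int; move=> /(_ measurableT mphi).
move=> [N [mN N0 hN]]; apply: (subset_measure0 _ mN) N0 => //.
  have := emeasurable_neq measurableT mphi 0%E.
  by rewrite setTI.
by move=> x /= hx; apply: hN => /= /(_ I) h; rewrite h eqxx in hx.
Qed.

End product_integrals.

(** * The algebra of Fourier transforms *)

Section fourier_algebra.
Context {R : realType} {d : nat}.
Local Notation T := (d.-tuple R).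
Local Notation Om := (d.-tuple R * nat)%type.

(* The pair (x, n) stands for the point mass at x with the phase i^n: with phases,
   positive measures on R^d x nat represent all complex measures on R^d. *)
Definition angle (y : T) (w : Om) : R :=
  w.2%:R * (pi / 2) - 2 * pi * scalar_product w.1 y.

(** For w = (x, n) this is i^n exp(-2 pi i <x, y>). *)
Definition wave (y : T) (w : Om) : R[i] := cos (angle y w) +i* sin (angle y w).

Definition tuple_add (x t : T) : T := affine_tuple 1 x t.
Definition tuple_opp (x : T) : T := affine_tuple (-1) [tuple 0 | _ < d] x.

Lemma tnth_add x t i : tnth (tuple_add x t) i = tnth x i + tnth t i.
Proof. by rewrite tnth_mktuple mul1r addrC. Qed.

Lemma tnth_opp x i : tnth (tuple_opp x) i = - tnth x i.
Proof. by rewrite !tnth_mktuple mulN1r addr0. Qed.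

Definition phase_add (w w' : Om) : Om := (tuple_add w.1 w'.1, (w.2 + w'.2)%N).
(** The conjugate of i^n is i^(3n), which keeps the phase a natural number. *)
Definition phase_conj (w : Om) : Om := (tuple_opp w.1, (3 * w.2)%N).

Lemma scalar_product_add x t y :
  scalar_product (tuple_add x t) y = scalar_product x y + scalar_product t y :> R.
Proof.
rewrite /scalar_product -big_split; apply: eq_bigr => i _.
by rewrite tnth_add mulrDl.
Qed.

Lemma scalar_product_opp x y :
  scalar_product (tuple_opp x) y = - scalar_product x y :> R.
Proof.
rewrite /scalar_product -sumrN; apply: eq_bigr => i _.
by rewrite tnth_opp mulNr.
Qed.

Lemma wave_add y w w' : wave y (phase_add w w') = wave y w * wave y w'.
Proof.
rewrite /wave (_ : angle y (phase_add w w') = angle y w + angle y w').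
  by rewrite cosD sinD; apply/eqP; rewrite eq_complex/= eqxx addrC eqxx.
by rewrite /angle /phase_add/= scalar_product_add natrD; ring.
Qed.

Lemma cos_D2pin (x : R) q : cos (x + q%:R * (2 * pi)) = cos x.
Proof.
elim: q => [|q IH]; first by rewrite mul0r addr0.
rewrite -(addn1 q) natrD mulrDl mul1r addrA.
by rewrite [2 * pi]mulr_natl cosD cos2pi sin2pi mulr1 mulr0 subr0 -[pi *+ 2]mulr_natl.
Qed.

Lemma wave_conj y w : wave y (phase_conj w) = (wave y w)^*.
Proof.
rewrite /wave (_ : angle y (phase_conj w) = - angle y w + w.2%:R * (2 * pi)).
  by rewrite cos_D2pin sin_D2pin cosN sinN.
by rewrite /angle /phase_conj/= scalar_product_opp natrM; field.
Qed.

Lemma measurable_scalar_product (y : T) :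
  measurable_fun setT (fun x : T => scalar_product x y).
Proof.
apply: measurable_sum => i.
by apply: measurable_funM => //; exact: measurable_tnth.
Qed.

Lemma measurable_angle y : measurable_fun setT (angle y).
Proof.
apply: measurable_funB; apply: measurable_funM => //.
  apply: (measurableT_comp (f := fun n : nat => n%:R : R)) => //.
by apply: (measurableT_comp (measurable_scalar_product y)).
Qed.

Lemma measurable_cos_angle y : measurable_fun setT (cos \o angle y).
Proof.
apply: measurableT_comp; last exact: measurable_angle.
by apply: continuous_measurable_fun; exact: continuous_cos.
Qed.

Lemma measurable_sin_angle y : measurable_fun setT (sin \o angle y).
Proof.
apply: measurableT_comp; last exact: measurable_angle.
by apply: continuous_measurable_fun; exact: continuous_sin.
Qed.

Lemma measurable_tuple_add d' (X : measurableType d') (f g : X -> T) :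
  measurable_fun setT f -> measurable_fun setT g ->
  measurable_fun setT (fun x => tuple_add (f x) (g x)).
Proof.
move=> mf mg; apply/measurable_fun_tnthP => i.
rewrite (_ : _ \o _ = fun x => tnth (f x) i + tnth (g x) i); last first.
  by apply/funext => x /=; rewrite tnth_add.
apply: measurable_funD.
  exact: (measurableT_comp (measurable_tnth i) mf).
exact: (measurableT_comp (measurable_tnth i) mg).
Qed.

Lemma measurable_phase_add :
  measurable_fun setT (fun p : Om * Om => phase_add p.1 p.2).
Proof.
apply: measurable_fun_pair => /=.
  by apply: measurable_tuple_add; exact: measurableT_comp.
by apply: measurable_fun_addn; exact: measurableT_comp.
Qed.

Lemma measurable_phase_conj : measurable_fun setT phase_conj.
Proof.
apply: measurable_fun_pair => /=.
  exact: (measurableT_comp (measurable_affine_tuple _ _)).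
by apply: (measurableT_comp (f := fun n : nat => (3 * n)%N)).
Qed.

Definition ft (m : {measure set Om -> \bar R}) (y : T) : R[i] :=
  (\int[m]_w cos (angle y w)) +i* (\int[m]_w sin (angle y w)).

(* The marginal of m on R^d has no singular continuous part: outside the range of
   u it is absolutely continuous. *)
Definition no_singular_continuous (m : {measure set Om -> \bar R}) :=
  exists u : nat -> T, forall A, measurable A -> lebesgue_tuple d A = 0%E ->
    (forall i, ~ A (u i)) -> m (A `*` setT) = 0%E.

(** [ad_norm F r] says that F has a representing measure of mass at most r. Since masses with
    opposite phases cancel in the transform, representations are far from unique, and only upper
    bounds for the norm are ever used. *)
Definition ad_norm (F : T -> R[i]) (r : R) :=
  exists m : {measure set Om -> \bar R}, [/\ (m setT <= r%:E)%E,
    no_singular_continuous m & forall y, F y = ft m y].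

Lemma ad_norm_ge0 F r : ad_norm F r -> 0 <= r.
Proof. by move=> [m [mr _ _]]; rewrite -lee_fin (le_trans _ mr). Qed.

Lemma ad_norm_bound F r : ad_norm F r -> forall y, norm1 (F y) <= 2 * r.
Proof.
move=> [m [mr _ Fm]] y; rewrite Fm /norm1 /=.
have moo : (m setT < +oo)%E by rewrite (le_lt_trans mr)// ltry.
have hc := norm_Rintegral_le moo (measurable_cos_angle y) (fun w => cos_max _).
have hs := norm_Rintegral_le moo (measurable_sin_angle y) (fun w => sin_max _).
have hr : fine (m setT) <= r by rewrite -lee_fin fineK// ge0_fin_numE.
move: hc hs => /=; lra.
Qed.

Lemma ft_push (m : {measure set Om -> \bar R}) (f : Om -> Om)
    (mf : measurable_fun setT f) y : (m setT < +oo)%E ->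
  ft (push_measure m mf) y =
  (\int[m]_w cos (angle y (f w))) +i* (\int[m]_w sin (angle y (f w))).
Proof.
move=> moo; rewrite /ft.
by rewrite (Rintegral_push mf moo (measurable_cos_angle y) (fun w => cos_max _))
  (Rintegral_push mf moo (measurable_sin_angle y) (fun w => sin_max _)).
Qed.

Lemma ad_norm_conj F r : ad_norm F r -> ad_norm (fun y => (F y)^*) r.
Proof.
move=> [m [mr [u hu] Fm]].
have moo : (m setT < +oo)%E by rewrite (le_lt_trans mr)// ltry.
exists (push_measure m measurable_phase_conj); split.
- by rewrite /= /pushforward preimage_setT.
- exists (tuple_opp \o u) => A mA A0 Au.
  have moppA : measurable (tuple_opp @^-1` A).
    by rewrite -[X in measurable X]setTI; exact: measurable_affine_tuple.
  rewrite -(hu (tuple_opp @^-1` A))//.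
  by rewrite lebesgue_tuple_affine//; right.
- move=> y; rewrite ft_push// Fm /ft; congr (_ +i* _).
    by apply: eq_Rintegral => w _; have [] := wave_conj y w.
  rewrite -[- _]mulN1r -RintegralZl//.
    by apply: eq_Rintegral => w _; have [_ ->] := wave_conj y w; rewrite mulN1r.
  exact: (bounded_integrable moo (measurable_sin_angle y) (fun w => sin_max _)).
Qed.

Lemma ad_norm_series (F : nat -> T -> R[i]) (r : nat -> R) G s :
  (forall j, ad_norm (F j) (r j)) -> (forall n, \sum_(j < n) r j <= s) ->
  (forall y, series_to (F^~ y) (G y)) -> ad_norm G s.
Proof.
move=> hF rs FG; have [m hm] := boolp.choice hF.
have moo j : (m j setT < +oo)%E.
  by have [h _ _] := hm j; rewrite (le_lt_trans h)// ltry.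
have ms n : \sum_(j < n) fine (m j setT) <= s.
  rewrite (le_trans _ (rs n))//; apply: ler_sum => j _.
  by have [h _ _] := hm j; rewrite -lee_fin fineK// ge0_fin_numE.
exists (mseries m 0); split.
- apply: lime_le; first by apply: is_cvg_nneseries.
  apply: nearW => n; rewrite big_mkord.
  rewrite (eq_bigr (fun j : 'I_n => (fine (m j setT))%:E)).
    by rewrite sumEFin lee_fin; exact: ms.
  by move=> j _; rewrite fineK// ge0_fin_numE.
- have hu j : exists u : nat -> T, forall A, measurable A ->
      lebesgue_tuple d A = 0%E -> (forall i, ~ A (u i)) -> m j (A `*` setT) = 0%E.
    by have [] := hm j.
  have {hu} [u hu] := boolp.choice hu.
  (* All the sequences of exceptional points are merged into one; indices that code no pair repeat a
     point already listed. *)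
  pose v n := if @choice.unpickle (nat * nat)%type n is Some p then u p.1 p.2 else u 0%N 0%N.
  exists v => A mA A0 Av; apply: eseries0 => j _ _; apply: hu => // i Aui.
  by apply: (Av (choice.pickle (j, i))); rewrite /v choice.pickleK.
- move=> y; apply: series_to_unique (FG y) _; apply/series_to_cvg; split.
    rewrite (_ : (fun n => _) = fun n => \sum_(j < n) \int[m j]_w cos (angle y w)).
      exact: (Rintegral_series moo ms (measurable_cos_angle y) (fun w => cos_max _)).
    by apply/funext => n; apply: eq_bigr => j _; have [_ _ ->] := hm j.
  rewrite (_ : (fun n => _) = fun n => \sum_(j < n) \int[m j]_w sin (angle y w)).
    exact: (Rintegral_series moo ms (measurable_sin_angle y) (fun w => sin_max _)).
  by apply/funext => n; apply: eq_bigr => j _; have [_ _ ->] := hm j.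
Qed.

Lemma ad_norm_add F G r s : ad_norm F r -> ad_norm G s ->
  ad_norm (fun y => F y + G y) (r + s).
Proof.
move=> [m [mr [u hu] Fm]] [n [ns [v hv] Gn]].
have moo : (m setT < +oo)%E by rewrite (le_lt_trans mr)// ltry.
have noo : (n setT < +oo)%E by rewrite (le_lt_trans ns)// ltry.
exists (measure_add m n); split.
- by rewrite [leLHS]measure_addE EFinD leeD.
- exists (fun k => if odd k then u k./2 else v k./2) => A mA A0 Auv.
  rewrite [LHS]measure_addE hu ?hv ?adde0// => i Ai.
    by have := Auv i.*2; rewrite odd_double doubleK.
  by have := Auv i.*2.+1; rewrite /= odd_double uphalf_double.
- move=> y; rewrite Fm Gn /ft; congr (_ +i* _).
    by rewrite (Rintegral_measure_add moo noo (measurable_cos_angle y) (fun w => cos_max _)).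
  by rewrite (Rintegral_measure_add moo noo (measurable_sin_angle y) (fun w => sin_max _)).
Qed.

(** The product is represented by the convolution of m and n, and the point is that it has no
    singular continuous part. Let A be Lebesgue-null and miss all sums u i + v j, and let phi(x) be
    the n-mass of A - x. Then phi is 0 Lebesgue-almost everywhere by [null_sections], and also at
    every u i, because A - u i is null and misses all v j. So the set where phi is nonzero is null
    for m, and the mass of A, which is the integral of phi, is 0. *)
Lemma ad_norm_mul F G r s : ad_norm F r -> ad_norm G s ->
  ad_norm (fun y => F y * G y) (r * s).
Proof.
move=> [m [mr [u hu] Fm]] [n [ns [v hv] Gn]].
have moo : (m setT < +oo)%E by rewrite (le_lt_trans mr)// ltry.
have noo : (n setT < +oo)%E by rewrite (le_lt_trans ns)// ltry.
pose m1 := finite_copy moo; pose n1 := finite_copy noo.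
have Poo := product_finite_lty m1 n1.
pose nu := push_measure (m1 \x n1)%E measurable_phase_add.
exists nu; split.
- rewrite /nu /= /pushforward preimage_setT product_finite EFinM.
  by apply: lee_pmul.
- pose w k := if @choice.unpickle (nat * nat)%type k is Some p then tuple_add (u p.1) (v p.2)
    else u 0%N.
  exists w => A mA A0 Aw.
  pose B : set (T * Om) := [set p | A (tuple_add p.1 p.2.1)].
  have mB : measurable B.
    rewrite -[B]setTI.
    have := @measurable_tuple_add _ (T * Om)%type fst (fst \o snd).
    by apply => //; exact: measurableT_comp.
  pose phi (x : T) := n1 (xsection B x).
  have mphi : measurable_fun setT phi by exact: measurable_fun_xsection.
  have -> : nu (A `*` setT) = (\int[m1]_p phi p.1)%E.
    rewrite /nu /= /pushforward /product_measure1; apply: eq_integral => p _ /=.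
    rewrite /phi; congr (n1 _); apply/seteqP; split=> q;
      rewrite /xsection /= !inE /=; by [move=> []|move=> ?; split].
  have phi0 : lebesgue_tuple d [set x | phi x != 0%E] = 0%E.
    apply: null_sections => // q.
    rewrite (_ : ysection B q = affine_tuple 1 q.1 @^-1` A).
      by rewrite lebesgue_tuple_affine//; left.
    apply/seteqP; split=> x; rewrite /ysection /B /= !inE /= /tuple_add;
      congr A; apply: eq_from_tnth => i; by rewrite !tnth_mktuple !mul1r addrC.
  have phiu i : phi (u i) = 0%E.
    have -> : phi (u i) = n ((tuple_add (u i) @^-1` A) `*` setT).
      rewrite /phi /n1 /=; congr (n _); apply/seteqP; split=> q;
        rewrite /xsection /= !inE /=; by [move=> ?; split|move=> []].
    apply: hv.
    - have := @measurable_tuple_add _ T (cst (u i)) id; rewrite -[_ @^-1` _]setTI.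
      by apply.
    - by rewrite lebesgue_tuple_affine//; left.
    - by move=> j Aij; apply: (Aw (choice.pickle (i, j))); rewrite /w choice.pickleK.
  pose N0 := [set x | phi x != 0%E] `*` [set: nat].
  have mN0 : measurable [set x | phi x != 0%E].
    by have := emeasurable_neq measurableT mphi 0%E; rewrite setTI.
  have N00 : m1 N0 = 0%E.
    by apply: hu => // i /=; rewrite phiu eqxx.
  transitivity (\int[m1]_p `|phi p.1|)%E.
    by apply: eq_integral => p _; rewrite gee0_abs.
  apply/ae_eq_integral_abs => //; first exact: measurableT_comp.
  exists N0; split=> //; first exact: measurableX.
  move=> p /= hp; split=> //=; apply/eqP => h; apply: hp => _; exact: h.
- move=> y.
  have mc := measurable_cos_angle y; have ms := measurable_sin_angle y.
  have bc (w : Om) : `|cos (angle y w)| <= 1 by exact: cos_max.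
  have bs (w : Om) : `|sin (angle y w)| <= 1 by exact: sin_max.
  have mcf : measurable_fun setT (cos \o angle y \o (@fst Om Om)) by exact: measurableT_comp.
  have mcs : measurable_fun setT (cos \o angle y \o (@snd Om Om)) by exact: measurableT_comp.
  have msf : measurable_fun setT (sin \o angle y \o (@fst Om Om)) by exact: measurableT_comp.
  have mss : measurable_fun setT (sin \o angle y \o (@snd Om Om)) by exact: measurableT_comp.
  have int (f g : Om * Om -> R) : measurable_fun setT f -> measurable_fun setT g ->
      (forall p, `|f p| <= 1) -> (forall p, `|g p| <= 1) ->
      (m1 \x n1)%E.-integrable setT (EFin \o (fun p => f p * g p)).
    move=> mf mg f1 g1; apply: (bounded_integrable Poo (C := 1)).
      exact: measurable_funM.
    by move=> p; rewrite normrM mulr_ile1.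
  rewrite /ft /nu (Rintegral_push measurable_phase_add Poo mc bc).
  rewrite (Rintegral_push measurable_phase_add Poo ms bs) Fm Gn /ft.
  have -> : \int[(m1 \x n1)%E]_p cos (angle y (phase_add p.1 p.2)) =
      \int[(m1 \x n1)%E]_p (cos (angle y p.1) * cos (angle y p.2) -
        sin (angle y p.1) * sin (angle y p.2)).
    by apply: eq_Rintegral => p _; have [->] := wave_add y p.1 p.2.
  have -> : \int[(m1 \x n1)%E]_p sin (angle y (phase_add p.1 p.2)) =
      \int[(m1 \x n1)%E]_p (cos (angle y p.1) * sin (angle y p.2) +
        sin (angle y p.1) * cos (angle y p.2)).
    by apply: eq_Rintegral => p _; have [_ ->] := wave_add y p.1 p.2.
  rewrite RintegralB//; [|exact: int..].
  rewrite RintegralD//; [|exact: int..].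
  rewrite (Rintegral_prod m1 n1 mc bc mc bc) (Rintegral_prod m1 n1 ms bs ms bs).
  by rewrite (Rintegral_prod m1 n1 mc bc ms bs) (Rintegral_prod m1 n1 ms bs mc bc).
Qed.

End fourier_algebra.

Lemma Rintegral_mscale_dirac {R : realType} {disp : measure_display}
    {T : measurableType disp} (a : {nonneg R}) (w : T) (f : T -> R) (C : R) :
  measurable_fun setT f -> (forall x, `|f x| <= C) ->
  \int[mscale a (dirac w)]_x f x = a%:num * f w.
Proof.
move=> mf fC; have mEf : measurable_fun setT (EFin \o f) by exact/measurable_EFinP.
rewrite /Rintegral integralE.
rewrite ge0_integral_mscale//; last exact: measurable_funepos.
rewrite ge0_integral_mscale//; last exact: measurable_funeneg.
rewrite !integral_dirac//; [|exact: measurable_funeneg|exact: measurable_funepos].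
rewrite !diracT !mul1e /= funeposE funenegE -EFinN -!EFin_max -!EFinM -EFinB /=.
by rewrite -mulrBr; congr (_ * _); case: (lerP (f w) 0) => h1; case: (lerP (- f w) 0) => h2; lra.
Qed.

(** * Point masses and characters *)

Section discrete_part.
Context {R : realType} {d : nat}.
Local Notation T := (d.-tuple R).
Local Notation Om := (d.-tuple R * nat)%type.

Lemma ad_norm_point (g : T) (k : nat) (a : R) : 0 <= a ->
  ad_norm (fun y => a%:C * wave y (g, k)) a.
Proof.
move=> a0; pose an : {nonneg R} := NngNum a0.
have mE (A : set Om) : mscale an (dirac (g, k)) A = (a%:E * ((g, k) \in A)%:R%:E)%E.
  by rewrite -diracE.
exists (mscale an (dirac (g, k))); split.
- have h : mscale an (dirac (g, k)) setT = a%:E by rewrite mE in_setT mule1.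
  by rewrite -[leRHS]h; exact: lexx.
- exists (fun=> g) => A mA A0 Ag.
  apply: etrans (mE _) _; rewrite memNset ?mule0//=.
  by move=> [/= /(Ag 0%N)].
- move=> y; rewrite /ft.
  rewrite (Rintegral_mscale_dirac an _ (measurable_cos_angle y) (fun w => cos_max _)).
  rewrite (Rintegral_mscale_dirac an _ (measurable_sin_angle y) (fun w => sin_max _)).
  by apply/eqP; rewrite eq_complex/= !mul0r subr0 addr0 !eqxx.
Qed.

Lemma wave0 (y : T) k : wave y ([tuple 0 | _ < d], k) =
  cos (k%:R * (pi / 2)) +i* sin (k%:R * (pi / 2)).
Proof.
rewrite /wave /angle /= (_ : scalar_product _ _ = 0) ?mulr0 ?subr0//.
by rewrite /scalar_product big1// => i _; rewrite tnth_mktuple mul0r.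
Qed.

(** Masses |Re c| and |Im c| at the origin with phases 1 and i; a negative sign is two further
    quarter turns. *)
Lemma ad_norm_cst c : @ad_norm R d (fun=> c) (norm1 c).
Proof.
have quarter k : (k%:R * (pi / 2) : R) = (pi / 2) *+ k by rewrite mulr_natl.
have sgn (x : R) (k : nat) : (fun y : T => (if 0 <= x then 1 else -1) * wave y ([tuple 0 | _ < d], k)) =
    (fun y => wave y ([tuple 0 | _ < d], if 0 <= x then k else k.+2)).
  apply/funext => y; case: ifP => _; rewrite ?mul1r// !wave0.
  have -> : k.+2%:R * (pi / 2) = k%:R * (pi / 2) + pi :> R.
    by rewrite -(addn2 k) natrD; field.
  by rewrite cosDpi sinDpi; apply/eqP; rewrite eq_complex/= !mulN1r !oppr0 !mul0r subr0 addr0 !eqxx.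
have real_part (x : R) k : ad_norm (fun y : T => x%:C * wave y ([tuple 0 | _ < d], k)) `|x|.
  have := ad_norm_point [tuple 0 | _ < d] (if 0 <= x then k else k.+2) (normr_ge0 x).
  congr ad_norm; apply/funext => y.
  have := congr1 (fun f => f y) (sgn x k) => /= <-.
  rewrite mulrA; congr (_ * _); have [x0|x0] := leP 0 x.
    by rewrite mulr1 ger0_norm.
  by rewrite ltr0_norm// rmorphN mulrN1 opprK.
case: c => a b.
have := ad_norm_add (real_part a 0%N) (real_part b 1%N).
congr ad_norm; apply/funext => y; rewrite !wave0 mul0r mul1r cos0 sin0 cos_pihalf sin_pihalf.
by apply/eqP; rewrite eq_complex/=; apply/andP; split; apply/eqP; ring.
Qed.

Lemma ad_norm_algebra : function_algebra_norm (@ad_norm R d).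
Proof.
split; [exact: ad_norm_ge0|exact: ad_norm_cst|exact: ad_norm_mul|
  exact: ad_norm_series|exact: ad_norm_bound|exact: ad_norm_conj].
Qed.

Lemma ad_norm_wave (g : T) c : ad_norm (fun y => c * wave y (g, 0%N)) (norm1 c).
Proof.
have := ad_norm_mul (ad_norm_cst c) (ad_norm_point g 0 (@ler01 R)).
rewrite mulr1; congr ad_norm; apply/funext => y.
by rewrite mul1r.
Qed.

Lemma horner_cheb_Re (z : R[i]) k : z * z^* = 1 ->
  (cheb k).[complex.Re z] = complex.Re (z ^+ k).
Proof.
move=> z1; elim/nat_ind2: k => [||k h1 h2]; first by rewrite hornerC expr0.
  by rewrite hornerX expr1.
rewrite chebSS hornerD hornerN hornerMn hornerM hornerX h1 h2.
have -> : z ^+ k.+2 = z ^+ k.+1 * (z + z^*) - z ^+ k.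
  have zk : z ^+ k.+1 * z^* = z ^+ k by rewrite exprSr -mulrA z1 mulr1.
  by rewrite mulrDr zk -exprSr addrK.
case: z {z1 h1 h2} => a b; case: (_ ^+ k.+1) => p q; case: (_ ^+ k) => u v /=.
ring.
Qed.

Lemma wave_unimodular (y : T) w : wave y w * (wave y w)^* = 1.
Proof.
apply/eqP; rewrite eq_complex/=; apply/andP; split; apply/eqP; last by ring.
by rewrite -(cos2Dsin2 (angle y w)); ring.
Qed.

(** For the unimodular u = z wave, T_k(Re u) is the real part of u^k, again a multiple of a
    character by a number of modulus 1. The norms are thus bounded by 2 ([norm1] being at most twice
    the modulus), without any growth. *)
Lemma tempered_wave (g : T) (z : R[i]) : z * z^* = 1 ->
  tempered (@ad_norm R d) (fun y => complex.Re (z * wave y (g, 0%N))).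
Proof.
move=> z1.
have u1 y : (z * wave y (g, 0%N)) * (z * wave y (g, 0%N))^* = 1.
  by rewrite rmorphM mulrACA z1 wave_unimodular mulr1.
have mod1 (w : R[i]) : w * w^* = 1 -> modulus w = 1.
  move=> w1; have h : modulus w ^+ 2 = 1.
    by apply: complexI; rewrite rmorphXn /= -modulusE normCK w1.
  have m0 := modulus_ge0 w.
  by apply/eqP; rewrite -(@eqrXn2 _ 2)// h expr1n.
split=> [y|].
  rewrite -ler_norml -(mod1 _ (u1 y)) -lecR -modulusE.
  exact: normc_ge_Re.
exists 2, 0%N => k; rewrite expr0 mulr1.
have Nw : ad_norm (fun y : T => z ^+ k * wave y (g, 0%N) ^+ k) 2.
  have := ad_norm_mul (ad_norm_cst (z ^+ k)) (fan_exp ad_norm_algebra k (ad_norm_wave g 1)).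
  rewrite norm1_1 expr1n mulr1 => h.
  have zk : modulus (z ^+ k) = 1.
    by elim: k {h} => [|k IH]; rewrite ?modulus1// exprS modulusM IH mod1// mulr1.
  have := norm1_le_modulus (z ^+ k); rewrite zk mulr1 => z2.
  apply: (fan_eq _ (fan_le ad_norm_algebra h z2)) => y.
  by rewrite mul1r.
have := fan_scale ad_norm_algebra 2^-1%:C (ad_norm_add Nw (ad_norm_conj Nw)).
rewrite norm1_real ger0_norm//.
have -> : 2^-1 * (2 + 2) = 2 :> R by field.
congr ad_norm; apply/funext => y.
rewrite horner_cheb_Re ?u1// exprMn; case: (z ^+ k * _) => a b.
by apply/eqP; rewrite eq_complex/=; apply/andP; split; apply/eqP; field.
Qed.

Lemma localizable_wave (g : T) c :
  localizable (@ad_norm R d) (fun y => c * wave y (g, 0%N)).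
Proof.
have [->|c0] := eqVneq c 0.
  rewrite (_ : (fun y => _) = fun=> 0); first exact: localizable_cst ad_norm_algebra _.
  by apply/funext => y; rewrite mul0r.
pose z := c / `|c|.
have z1 : z * z^* = 1.
  by rewrite -normCK /z normf_div normr_id divff ?expr1n ?normr_eq0.
have iz1 : ('i * z) * ('i * z)^* = 1.
  by rewrite rmorphM mulrACA z1 mulr1; apply/eqP; rewrite eq_complex/=; apply/andP; split; apply/eqP; ring.
(* A unimodular u is Re u - i Re(i u), and both real parts are covered by [tempered_wave]. *)
have := localizable_scale ad_norm_algebra `|c|
  (localizable_add ad_norm_algebra
    (tempered_localizable ad_norm_algebra (tempered_wave g z1))
    (localizable_scale ad_norm_algebra (0 +i* -1)
      (tempered_localizable ad_norm_algebra (tempered_wave g iz1)))).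
congr localizable; apply/funext => y.
rewrite (_ : c * _ = `|c| * z * wave y (g, 0%N)); last first.
  by congr (_ * _); rewrite /z mulrC divfK// normr_eq0.
rewrite -mulrA; congr (_ * _).
case: z {z1 iz1} => a b; case: (wave y _) => p q.
apply/eqP; rewrite eq_complex/=; apply/andP; split; apply/eqP; ring.
Qed.

End discrete_part.

(** * Densities *)

Section density_measure.
Context {R : realType} {disp : measure_display} {T : measurableType disp}.
Variables (mu : {measure set T -> \bar R}) (f : T -> R) (mf : measurable_fun setT f).

(** The absolute value makes this a measure for every f; the proof of measurability is an argument
    so that the measure structure can be attached. *)
Definition density_fun of measurable_fun setT f : set T -> \bar R :=
  fun A => (\int[mu]_(x in A) `|f x|%:E)%E.

Let density_fun0 : density_fun mf set0 = 0%E.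
Proof. exact: integral_set0. Qed.

Let density_fun_ge0 A : (0 <= density_fun mf A)%E.
Proof. by apply: integral_ge0 => x _; rewrite lee_fin. Qed.

Let density_fun_sigma_additive : semi_sigma_additive (density_fun mf).
Proof.
move=> F mF tF mUF; rewrite /density_fun ge0_integral_bigcup//.
- by apply: is_cvg_ereal_nneg_natsum_cond => n _ _; apply: integral_ge0 => x _; rewrite lee_fin.
- by apply: measurable_funTS; apply/measurable_EFinP; exact: measurableT_comp.
Qed.

HB.instance Definition _ := isMeasure.Build _ _ _ (density_fun mf)
  density_fun0 density_fun_ge0 density_fun_sigma_additive.

Definition density_measure : {measure set T -> \bar R} := density_fun mf.

End density_measure.

Section density_integral.
Context {R : realType} {disp : measure_display} {T : measurableType disp}.
Variables (mu : {sigma_finite_measure set T -> \bar R}).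
Variables (f : T -> R) (mf : measurable_fun setT f).
Hypothesis fi : mu.-integrable setT (EFin \o f).

Lemma density_finite : (density_measure mu mf setT < +oo)%E.
Proof. by have /integrableP[_] := fi. Qed.

Lemma density_dominates : density_measure mu mf `<< mu.
Proof.
apply/null_content_dominatesP => A mA A0.
apply: null_set_integral => //; apply: measurable_funTS.
by apply/measurable_EFinP; exact: measurableT_comp.
Qed.

(** Change of variables for the Radon-Nikodym derivative of the density measure, which agrees with
    |f| almost everywhere since both have the same integrals over measurable sets. *)
Lemma Rintegral_density (phi : T -> R) (C : R) : measurable_fun setT phi ->
  (forall x, `|phi x| <= C) ->
  \int[density_measure mu mf]_x phi x = \int[mu]_x (phi x * `|f x|).
Proof.
move=> mphi phiC; congr fine.
have nuoo := density_finite.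
pose nu := finite_copy nuoo.
have numu : nu `<< mu by exact: density_dominates.
have phii : nu.-integrable setT (EFin \o phi).
  exact: (bounded_integrable nuoo mphi phiC).
rewrite -[LHS]/(\int[nu]_x (EFin \o phi) x)%E.
rewrite -(Radon_Nikodym_change_of_variables numu measurableT phii).
have afi : mu.-integrable setT (fun x => `|f x|%:E).
  exact: (integrable_abse fi).
apply: ae_eq_integral => //.
- apply: emeasurable_funM => //; exact/measurable_EFinP.
- by apply/measurable_EFinP; apply: measurable_funM => //; exact: measurableT_comp.
have h : ae_eq mu setT (Radon_Nikodym (charge_of_finite_measure nu) mu) (fun x => `|f x|%:E).
  apply: integral_ae_eq => //; first exact: Radon_Nikodym_integrable.
    exact: (measurable_int mu afi).
  by move=> E _ mE; rewrite -Radon_Nikodym_integral.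
by apply: filterS h => x /= h xT; rewrite h// EFinM.
Qed.

End density_integral.

Section bounded_multiplier.
Context {R : realType} {disp : measure_display} {T : measurableType disp}.

Lemma integrable_bounded_mul (m : {measure set T -> \bar R}) (f g : T -> R) (C : R) :
  m.-integrable setT (EFin \o f) ->
  measurable_fun setT g -> (forall x, `|g x| <= C) ->
  m.-integrable setT (EFin \o (fun x => f x * g x)).
Proof.
move=> fi mg gC; have mf : measurable_fun setT f.
  by have /measurable_EFinP := measurable_int _ fi.
have Cfi : m.-integrable setT (EFin \o (fun x => C * f x)).
  rewrite (_ : _ \o _ = (fun x => C%:E * (f x)%:E)%E).
    exact: integrableZl.
  by apply/funext => x /=; rewrite EFinM.
apply: (le_integrable measurableT _ _ Cfi).
  by apply/measurable_EFinP; exact: measurable_funM.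
move=> x _ /=; rewrite lee_fin !normrM mulrC ler_wpM2r//.
exact: le_trans (ler_norm _).
Qed.

End bounded_multiplier.

Section density_transform.
Context {R : realType} {d : nat}.
Local Notation T := (d.-tuple R).
Local Notation Om := (d.-tuple R * nat)%type.
Local Notation lam := (lebesgue_tuple d).

Definition ftd (f : T -> R) (y : T) : R[i] :=
  (\int[lam]_x (f x * cos (angle y (x, 0%N)))) +i*
  (\int[lam]_x (f x * sin (angle y (x, 0%N)))).

Lemma measurable_phase0 : measurable_fun setT (fun x : T => (x, 0%N)).
Proof. by apply: measurable_fun_pair. Qed.

Lemma measurable_cos_phase0 (y : T) :
  measurable_fun setT (fun x : T => cos (angle y (x, 0%N))).
Proof. exact: (measurableT_comp (measurable_cos_angle y) measurable_phase0). Qed.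

Lemma measurable_sin_phase0 (y : T) :
  measurable_fun setT (fun x : T => sin (angle y (x, 0%N))).
Proof. exact: (measurableT_comp (measurable_sin_angle y) measurable_phase0). Qed.

Lemma integrable_cos (f : T -> R) y : lam.-integrable setT (EFin \o f) ->
  lam.-integrable setT (EFin \o (fun x => f x * cos (angle y (x, 0%N)))).
Proof.
move=> fi; apply: (integrable_bounded_mul fi (measurable_cos_phase0 y)) => x.
exact: cos_max.
Qed.

Lemma integrable_sin (f : T -> R) y : lam.-integrable setT (EFin \o f) ->
  lam.-integrable setT (EFin \o (fun x => f x * sin (angle y (x, 0%N)))).
Proof.
move=> fi; apply: (integrable_bounded_mul fi (measurable_sin_phase0 y)) => x.
exact: sin_max.
Qed.

Lemma ft_density (f : T -> R) (mf : measurable_fun setT f) y :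
  lam.-integrable setT (EFin \o f) -> (forall x, 0 <= f x) ->
  ft (push_measure (density_measure lam mf) measurable_phase0) y = ftd f y.
Proof.
move=> fi f0; have oo := density_finite mf fi.
rewrite /ft (Rintegral_push _ oo (measurable_cos_angle y) (fun w => cos_max _)).
rewrite (Rintegral_push _ oo (measurable_sin_angle y) (fun w => sin_max _)).
rewrite (Rintegral_density mf fi (measurable_cos_phase0 y) (fun w => cos_max _)).
rewrite (Rintegral_density mf fi (measurable_sin_phase0 y) (fun w => sin_max _)).
by congr (_ +i* _); apply: eq_Rintegral => x _; rewrite ger0_norm// mulrC.
Qed.

Lemma ad_norm_density_ge0 (f : T -> R) :
  lam.-integrable setT (EFin \o f) -> (forall x, 0 <= f x) ->
  ad_norm (ftd f) (\int[lam]_x f x).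
Proof.
move=> fi f0; have mf : measurable_fun setT f.
  by have /measurable_EFinP := measurable_int _ fi.
exists (push_measure (density_measure lam mf) measurable_phase0); split.
- rewrite [leLHS]/(density_measure lam mf (_ @^-1` setT)) preimage_setT.
  rewrite /Rintegral fineK; last exact: integrable_fin_num.
  have E : (density_measure lam mf setT = \int[lam]_x (f x)%:E)%E.
    by apply: eq_integral => x _; rewrite ger0_norm.
  by rewrite -E; exact: lexx.
- exists (fun=> [tuple 0 | _ < d]) => A mA A0 _.
  rewrite -[LHS]/(density_measure lam mf (_ @^-1` (A `*` setT))).
  rewrite (_ : _ @^-1` _ = A); last first.
    by apply/seteqP; split=> x /=; [move=> []|].
  have /null_content_dominatesP := @density_dominates R _ _ lam f mf; exact.
- by move=> y; rewrite ft_density.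
Qed.

Lemma ftdB (f g : T -> R) y : lam.-integrable setT (EFin \o f) ->
  lam.-integrable setT (EFin \o g) -> ftd (fun x => f x - g x) y = ftd f y - ftd g y.
Proof.
move=> fi gi; apply/eqP; rewrite eq_complex/=; apply/andP; split; apply/eqP.
  rewrite -RintegralB//; [|exact: integrable_cos..].
  by apply: eq_Rintegral => x _; rewrite mulrBl.
rewrite -RintegralB//; [|exact: integrable_sin..].
by apply: eq_Rintegral => x _; rewrite mulrBl.
Qed.

Lemma ftdZ (c : R) (f : T -> R) y : lam.-integrable setT (EFin \o f) ->
  ftd (fun x => c * f x) y = c%:C * ftd f y.
Proof.
move=> fi; apply/eqP; rewrite eq_complex/= !mul0r subr0 addr0.
apply/andP; split; apply/eqP.
  rewrite -RintegralZl//; last exact: integrable_cos.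
  by apply: eq_Rintegral => x _; rewrite mulrA.
rewrite -RintegralZl//; last exact: integrable_sin.
by apply: eq_Rintegral => x _; rewrite mulrA.
Qed.

(** The positive and the negative part are represented separately, and their masses add up to the
    L^1 norm without loss. *)
Lemma ad_norm_density (f : T -> R) : lam.-integrable setT (EFin \o f) ->
  ad_norm (ftd f) (\int[lam]_x `|f x|).
Proof.
move=> fi.
have ai : lam.-integrable setT (EFin \o (fun x => `|f x|)) by exact: integrable_norm.
have half (g h : T -> R) : lam.-integrable setT (EFin \o g) ->
    lam.-integrable setT (EFin \o h) ->
    lam.-integrable setT (EFin \o (fun x => 2^-1 * (g x + h x))).
  move=> gi hi; rewrite (_ : _ \o _ = (fun x => 2^-1%:E * ((g x)%:E + (h x)%:E))%E).
    by apply: integrableZl => //; exact: integrableD.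
  by apply/funext => x /=; rewrite EFinM EFinD.
have Ni : lam.-integrable setT (EFin \o (fun x => - f x)).
  by rewrite (_ : _ \o _ = (\- (EFin \o f))%E)//; exact: integrableN.
pose fp x := 2^-1 * (`|f x| + f x); pose fm x := 2^-1 * (`|f x| + - f x).
have fpi := half _ _ ai fi; have fmi := half _ _ ai Ni.
have fp0 x : 0 <= fp x by rewrite /fp; have := ler_norm (- f x); rewrite normrN; lra.
have fm0 x : 0 <= fm x by rewrite /fm; have := ler_norm (f x); lra.
have := ad_norm_add (ad_norm_density_ge0 fpi fp0)
  (fan_scale ad_norm_algebra (-1) (ad_norm_density_ge0 fmi fm0)).
rewrite norm1N norm1_1 mul1r -RintegralD//.
rewrite (_ : \int[lam]_x (fp x + fm x) = \int[lam]_x `|f x|); last first.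
  by apply: eq_Rintegral => x _; rewrite /fp /fm; lra.
apply: fan_eq => y; rewrite mulN1r -ftdB//.
by congr ftd; apply/funext => x; rewrite /fp /fm; lra.
Qed.

End density_transform.

Section localizable_series.
Context {R : realType} {Y : Type}.
Variable N : (Y -> R[i]) -> R -> Prop.
Hypothesis HN : function_algebra_norm N.

Lemma series_tail (r : nat -> R) (s e : R) : (forall j, 0 <= r j) ->
  (forall n, \sum_(j < n) r j <= s) -> 0 < e ->
  exists n0, forall n, \sum_(j < n) r (n0 + j)%N <= e.
Proof.
move=> r0 rs e0; pose S := range (fun n : nat => \sum_(j < n) r j).
have hS : has_sup S.
  split; first by exists (\sum_(j < 0) r j), 0%N.
  by exists s => _ [n _ <-].
have [_ [n0 _ <-] hn0] := sup_adherent e0 hS.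
exists n0 => n.
have : \sum_(j < n0 + n) r j <= sup S.
  by apply: ub_le_sup; [case: hS|exists (n0 + n)%N].
by rewrite big_split_ord /=; lra.
Qed.

Lemma localizable_series (F : nat -> Y -> R[i]) (r : nat -> R) (G : Y -> R[i]) s :
  (forall j, localizable N (F j)) -> (forall j, N (F j) (r j)) ->
  (forall n, \sum_(j < n) r j <= s) -> (forall y, series_to (F^~ y) (G y)) ->
  localizable N G.
Proof.
move=> lF NF rs FG; apply: (localizable_lim HN) => e e0.
have [n0 hn0] := series_tail (fun j => fan_ge0 HN (NF j)) rs e0.
exists (fun y => \sum_(j < n0) F j y).
  by apply: (localizable_sum HN) => j _; exact: lF.
apply: (fan_series HN (fun j => NF (n0 + j)%N) hn0) => y e' e'0.
have [n1 hn1] := FG y e' e'0.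
exists n1 => n hn.
have := hn1 (n0 + n)%N (leq_trans hn (leq_addl _ _)).
rewrite big_split_ord /= => h.
have E (a b c : R[i]) : b - (c - a) = a + b - c by ring.
by rewrite E.
Qed.

End localizable_series.

(** * Convolution of integrable functions *)

Section convolution.
Context {R : realType} {d : nat}.
Local Notation T := (d.-tuple R).
Local Notation lam := (lebesgue_tuple d).
Implicit Types f g h : T -> R.

Definition tuple_sub (x t : T) : T := tuple_add x (tuple_opp t).

Lemma tnth_sub x t i : tnth (tuple_sub x t) i = tnth x i - tnth t i.
Proof. by rewrite tnth_add tnth_opp. Qed.

Lemma integrable_measurable f : lam.-integrable setT (EFin \o f) -> measurable_fun setT f.
Proof. by move=> fi; have /measurable_EFinP := measurable_int _ fi. Qed.

Lemma integral_affine (s : R) (v : T) (F : T -> \bar R) : s = 1 \/ s = -1 ->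
  measurable_fun setT F -> (\int[lam]_x F (affine_tuple s v x) = \int[lam]_x F x)%E.
Proof.
move=> hs mF.
have ge0 (G : T -> \bar R) : measurable_fun setT G -> (forall x, 0 <= G x)%E ->
    (\int[lam]_x G (affine_tuple s v x) = \int[lam]_x G x)%E.
  move=> mG G0; pose nu := push_measure lam (measurable_affine_tuple s v).
  transitivity (\int[nu]_x G x)%E.
    by rewrite /nu ge0_integral_pushforward//; exact: measurable_affine_tuple.
  by apply: eq_measure_integral => A mA _; exact: lebesgue_tuple_affine.
rewrite [LHS]integralE [RHS]integralE; congr (_ - _)%E.
  rewrite -(ge0 (F^\+)%E)//; last exact: measurable_funepos.
  by apply: eq_integral => x _; rewrite !funeposE.
rewrite -(ge0 (F^\-)%E)//; last exact: measurable_funeneg.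
by apply: eq_integral => x _; rewrite !funenegE.
Qed.

Lemma Rintegral_affine (s : R) (v : T) f : s = 1 \/ s = -1 ->
  measurable_fun setT f -> \int[lam]_x f (affine_tuple s v x) = \int[lam]_x f x.
Proof.
move=> hs mf; rewrite /Rintegral (integral_affine v hs (F := EFin \o f))//.
exact/measurable_EFinP.
Qed.

Lemma integrable_affine (s : R) (v : T) f : s = 1 \/ s = -1 ->
  lam.-integrable setT (EFin \o f) ->
  lam.-integrable setT (EFin \o (fun x => f (affine_tuple s v x))).
Proof.
move=> hs fi; have mf := integrable_measurable fi; apply/integrableP; split.
  apply/measurable_EFinP; apply: measurableT_comp => //.
  exact: measurable_affine_tuple.
rewrite (integral_affine v hs (F := fun x => `|(f x)%:E|%E)).
  by have /integrableP[] := fi.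
by apply: measurableT_comp => //; exact/measurable_EFinP.
Qed.

Lemma tuple_subE (x t : T) : tuple_sub x t = affine_tuple 1 (tuple_opp t) x.
Proof. by apply: eq_from_tnth => i; rewrite tnth_sub tnth_mktuple tnth_opp mul1r. Qed.

Lemma Rintegral_shift (t : T) f : measurable_fun setT f ->
  \int[lam]_x f (tuple_sub x t) = \int[lam]_x f x.
Proof.
move=> mf; rewrite -[RHS](Rintegral_affine (tuple_opp t) (or_introl erefl) mf).
by apply: eq_Rintegral => x _; rewrite tuple_subE.
Qed.

Lemma measurable_sub : measurable_fun setT (fun p : T * T => tuple_sub p.1 p.2).
Proof.
apply: measurable_tuple_add; first exact: measurable_fst.
exact: (measurableT_comp (measurable_affine_tuple _ _)).
Qed.

Lemma integrable_kernel f g : lam.-integrable setT (EFin \o f) ->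
  lam.-integrable setT (EFin \o g) ->
  (lam \x lam)%E.-integrable setT (EFin \o (fun p : T * T => g p.2 * f (tuple_sub p.1 p.2))).
Proof.
move=> fi gi; have mf := integrable_measurable fi; have mg := integrable_measurable gi.
have mF : measurable_fun setT (fun p : T * T => g p.2 * f (tuple_sub p.1 p.2)).
  apply: measurable_funM; first exact: measurableT_comp.
  exact: (measurableT_comp mf measurable_sub).
apply/integrableP; split; first exact/measurable_EFinP.
have mAF : measurable_fun setT (fun p : T * T => `|(g p.2 * f (tuple_sub p.1 p.2))%:E|%E).
  by apply: measurableT_comp => //; exact/measurable_EFinP.
rewrite fubini_tonelli1// fubini_tonelli//.
have inner t : fubini_G lam (fun p : T * T => `|(g p.2 * f (tuple_sub p.1 p.2))%:E|%E) t =
    (`|g t|%:E * \int[lam]_x `|(f x)%:E|)%E.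
  rewrite /fubini_G /=.
  under eq_integral do rewrite normrM EFinM.
  rewrite ge0_integralZl//; last first.
    apply/measurable_EFinP; apply: measurableT_comp => //.
    by apply: (measurableT_comp mf); exact: (measurableT_comp measurable_sub (pair2_measurable _)).
  congr (_ * _)%E.
  rewrite -[RHS](integral_affine (tuple_opp t) (or_introl erefl) (F := fun x => `|(f x)%:E|%E)).
    by apply: eq_integral => x _; rewrite tuple_subE.
  by apply: measurableT_comp => //; exact/measurable_EFinP.
rewrite (eq_integral (fun t => `|g t|%:E * \int[lam]_x `|(f x)%:E|)%E); last first.
  by move=> t _; exact: inner.
have fE : (\int[lam]_x `|(f x)%:E| = (fine (\int[lam]_x `|(f x)%:E|))%:E)%E.
  rewrite fineK// ge0_fin_numE; last by apply: integral_ge0.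
  by have /integrableP[] := fi.
rewrite fE; under eq_integral do rewrite muleC.
have f0 : (0 <= (fine (\int[lam]_x `|(f x)%:E|))%:E)%E.
  by rewrite lee_fin fine_ge0// integral_ge0.
rewrite ge0_integralZl//; last by apply/measurable_EFinP; exact: measurableT_comp.
rewrite lte_mul_pinfty// ?lee_fin ?fine_ge0 ?integral_ge0//.
by have /integrableP[] := gi.
Qed.

Lemma Rfubini (F : T * T -> R) : (lam \x lam)%E.-integrable setT (EFin \o F) ->
  (forall x, lam.-integrable setT (EFin \o (fun t => F (x, t)))) ->
  (forall t, lam.-integrable setT (EFin \o (fun x => F (x, t)))) ->
  \int[lam]_x \int[lam]_t F (x, t) = \int[lam]_t \int[lam]_x F (x, t).
Proof.
move=> Fi F1 F2; have h := Fubini Fi.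
rewrite [LHS]/Rintegral [RHS]/Rintegral; congr fine.
transitivity (\int[lam]_x \int[lam]_t (F (x, t))%:E)%E.
  by apply: eq_integral => x _; rewrite /Rintegral fineK//; exact: (integrable_fin_num measurableT (F1 x)).
rewrite [LHS]h; apply: eq_integral => t _.
by rewrite /Rintegral fineK//; exact: (integrable_fin_num measurableT (F2 t)).
Qed.

(** Integrable and bounded functions are in L^1 and in L^2, and their convolution with an integrable
    function is defined at every point, not only almost everywhere. *)
Definition tame f := lam.-integrable setT (EFin \o f) /\
  exists M : R, forall x, `|f x| <= M.

Definition conv g f (x : T) : R := \int[lam]_t (g t * f (tuple_sub x t)).

Lemma conv_integrand g f x : lam.-integrable setT (EFin \o g) -> tame f ->
  lam.-integrable setT (EFin \o (fun t => g t * f (tuple_sub x t))).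
Proof.
move=> gi [fi [M fM]]; apply: (integrable_bounded_mul gi (C := M)) => //.
apply: (measurableT_comp (integrable_measurable fi)).
exact: (measurableT_comp measurable_sub (pair1_measurable _)).
Qed.

Lemma conv_tame g f : lam.-integrable setT (EFin \o g) -> tame f -> tame (conv g f).
Proof.
move=> gi tf; have [fi [M fM]] := tf; split.
  have := integrable_fubini_F (integrable_kernel fi gi).
  congr (lam.-integrable); apply/funext => x.
  rewrite /fubini_F /conv /= /Rintegral fineK//.
  exact: (integrable_fin_num measurableT (conv_integrand x gi tf)).
exists (M * \int[lam]_t `|g t|) => x.
have ci := conv_integrand x gi tf.
rewrite (le_trans (le_normr_Rintegral measurableT ci))//.
have ai : lam.-integrable setT (EFin \o (fun x => `|g x|)) by exact: integrable_norm.
rewrite -RintegralZl//; apply: le_Rintegral => //.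
- exact: integrable_norm.
- rewrite (_ : _ \o _ = (fun x => M%:E * (`|g x|)%:E)%E); first exact: integrableZl.
  by apply/funext => t /=; rewrite EFinM.
- by move=> t _; rewrite normrM mulrC ler_wpM2r.
Qed.

(** Fubini and the substitution of x + t for x. With phi a cosine or sine it gives the convolution
    theorem, with phi a tame function the symmetry of convolution, with phi = 1 the integral of a
    convolution. *)
Lemma conv_pairing g f (phi : T -> R) (C : R) : lam.-integrable setT (EFin \o g) -> tame f ->
  measurable_fun setT phi -> (forall x, `|phi x| <= C) ->
  \int[lam]_x (conv g f x * phi x) =
  \int[lam]_t (g t * \int[lam]_x (f x * phi (tuple_add x t))).
Proof.
move=> gi tf mphi phiC; have [fi [M fM]] := tf.
have mf := integrable_measurable fi.
pose F (p : T * T) := g p.2 * f (tuple_sub p.1 p.2) * phi p.1.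
have Fi : (lam \x lam)%E.-integrable setT (EFin \o F).
  apply: (integrable_bounded_mul (integrable_kernel fi gi) (C := C)).
    exact: (measurableT_comp mphi measurable_fst).
  by move=> p; exact: phiC.
have F1 x : lam.-integrable setT (EFin \o (fun t => F (x, t))).
  exact: (integrable_bounded_mul (conv_integrand x gi tf) (measurable_cst (phi x)) (fun=> phiC x)).
have fti t : lam.-integrable setT (EFin \o (fun x => f (tuple_sub x t) * phi x)).
  apply: (integrable_bounded_mul _ mphi phiC).
  rewrite (_ : _ \o _ = EFin \o (fun x => f (affine_tuple 1 (tuple_opp t) x))).
    by apply: integrable_affine => //; left.
  by apply/funext => x /=; rewrite tuple_subE.
have F2 t : lam.-integrable setT (EFin \o (fun x => F (x, t))).
  rewrite (_ : _ \o _ = (fun x => (g t)%:E * (f (tuple_sub x t) * phi x)%:E)%E).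
    by apply: integrableZl => //; exact: fti.
  by apply/funext => x; rewrite /F /= -EFinM mulrA.
transitivity (\int[lam]_x \int[lam]_t F (x, t)).
  apply: eq_Rintegral => x _; rewrite /conv -RintegralZr//.
  exact: conv_integrand.
rewrite (Rfubini Fi F1 F2); apply: eq_Rintegral => t _.
transitivity (\int[lam]_x (g t * (f (tuple_sub x t) * phi x))).
  by apply: eq_Rintegral => x _; rewrite /F mulrA.
rewrite (RintegralZl (g t) measurableT (fti t)).
congr (_ * _).
rewrite -(Rintegral_shift t (f := fun x => f x * phi (tuple_add x t))).
  apply: eq_Rintegral => x _; congr (_ * phi _).
  by apply: eq_from_tnth => i; rewrite tnth_add tnth_sub subrK.
apply: measurable_funM => //; apply: (measurableT_comp mphi).
by apply: measurable_tuple_add => //; exact: measurable_cst.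
Qed.

End convolution.

(** * Convolution as an operator on square-integrable functions *)

Section convolution_energy.
Context {R : realType} {d : nat}.
Local Notation T := (d.-tuple R).
Local Notation lam := (lebesgue_tuple d).
Implicit Types f g h : T -> R.

Definition ip f h : R := \int[lam]_x (f x * h x).

Lemma tame_measurable f : tame f -> measurable_fun setT f.
Proof. by move=> [fi _]; exact: integrable_measurable. Qed.

Lemma tame_mul f h : tame f -> tame h -> tame (fun x => f x * h x).
Proof.
move=> [fi [M fM]] th; have [hi [M' hM']] := th; split.
  exact: (integrable_bounded_mul fi (tame_measurable th) hM').
by exists (M * M') => x; rewrite normrM ler_pM.
Qed.

Lemma tame_scale (a : R) f : tame f -> tame (fun x => a * f x).
Proof.
move=> [fi [M fM]]; split.
  rewrite (_ : _ \o _ = (fun x => a%:E * (f x)%:E)%E); first exact: integrableZl.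
  by apply/funext => x /=; rewrite EFinM.
by exists (`|a| * M) => x; rewrite normrM ler_wpM2l.
Qed.

Lemma tame_add f h : tame f -> tame h -> tame (fun x => f x + h x).
Proof.
move=> [fi [M fM]] [hi [M' hM']]; split.
  rewrite (_ : _ \o _ = (fun x => (f x)%:E + (h x)%:E)%E); first exact: integrableD.
  by apply/funext => x /=; rewrite EFinD.
by exists (M + M') => x; rewrite (le_trans (ler_normD _ _))// lerD.
Qed.

Lemma ipC f h : ip f h = ip h f.
Proof. by apply: eq_Rintegral => x _; rewrite mulrC. Qed.

Lemma ipDl f h k : tame f -> tame h -> tame k ->
  ip (fun x => f x + h x) k = ip f k + ip h k.
Proof.
move=> tf th tk; rewrite /ip -RintegralD//; last 2 first.
- by have [] := tame_mul tf tk.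
- by have [] := tame_mul th tk.
by apply: eq_Rintegral => x _; rewrite mulrDl.
Qed.

Lemma ipZl (a : R) f k : tame f -> tame k -> ip (fun x => a * f x) k = a * ip f k.
Proof.
move=> tf tk; rewrite /ip -RintegralZl//; last by have [] := tame_mul tf tk.
by apply: eq_Rintegral => x _; rewrite mulrA.
Qed.

Lemma ip_ge0 f : 0 <= ip f f.
Proof. by apply: Rintegral_ge0 => x _; rewrite -expr2 sqr_ge0. Qed.

Lemma tuple_oppK (x : T) : tuple_opp (tuple_opp x) = x.
Proof. by apply: eq_from_tnth => i; rewrite !tnth_opp opprK. Qed.

Lemma Rintegral_opp f : measurable_fun setT f ->
  \int[lam]_x f (tuple_opp x) = \int[lam]_x f x.
Proof. by move=> mf; rewrite Rintegral_affine//; right. Qed.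

Lemma tame_opp f : tame f -> tame (fun x => f (tuple_opp x)).
Proof.
move=> [fi [M fM]]; split; last by exists M => x.
by apply: integrable_affine => //; right.
Qed.

(** Let Phi(t) be the integral of f(x) h(x + t) over x. The left side is the integral of g(t)
    Phi(t), the inner product on the right that of g(t) Phi(-t), and the reflection of t produces
    the factor e. *)
Lemma conv_sym (e : R) g f h : e ^+ 2 = 1 -> lam.-integrable setT (EFin \o g) ->
  (forall t, g (tuple_opp t) = e * g t) -> tame f -> tame h ->
  ip (conv g f) h = e * ip f (conv g h).
Proof.
move=> e2 gi ge tf th.
have [fi [M fM]] := tf; have [hi [M' hM']] := th.
have mf := tame_measurable tf; have mh := tame_measurable th.
pose Phi t := \int[lam]_x (f x * h (tuple_add x t)).
have PhiE t : Phi t = conv (fun x => f (tuple_opp x)) h t.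
  rewrite /Phi -(Rintegral_opp (f := fun x => f x * h (tuple_add x t))).
    apply: eq_Rintegral => x _; congr (_ * h _).
    by apply: eq_from_tnth => i; rewrite tnth_add tnth_sub tnth_opp addrC.
  apply: measurable_funM => //; apply: (measurableT_comp mh).
  by apply: measurable_tuple_add => //; exact: measurable_cst.
have tPhi : tame Phi.
  have -> : Phi = conv (fun x => f (tuple_opp x)) h by apply/funext => t; exact: PhiE.
  by apply: conv_tame => //; have [] := tame_opp tf.
rewrite {1}/ip (conv_pairing gi tf mh hM') -/Phi.
rewrite (ipC f) /ip (conv_pairing gi th mf fM).
have shiftE t : \int[lam]_x (h x * f (tuple_add x t)) = Phi (tuple_opp t).
  rewrite -(Rintegral_shift t (f := fun x => h x * f (tuple_add x t))).
    apply: eq_Rintegral => x _; rewrite [RHS]mulrC; congr (_ * _).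
    by congr f; apply: eq_from_tnth => i; rewrite tnth_add tnth_sub subrK.
  apply: measurable_funM => //; apply: (measurableT_comp mf).
  by apply: measurable_tuple_add => //; exact: measurable_cst.
transitivity (\int[lam]_t (g t * Phi t)); first by [].
have mgP : measurable_fun setT (fun t => g t * Phi t).
  by apply: measurable_funM; [exact: integrable_measurable|exact: tame_measurable].
have [oPi [B oPB]] := tame_opp tPhi.
rewrite -(Rintegral_opp mgP) -RintegralZl//; last first.
  apply: (integrable_bounded_mul gi (C := B)) => [|t]; last by rewrite shiftE.
  rewrite (_ : (fun t => _) = Phi \o tuple_opp); first exact: integrable_measurable.
  by apply/funext => t; exact: shiftE.
by apply: eq_Rintegral => t _; rewrite ge shiftE mulrA.
Qed.

(** Young's inequality with constant 1/2, by a quadratic estimate under the integral. With c the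
    value of the convolution at x and u = f(x - t), one has 4 c g u <= |g| (4 c^2 + u^2);
    integration over t gives 4 c^2 <= 2 c^2 + S(x), and the integral of S is the L^1 norm of g times
    the square norm of f. *)
Lemma conv_norm g f : tame g -> \int[lam]_t `|g t| <= 2^-1 -> tame f ->
  ip (conv g f) (conv g f) <= 4^-1 * ip f f.
Proof.
move=> tg g2 tf; have [gi _] := tg.
have agi : lam.-integrable setT (EFin \o (fun x => `|g x|)) by exact: integrable_norm.
have tff := tame_mul tf tf.
pose S := conv (fun t => `|g t|) (fun x => f x * f x).
have tS : tame S by exact: conv_tame.
have tC : tame (conv g f) by exact: conv_tame.
have pw x : conv g f x * conv g f x <= 2^-1 * S x.
  set c := conv g f x.
  have ci := conv_integrand x gi tf.
  have Si := conv_integrand x agi tff.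
  have : \int[lam]_t (4 * c * (g t * f (tuple_sub x t))) <=
      \int[lam]_t (4 * c ^+ 2 * `|g t| + `|g t| * (f (tuple_sub x t) * f (tuple_sub x t))).
    have i1 : lam.-integrable setT (EFin \o (fun t => 4 * c * (g t * f (tuple_sub x t)))).
      rewrite (_ : _ \o _ = (fun t => (4 * c)%:E * (g t * f (tuple_sub x t))%:E)%E).
        exact: integrableZl.
      by apply/funext => t /=; rewrite EFinM.
    have i2 : lam.-integrable setT (EFin \o (fun t => 4 * c ^+ 2 * `|g t| +
        `|g t| * (f (tuple_sub x t) * f (tuple_sub x t)))).
      rewrite (_ : _ \o _ = (fun t => (4 * c ^+ 2)%:E * (`|g t|)%:E +
          (`|g t| * (f (tuple_sub x t) * f (tuple_sub x t)))%:E)%E).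
        by apply: integrableD => //; exact: integrableZl.
      by apply/funext => t /=; rewrite EFinD EFinM.
    apply: le_Rintegral => // t _; set u := f _.
    have -> : 4 * c * (g t * u) = g t * (4 * c * u) by ring.
    have -> : 4 * c ^+ 2 * `|g t| + `|g t| * (u * u) = `|g t| * (4 * c ^+ 2 + u * u).
      by ring.
    rewrite (le_trans (ler_norm _))// normrM ler_wpM2l// ler_norml.
    have h1 : 0 <= (2 * c - u) * (2 * c - u) by rewrite -expr2 sqr_ge0.
    have h2 : 0 <= (2 * c + u) * (2 * c + u) by rewrite -expr2 sqr_ge0.
    have u2 : 0 <= u * u by rewrite -expr2 sqr_ge0.
    have c2 : 0 <= c * c by rewrite -expr2 sqr_ge0.
    by rewrite expr2; apply/andP; split; lra.
  rewrite RintegralZl// RintegralD//; last first.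
    rewrite (_ : _ \o _ = (fun t => (4 * c ^+ 2)%:E * (`|g t|)%:E)%E).
      exact: integrableZl.
    by apply/funext => t /=; rewrite EFinM.
  rewrite RintegralZl// -/(conv g f x) -/c.
  rewrite -[X in _ + X]/(S x).
  have := ler_wpM2l (sqr_ge0 c) g2; rewrite !expr2; lra.
have SE : \int[lam]_x S x = (\int[lam]_t `|g t|) * ip f f.
  have := conv_pairing agi tff (measurable_cst (1 : R)) (C := 1) (fun=> _).
  move=> /(_ _)/= h.
  have -> : \int[lam]_x S x = \int[lam]_x (S x * 1).
    by apply: eq_Rintegral => x _; rewrite mulr1.
  rewrite h; last by rewrite normr1.
  rewrite -(RintegralZr _ measurableT agi); apply: eq_Rintegral => t _.
  by congr (_ * _); apply: eq_Rintegral => x _; rewrite mulr1.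
have := ip_ge0 f.
have : ip (conv g f) (conv g f) <= 2^-1 * \int[lam]_x S x.
  rewrite -RintegralZl//; last by case: tS.
  apply: le_Rintegral => //.
  - by have [] := tame_mul tC tC.
  - by have [] := tame_scale 2^-1 tS.
rewrite SE; nra.
Qed.

Lemma ftd_conv g f y : lam.-integrable setT (EFin \o g) -> tame f ->
  ftd (conv g f) y = ftd g y * ftd f y.
Proof.
move=> gi tf; have [fi _] := tf.
have angleD (x t : T) : wave y (tuple_add x t, 0%N) = wave y (x, 0%N) * wave y (t, 0%N).
  exact: (wave_add y (x, 0%N) (t, 0%N)).
rewrite {1}/ftd (conv_pairing gi tf (measurable_cos_phase0 y) (fun w => cos_max _)).
rewrite (conv_pairing gi tf (measurable_sin_phase0 y) (fun w => sin_max _)).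
have fc := integrable_cos y fi; have fs := integrable_sin y fi.
have gc := integrable_cos y gi; have gs := integrable_sin y gi.
have Zi (c : R) k : lam.-integrable setT (EFin \o k) ->
    lam.-integrable setT (EFin \o (fun x => k x * c)).
  move=> ki; rewrite (_ : _ \o _ = (fun x => (k x)%:E * c%:E)%E); first exact: integrableZr.
  by apply/funext => x /=; rewrite EFinM.
apply/eqP; rewrite eq_complex/=; apply/andP; split; apply/eqP.
  rewrite -!RintegralZr// -RintegralB//; [|exact: Zi..].
  apply: eq_Rintegral => t _; rewrite -!mulrA -mulrBr; congr (_ * _).
  rewrite [cos _ * _]mulrC [sin _ * _]mulrC -!RintegralZr// -RintegralB//; [|exact: Zi..].
  apply: eq_Rintegral => x _; rewrite -!mulrA -mulrBr; congr (_ * _).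
  by have [] := angleD x t.
rewrite -!RintegralZr// -RintegralD//; [|exact: Zi..].
apply: eq_Rintegral => t _; rewrite -!mulrA -mulrDr; congr (_ * _).
rewrite [cos _ * _]mulrC [sin _ * _]mulrC -!RintegralZr// -RintegralD//; [|exact: Zi..].
apply: eq_Rintegral => x _; rewrite -!mulrA -mulrDr; congr (_ * _).
have [_] := angleD x t; rewrite addrC => ->; ring.
Qed.

End convolution_energy.

(** * Transforms of densities are localizable *)

Section localizable_density.
Context {R : realType} {d : nat}.
Local Notation T := (d.-tuple R).
Local Notation lam := (lebesgue_tuple d).
Implicit Types f g h : T -> R.

Definition supported (L : R) f := forall x, f x != 0 -> forall i, `|tnth x i| <= L.

Lemma supported_conv L M g f : supported L g -> supported M f ->
  supported (L + M) (conv g f).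
Proof.
move=> Lg Mf x; apply: contra_neqP => /existsNP[i /negP]; rewrite -ltNge => xi.
suff -> : conv g f x = \int[lam]_t (cst 0 t : R) by rewrite Rintegral_cst// mul0r.
apply: eq_Rintegral => t _; rewrite /=.
have [->|gt] := eqVneq (g t) 0; first by rewrite mul0r.
have [->|ft] := eqVneq (f (tuple_sub x t)) 0; first by rewrite mulr0.
have := Lg _ gt i; have := Mf _ ft i; rewrite tnth_sub => h1 h2.
have := ler_normD (tnth x i - tnth t i) (tnth t i); rewrite subrK; lra.
Qed.

Lemma supported_le L M f : L <= M -> supported L f -> supported M f.
Proof. by move=> LM hf x fx i; rewrite (le_trans (hf x fx i)). Qed.

Lemma supported_lin L (a b : R) f h : supported L f -> supported L h ->
  supported L (fun x => a * f x + b * h x).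
Proof.
move=> hf hh x; have [fx|fx _] := eqVneq (f x) 0; last exact: hf.
have [hx|hx _] := eqVneq (h x) 0; last exact: hh.
by rewrite fx hx !mulr0 addr0 eqxx.
Qed.

Definition box (L : R) : set T := [set x | forall i, `[-L, L]%classic (tnth x i)].

Lemma box_measure L : 0 <= L -> lam (box L) = ((2 * L) ^+ d)%:E.
Proof.
move=> L0; have := @lebesgue_tuple_box R d (fun=> `[-L, L]%classic) (fun=> measurable_itv _).
rewrite -/(box L) => ->.
have -> : lebesgue_measure `[-L, L]%classic = (2 * L)%:E.
  rewrite lebesgue_measure_itv/= lte_fin; case: ltP => h.
    by rewrite -EFinB; congr EFin; ring.
  by congr EFin; lra.
by rewrite prodEFin prodr_const card_ord.
Qed.

Lemma measurable_box L : measurable (box L).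
Proof.
rewrite (_ : box L = \bigcap_(i in [set: 'I_d]) ((@tnth _ R)^~ i @^-1` `[-L, L]%classic)).
  apply: fin_bigcap_measurable => [|i _]; first exact: finite_finset.
  by rewrite -[X in measurable X]setTI; exact: measurable_tnth.
by apply/seteqP; split => t /= Bt i => [_|]; exact: Bt.
Qed.

Lemma mem_box L x : box L x <-> forall i, `|tnth x i| <= L.
Proof.
split=> h i; have := h i; rewrite /= in_itv/=; first by rewrite ler_norml.
by rewrite ler_norml.
Qed.

(** |f| <= (1 + f^2)/2 on the box, whose volume is (2L)^d; this replaces the Cauchy-Schwarz
    inequality. *)
Lemma norm_L1_le L f : 0 <= L -> tame f -> supported L f ->
  \int[lam]_x `|f x| <= 2^-1 * ((2 * L) ^+ d + ip f f).
Proof.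
move=> L0 tf Lf.
have fi := (tame_mul tf tf).1.
have bi : lam.-integrable setT (EFin \o \1_(box L)).
  apply/integrableP; split.
    by apply/measurable_EFinP/measurable_indic; exact: (measurable_box L).
  under eq_integral do rewrite /= ger0_norm//.
  rewrite integral_indic//; last exact: measurable_box.
  apply: le_lt_trans (ltry ((2 * L) ^+ d)); rewrite setIT -(box_measure L0).
  exact: lexx.
have bE : \int[lam]_x \1_(box L) x = (2 * L) ^+ d.
  rewrite /Rintegral integral_indic//; last exact: measurable_box.
  by rewrite setIT -[RHS]/(fine ((2 * L) ^+ d)%:E) -(box_measure L0).
rewrite -bE /ip -RintegralD// -RintegralZl//; last first.
  rewrite (_ : _ \o _ = (fun x => (\1_(box L) x)%:E + (f x * f x)%:E)%E).
    exact: integrableD.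
  by apply/funext => x /=; rewrite EFinD.
apply: le_Rintegral => //.
- exact: (integrable_norm tf.1).
- rewrite (_ : _ \o _ = (fun x => 2^-1%:E * ((\1_(box L) x)%:E + (f x * f x)%:E))%E).
    by apply: integrableZl => //; exact: integrableD.
  by apply/funext => x /=; rewrite EFinM EFinD.
move=> x _; have [->|fx] := eqVneq (f x) 0.
  by rewrite normr0 mul0r addr0 mulr_ge0// indicE.
rewrite indicE mem_set/=; last by apply/mem_box; exact: Lf.
have := sqr_ge0 (`|f x| - 1); rewrite sqrrB real_normK ?num_real// expr2; lra.
Qed.

Section chebyshev_iterates.
Variables (g : T -> R) (e L : R).
Hypotheses (tg : tame g) (e2 : e ^+ 2 = 1) (L0 : 0 <= L) (Lg : supported L g).
Hypotheses (ge : forall t, g (tuple_opp t) = e * g t).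
Hypothesis (g2 : \int[lam]_t `|g t| <= 2^-1).

(* The transform of g is w p with w^2 = e and p real; that of cheb_conv n is then
   w^(n+1) T_n(p) p. *)
Fixpoint cheb_conv (n : nat) : T -> R :=
  if n is n1.+1 then
    if n1 is n2.+1 then
      fun x => 2 * conv g (cheb_conv n1) x + (- e) * cheb_conv n2 x
    else conv g g
  else g.

Lemma cheb_convSS n : cheb_conv n.+2 =
  fun x => 2 * conv g (cheb_conv n.+1) x + (- e) * cheb_conv n x.
Proof. by []. Qed.

Lemma cheb_conv_tame n : tame (cheb_conv n).
Proof.
have gi := tg.1.
elim/nat_ind2: n => [||n h1 h2]; [exact: tg|exact: conv_tame|].
by rewrite cheb_convSS; apply: tame_add; apply: tame_scale => //; exact: conv_tame.
Qed.

Lemma cheb_conv_supported n : supported (n.+1%:R * L) (cheb_conv n).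
Proof.
elim/nat_ind2: n => [||n h1 h2]; first by rewrite mul1r.
  by rewrite -[2%:R * L]/(2 * L) mulr_natl mulr2n; exact: supported_conv.
rewrite cheb_convSS; apply: supported_lin; last first.
  by apply: supported_le h1; rewrite ler_wpM2r// ler_nat leqW.
by rewrite -(addn1 n.+2) natrD mulrDl mul1r addrC; exact: supported_conv.
Qed.

(* Convolution with g is e-symmetric, so that this quadratic form is invariant
   under the three-term recurrence; it controls the L^2 norms of the iterates. *)
Lemma cheb_conv_energy n :
  ip (cheb_conv n.+1) (cheb_conv n.+1) + ip (cheb_conv n) (cheb_conv n)
  - 2 * ip (conv g (cheb_conv n)) (cheb_conv n.+1) = ip g g - ip (conv g g) (conv g g).
Proof.
have gi := tg.1.
elim: n => [|n IH]; first by rewrite /=; ring.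
rewrite -IH.
have t0 := cheb_conv_tame n; have t1 := cheb_conv_tame n.+1.
have tC := conv_tame gi t1.
have t2C := tame_scale 2 tC; have te := tame_scale (- e) t0.
have t2 := tame_add t2C te.
have lin k : tame k -> ip (cheb_conv n.+2) k =
    2 * ip (conv g (cheb_conv n.+1)) k - e * ip (cheb_conv n) k.
  by move=> tk; rewrite cheb_convSS ipDl// !ipZl// mulNr.
rewrite lin; last exact: cheb_conv_tame.
rewrite [ip (conv g (cheb_conv n.+1)) (cheb_conv n.+2)]ipC lin//.
rewrite [ip (cheb_conv n) (cheb_conv n.+2)]ipC lin//.
rewrite (conv_sym e2 gi ge t0 t1).
rewrite [ip (cheb_conv n) (conv g (cheb_conv n.+1))]ipC.
rewrite [e * (_ - _)]mulrBr [e * (e * _)]mulrA -expr2 e2 mul1r; ring.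
Qed.

(** Write t for the iterates and C for convolution with g. Completing the square, the energy is
    |t_(n+1) - C t_n|^2 + |t_n|^2 - |C t_n|^2, hence at least 3/4 |t_n|^2 by [conv_norm]. It equals
    |g|^2 - |C g|^2, which is at most |g|^2. *)
Lemma cheb_conv_norm n : ip (cheb_conv n) (cheb_conv n) <= 2 * ip g g.
Proof.
have gi := tg.1.
have t0 := cheb_conv_tame n; have t1 := cheb_conv_tame n.+1.
have tC := conv_tame gi t0.
have E := cheb_conv_energy n.
have hC := conv_norm tg g2 t0.
have h0 := ip_ge0 (conv g g).
have hg := ip_ge0 g.
have hn := ip_ge0 (cheb_conv n).
have tm := tame_scale (-1) tC.
pose D x := cheb_conv n.+1 x + (-1) * conv g (cheb_conv n) x.
have tD : tame D := tame_add t1 tm.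
have lin k : tame k -> ip D k = ip (cheb_conv n.+1) k - ip (conv g (cheb_conv n)) k.
  by move=> tk; rewrite /D ipDl// ipZl// mulN1r.
have := ip_ge0 D; rewrite lin// [ip (cheb_conv n.+1) D]ipC lin//.
rewrite [ip (conv g (cheb_conv n)) D]ipC lin//.
rewrite [ip (cheb_conv n.+1) (conv _ _)]ipC.
move: E hC h0 hg hn; do 6!move: (ip _ _) => ?; lra.
Qed.

Lemma ftd_lin (a b : R) f h y : tame f -> tame h ->
  ftd (fun x => a * f x + b * h x) y = a%:C * ftd f y + b%:C * ftd h y.
Proof.
move=> tf th.
have -> : (fun x => a * f x + b * h x) = (fun x => a * f x - (- b) * h x).
  by apply/funext => x; rewrite mulNr opprK.
rewrite (ftdB y (tame_scale a tf).1 (tame_scale (- b) th).1) !ftdZ; [|exact: th.1|exact: tf.1].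
by rewrite rmorphN mulNr opprK.
Qed.

Lemma ftd_cheb_conv (w : R[i]) (p : T -> R) y n : w ^+ 2 = e%:C ->
  ftd g y = w * (p y)%:C ->
  ftd (cheb_conv n) y = w ^+ n.+1 * ((cheb n).[p y] * p y)%:C.
Proof.
move=> we gp; have gi := tg.1.
elim/nat_ind2: n => [||n h1 h2].
- by rewrite hornerC mul1r expr1.
- by rewrite /= ftd_conv// gp hornerX rmorphM; ring.
have tC := conv_tame gi (cheb_conv_tame n.+1).
rewrite cheb_convSS ftd_lin//; last exact: cheb_conv_tame.
rewrite ftd_conv//; last exact: cheb_conv_tame.
rewrite h1 h2 gp chebSS hornerD hornerN hornerMn hornerM hornerX.
have -> : (- e)%:C = - w ^+ 2 by rewrite we rmorphN.
rewrite -[_ *+ 2]mulr_natl !(rmorphM, rmorphB) rmorph_nat.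
rewrite !exprS; ring.
Qed.

End chebyshev_iterates.

(** The iterates bound T_n(p) p by A (n+1)^d: the support has size (n+1)L, and the square norms stay
    bounded. The recurrence T_(k+2)(p) = 2 T_(k+1)(p) p - T_k(p) then bounds T_k(p) itself by a sum
    of such terms, for one more power of k. *)
Lemma tempered_transform (g : T -> R) (e L : R) (w : R[i]) (p : T -> R) :
  tame g -> e ^+ 2 = 1 -> 0 <= L -> supported L g ->
  (forall t, g (tuple_opp t) = e * g t) -> \int[lam]_t `|g t| <= 2^-1 ->
  w ^+ 2 = e%:C -> norm1 w = 1 -> w * w^* = 1 ->
  (forall y, ftd g y = w * (p y)%:C) -> tempered (@ad_norm R d) p.
Proof.
move=> tg e2 L0 Lg ge g2 we w1 ww gp.
have HN := @ad_norm_algebra R d.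
pose A : R := 2^-1 * ((2 * L) ^+ d + 2 * ip g g).
have A0 : 0 <= A.
  by rewrite mulr_ge0 ?addr_ge0 ?exprn_ge0 ?mulr_ge0 ?ip_ge0.
have w1n n : norm1 (w^* ^+ n) <= 1.
  elim: n => [|n IH]; first by rewrite expr0 norm1_1.
  by rewrite exprS (le_trans (norm1M _ _))// norm1_conj w1 mul1r.
have unw n (c : R) : w^* ^+ n * (w ^+ n * c%:C) = c%:C.
  by rewrite mulrA -exprMn [w^* * w]mulrC ww expr1n mul1r.
(* Norm 1/2 also yields the range [-1, 1], given the factor 2 in [fan_bound]. *)
have Np : ad_norm (fun y => (p y)%:C) 2^-1.
  apply: (fan_le HN) (_ : norm1 w^* * \int[lam]_t `|g t| <= _); last first.
    by rewrite norm1_conj w1 mul1r.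
  apply: fan_eq (fan_scale HN w^* (ad_norm_density tg.1)) => y.
  by rewrite gp mulrA [w^* * w]mulrC ww mul1r.
split=> [y|].
  have := fan_bound HN Np y; rewrite norm1_real divff// => pb.
  by rewrite -ler_norml.
have NTp n : ad_norm (fun y => ((cheb n).[p y] * p y)%:C) (A * n.+1%:R ^+ d).
  have tn := cheb_conv_tame e tg n.
  apply: (fan_le HN) (_ : norm1 (w^* ^+ n.+1) * \int[lam]_t `|cheb_conv g e n t| <= _).
    apply: fan_eq (fan_scale HN (w^* ^+ n.+1) (ad_norm_density tn.1)) => y.
    by rewrite (ftd_cheb_conv tg n we (gp y)) unw.
  have I0 : 0 <= \int[lam]_t `|cheb_conv g e n t| by apply: Rintegral_ge0.
  apply: (@le_trans _ _ (\int[lam]_t `|cheb_conv g e n t|)).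
    by rewrite -[leRHS]mul1r ler_wpM2r.
  have nL : 0 <= n.+1%:R * L by rewrite mulr_ge0.
  have sn : supported (n.+1%:R * L) (cheb_conv g e n) by exact: cheb_conv_supported.
  rewrite (le_trans (norm_L1_le nL tn sn))//.
  rewrite /A -[leRHS]mulrA ler_wpM2l//.
  rewrite (mulrCA 2 n.+1%:R L) exprMn [leRHS]mulrDl.
  apply: lerD; first by rewrite mulrC.
  rewrite (le_trans (cheb_conv_norm tg e2 ge g2 n))//.
  rewrite -[leLHS]mulr1 ler_wpM2l// ?mulr_ge0 ?ip_ge0//.
  by rewrite exprn_ege1// ler1n.
exists (1 + 2 * A), d.+1 => k; elim/nat_ind2: k => [||k h1 h2].
- rewrite expr1n mulr1; apply: (fan_le HN) (_ : norm1 1 <= _).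
    by apply: fan_eq (fan_cst HN 1) => y; rewrite hornerC.
  by rewrite norm1_1 lerDl mulr_ge0.
- apply: (fan_le HN) (_ : 2^-1 <= _).
    by apply: fan_eq Np => y; rewrite hornerX.
  have : (1 : R) <= 2 ^+ d.+1 by rewrite exprn_ege1// ler1n.
  have := mulr_ge0 (ler0n R 2) A0 => h3 h4.
  rewrite (@le_trans _ _ (1 * 1))//; first by lra.
  by rewrite ler_pM//; lra.
apply: (fan_le HN) (_ : norm1 2%:C * (A * k.+2%:R ^+ d) + norm1 (- 1) * ((1 + 2 * A) * k.+1%:R ^+ d.+1) <= _).
  apply: fan_eq (fan_add HN (fan_scale HN 2%:C (NTp k.+1)) (fan_scale HN (-1) h1)) => y.
  rewrite chebSS hornerD hornerN hornerMn hornerM hornerX mulN1r.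
  rewrite -rmorphM -rmorphB; congr (_%:C); ring.
rewrite norm1_real normr_nat norm1N norm1_1 mul1r.
set q : R := k.+3%:R ^+ d.
have q0 : 0 <= q by rewrite exprn_ge0.
have q1 : k.+1%:R ^+ d <= q by rewrite lerXn2r ?nnegrE// ler_nat; lia.
have q2 : k.+2%:R ^+ d <= q by rewrite lerXn2r ?nnegrE// ler_nat; lia.
have kE : k.+3%:R = k.+1%:R + 2 :> R by rewrite -(addn2 k.+1) natrD.
rewrite !exprS -/q kE.
have h3 : 2 * (A * k.+2%:R ^+ d) <= 2 * (A * q) by rewrite !ler_wpM2l.
have A1 : 0 <= 1 + 2 * A by rewrite addr_ge0// mulr_ge0.
have h4 : (1 + 2 * A) * (k.+1%:R * k.+1%:R ^+ d) <= (1 + 2 * A) * (k.+1%:R * q).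
  by rewrite !ler_wpM2l.
have h5 := mulr_ge0 A0 q0.
rewrite (le_trans (lerD h3 h4))//.
have -> : (1 + 2 * A) * ((k.+1%:R + 2) * q) =
  2 * (A * q) + (1 + 2 * A) * (k.+1%:R * q) + 2 * q + 2 * (A * q) by ring.
rewrite -[leRHS]addrA lerDl; lra.
Qed.

Lemma angle_opp (y x : T) : angle y (tuple_opp x, 0%N) = - angle y (x, 0%N).
Proof. by rewrite /angle /= scalar_product_opp !mul0r !sub0r mulrN. Qed.

Lemma odd_Rintegral f : lam.-integrable setT (EFin \o f) ->
  (forall x, f (tuple_opp x) = - f x) -> \int[lam]_x f x = 0.
Proof.
move=> fi fN; have := Rintegral_opp (integrable_measurable fi).
have -> : \int[lam]_x f (tuple_opp x) = \int[lam]_x ((-1) * f x).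
  by apply: eq_Rintegral => x _; rewrite fN mulN1r.
by rewrite RintegralZl// => h; lra.
Qed.

(** An even density has a real transform and an odd one a purely imaginary transform: w is 1 or i,
    with w^2 = e in both cases. *)
Lemma tempered_density (g : T -> R) (e L : R) : tame g -> e = 1 \/ e = -1 -> 0 <= L ->
  supported L g -> (forall t, g (tuple_opp t) = e * g t) ->
  \int[lam]_t `|g t| <= 2^-1 ->
  exists (w : R[i]) (p : T -> R), tempered (@ad_norm R d) p /\
    forall y, ftd g y = w * (p y)%:C.
Proof.
move=> tg e1 L0 Lg ge g2; have [gi _] := tg; case: e1 => eE; subst e.
- have gp y : ftd g y = 1 * (complex.Re (ftd g y))%:C.
    rewrite mul1r [LHS]/ftd; congr (_ +i* _); apply: odd_Rintegral => [|x].
      exact: integrable_sin.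
    by rewrite ge angle_opp sinN mul1r mulrN.
  exists 1, (fun y => complex.Re (ftd g y)); split=> //.
  by apply: (tempered_transform tg _ L0 Lg ge g2 _ _ _ gp);
    rewrite ?expr1n ?norm1_1 ?rmorph1 ?mulr1.
- have gp y : ftd g y = 'i * (complex.Im (ftd g y))%:C.
    apply/eqP; rewrite eq_complex/= ?(mul0r,mul1r,mulr0,subr0,sub0r,add0r,addr0,oppr0) eqxx andbT.
    apply/eqP/odd_Rintegral => [|x]; first exact: integrable_cos.
    by rewrite ge angle_opp cosN mulN1r mulNr.
  exists 'i, (fun y => complex.Im (ftd g y)); split=> //.
  apply: (tempered_transform tg _ L0 Lg ge g2 _ _ _ gp).
  + by rewrite sqrrN expr1n.
  + by rewrite sqr_i rmorphN rmorph1.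
  + by rewrite /norm1/= normr0 normr1 add0r.
  + by apply/eqP; rewrite eq_complex/= ?(mul0r,mul1r,mulr0,subr0,sub0r,add0r,addr0,opprK) !eqxx.
Qed.

Lemma localizable_parity (g : T -> R) (e L : R) : tame g -> e = 1 \/ e = -1 -> 0 <= L ->
  supported L g -> (forall t, g (tuple_opp t) = e * g t) ->
  localizable (@ad_norm R d) (ftd g).
Proof.
move=> tg e1 L0 Lg ge; have gi := tg.1.
have I0 : 0 <= \int[lam]_t `|g t| by apply: Rintegral_ge0.
(* This makes the L^1 norm of c g at most 1/2, with c finite even for g = 0; multiplication by the
   inverse of c preserves localizability. *)
pose c := (2 * (\int[lam]_t `|g t| + 1))^-1.
have c0 : 0 < c by rewrite invr_gt0 mulr_gt0// ltr_wpDl.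
have [w [p [tp gp]]] : exists (w : R[i]) (p : T -> R), tempered (@ad_norm R d) p /\
    forall y, ftd (fun x => c * g x) y = w * (p y)%:C.
  apply: (@tempered_density _ e L) => //; first exact: tame_scale.
  - by move=> x cg; apply: Lg; apply: contraNneq cg => ->; rewrite mulr0.
  - by move=> t; rewrite ge mulrCA.
  have -> : \int[lam]_t `|c * g t| = c * \int[lam]_t `|g t|.
    rewrite -RintegralZl//; last exact: integrable_norm.
    by apply: eq_Rintegral => t _; rewrite normrM gtr0_norm.
  rewrite /c invfM -mulrA -[leRHS]mulr1 ler_wpM2l// mulrC ler_pdivrMr ?ltr_wpDl//.
  by rewrite mul1r lerDl.
have -> : ftd g = fun y => (c^-1%:C * w) * (p y)%:C.
  apply/funext => y; rewrite -mulrA -gp ftdZ// mulrA -rmorphM mulVf ?gt_eqF//.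
  by rewrite mul1r.
have HN := @ad_norm_algebra R d.
by apply: (localizable_scale HN); exact: tempered_localizable.
Qed.

Lemma localizable_tame (g : T -> R) (L : R) : tame g -> 0 <= L -> supported L g ->
  localizable (@ad_norm R d) (ftd g).
Proof.
move=> tg L0 Lg; have tg' := tame_opp tg.
have Lg' : supported L (fun x => g (tuple_opp x)).
  by move=> x gx i; have := Lg _ gx i; rewrite tnth_opp normrN.
pose ge (e : R) x := 2^-1 * g x + 2^-1 * e * g (tuple_opp x).
have tge e : tame (ge e) by apply: tame_add; exact: tame_scale.
have lge e : e = 1 \/ e = -1 -> localizable (@ad_norm R d) (ftd (ge e)).
  move=> e1; apply: (localizable_parity (tge e) e1 L0); first exact: supported_lin.
  by move=> t; rewrite /ge tuple_oppK; case: e1 => ->; ring.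
have -> : ftd g = fun y => ftd (ge 1) y + ftd (ge (-1)) y.
  apply/funext => y; rewrite -[RHS]mul1r mulrDr -[1]/(1%:C) -ftd_lin//.
  by congr ftd; apply/funext => x; rewrite /ge; field.
by apply: (localizable_add (@ad_norm_algebra R d)); apply: lge; [left|right].
Qed.

(** Restricting f to the points of a box where |f| <= n gives tame functions of bounded support;
    they converge to f in L^1 by dominated convergence, hence their transforms converge in norm. *)
Lemma localizable_density f : lam.-integrable setT (EFin \o f) ->
  localizable (@ad_norm R d) (ftd f).
Proof.
move=> fi; have HN := @ad_norm_algebra R d; have mf := integrable_measurable fi.
pose E n : set T := box n%:R `&` [set x | `|f x| <= n%:R].
have mE n : measurable (E n).
  apply: measurableI; first exact: measurable_box.
  have mnf : measurable_fun setT (fun x => `|f x|) by exact: measurableT_comp.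
  rewrite -[X in measurable X]setTI (_ : mkset _ = (fun x => `|f x|) @^-1` `]-oo, n%:R]).
    by apply: mnf => //; exact: measurable_itv.
  by apply/seteqP; split=> x /=; rewrite in_itv.
pose fn n x := f x * \1_(E n) x.
have fn_le n x : `|fn n x| <= `|f x|.
  by rewrite /fn indicE; case: (_ \in _); rewrite ?mulr1// mulr0 normr0.
have tfn n : tame (fn n).
  split.
    apply: (integrable_bounded_mul fi (C := 1)) => [|x]; first exact: measurable_indic.
    by rewrite indicE; case: (_ \in _); rewrite ?normr1 ?normr0.
  exists n%:R => x; rewrite /fn indicE; have [|_] := boolP (x \in E n).
    by rewrite inE => -[_ /= h]; rewrite mulr1.
  by rewrite mulr0 normr0.
have sfn n : supported n%:R (fn n).
  move=> x; rewrite /fn indicE; have [|_] := boolP (x \in E n).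
    by rewrite inE => -[/mem_box h _ _]; exact: h.
  by rewrite mulr0 eqxx.
have fncvg : \forall x \ae lam, setT x ->
    (EFin \o fn n) x @[n --> \oo] --> (EFin \o f) x.
  apply/aeW => x _ /=; apply: cvg_near_cst; near=> n; congr EFin.
  rewrite /fn indicE mem_set ?mulr1//; split; last by near: n; exact: nbhs_infty_ger.
  apply/mem_box => i; apply: (@le_trans _ _ (\sum_(j < d) `|tnth x j|)).
    by rewrite (bigD1 i)//= lerDl sumr_ge0.
  by near: n; exact: nbhs_infty_ger.
have fndom : \forall x \ae lam, forall n, setT x ->
    (`|(EFin \o fn n) x| <= `|(f x)%:E|)%E.
  by apply/aeW => x n _; rewrite lee_fin.
have [_ + _] := dominated_convergence measurableT (fun n => measurable_int _ (tfn n).1)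
  (measurable_int _ fi) fncvg (integrable_abse fi) fndom.
move=> /fine_cvgP[_ /cvgrPdist_lt lim0].
apply: (localizable_lim HN) => e e0.
have [n _ /(_ n (leqnn n))] := lim0 _ e0.
rewrite /= sub0r normrN => hn; exists (ftd (fn n)).
  exact: localizable_tame (tfn n) (ler0n _ _) (sfn n).
have di : lam.-integrable setT (EFin \o (fun x => f x - fn n x)).
  rewrite (_ : _ \o _ = (fun x => (f x)%:E - (fn n x)%:E)%E); last by apply/funext => x.
  by apply: integrableB => //; exact: (tfn n).1.
apply: (fan_le HN) (_ : \int[lam]_x `|f x - fn n x| <= _).
  by apply: fan_eq (ad_norm_density di) => y; rewrite ftdB//; exact: (tfn n).1.
apply: le_trans (ltW (le_lt_trans (ler_norm _) hn)).
rewrite le_eqVlt; apply/orP; left; apply/eqP; congr fine.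
by apply: eq_integral => x _; rewrite /= distrC.
Unshelve. all: by end_near. Qed.

End localizable_density.

(** * Charges and positive measures *)

Section charge_integrals.
Context {R : realType} {disp : measure_display} {T : measurableType disp}.

(** The integral is defined by a Jordan decomposition P - Q. If also nu = M - N, then P + N and Q +
    M are the same positive measure, so that any such representation may replace the Jordan
    decomposition. *)
Lemma charge_integral_diff (nu : {charge set T -> \bar R})
    (M N : {measure set T -> \bar R}) (phi : T -> R[i]) (C : R) :
  (M setT < +oo)%E -> (N setT < +oo)%E ->
  (forall A, measurable A -> fine (nu A) = fine (M A) - fine (N A)) ->
  measurable_fun setT (fun x => complex.Re (phi x)) ->
  measurable_fun setT (fun x => complex.Im (phi x)) ->
  (forall x, `|complex.Re (phi x)| <= C) -> (forall x, `|complex.Im (phi x)| <= C) ->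
  charge_integral nu phi = complex_integral M setT phi - complex_integral N setT phi.
Proof.
move=> Moo Noo nuMN mRe mIm bRe bIm.
pose P : {measure set T -> \bar R} := jordan_pos (hahn_posneg nu).
pose Q : {measure set T -> \bar R} := jordan_neg (hahn_posneg nu).
have Poo : (P setT < +oo)%E by rewrite ltey_eq fin_num_measure.
have Qoo : (Q setT < +oo)%E by rewrite ltey_eq fin_num_measure.
have fin_num_of (m : {measure set T -> \bar R}) A : (m setT < +oo)%E -> measurable A ->
    m A \is a fin_num.
  move=> moo mA; rewrite ge0_fin_numE// (le_lt_trans _ moo)//.
  by apply: le_measure; rewrite ?inE.
have key A : measurable A -> measure_add P N A = measure_add Q M A.
  move=> mA; rewrite !measure_addE.
  have jd : nu A = (P A + (-1)%:E * Q A)%E := jordan_decomp (hahn_posneg nu) mA.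
  have := nuMN A mA; rewrite jd.
  rewrite -(fineK (fin_num_of P A Poo mA)) -(fineK (fin_num_of Q A Qoo mA)).
  rewrite -(fineK (fin_num_of M A Moo mA)) -(fineK (fin_num_of N A Noo mA)) /=.
  by move=> h; congr EFin; lra.
have E (f : T -> R) : measurable_fun setT f -> (forall x, `|f x| <= C) ->
    \int[P]_x f x - \int[Q]_x f x = \int[M]_x f x - \int[N]_x f x.
  move=> mf fC.
  have := Rintegral_measure_add Poo Noo mf fC.
  have -> : \int[measure_add P N]_x f x = \int[measure_add Q M]_x f x.
    by congr fine; apply: eq_measure_integral => A mA _; exact: key.
  rewrite (Rintegral_measure_add Qoo Moo mf fC); lra.
rewrite /charge_integral /complex_integral.
apply/eqP; rewrite eq_complex/=; apply/andP; split; apply/eqP.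
  exact: (E _ mRe bRe).
exact: (E _ mIm bIm).
Qed.

Lemma rn_finite (lam : {sigma_finite_measure set T -> \bar R})
    (M : {measure set T -> \bar R}) : (M setT < +oo)%E -> M `<< lam ->
  exists2 f : T -> R, lam.-integrable setT (EFin \o f) &
    forall A, measurable A -> fine (M A) = \int[lam]_(x in A) f x.
Proof.
move=> Moo Ml; pose nu := charge_of_finite_measure (finite_copy Moo).
have nul : nu `<< lam by [].
have fi := Radon_Nikodym_integrable nul.
exists (fun x => fine (Radon_Nikodym nu lam x)).
  apply: eq_integrable (fi) => // x _ /=; rewrite fineK//.
  exact: Radon_Nikodym_fin_num.
move=> A mA.
have -> : M A = (\int[lam]_(x in A) Radon_Nikodym nu lam x)%E := Radon_Nikodym_integral nul mA.
congr fine; apply: eq_integral => x _; rewrite fineK//.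
exact: Radon_Nikodym_fin_num.
Qed.

End charge_integrals.

(** * Localizability for measures without singular continuous part *)

Section transforms_of_measures.
Context {R : realType} {d : nat}.
Local Notation T := (d.-tuple R).
Local Notation lam := (lebesgue_tuple d).

Definition transform (M : {measure set T -> \bar R}) (y : T) : R[i] :=
  complex_integral M setT (fun x => wave y (x, 0%N)).

Lemma fine_mseries_dirac (c : nat -> {nonneg R}) (g : nat -> T) A l : measurable A ->
  (\sum_(j < n) (c j)%:num * \1_A (g j)) @[n --> \oo] --> (l : R) ->
  mseries (fun n => mscale (c n) (dirac (g n))) 0 A = l%:E.
Proof.
move=> mA cl; apply: cvg_lim => //.
rewrite (_ : (fun n => _) = EFin \o (fun n => \sum_(j < n) (c j)%:num * \1_A (g j))).
  by apply: cvg_EFin => //; near=> n.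
apply/funext => n /=; rewrite big_mkord -sumEFin; apply: eq_bigr => j _.
by rewrite /mscale /= diracE indicE EFinM.
Unshelve. all: by end_near. Qed.

(** The transform is that of a density plus a norm-convergent series of multiples of characters, and
    both are localizable. *)
Lemma ad_measure (f : T -> R) (c : nat -> R) (g : nat -> T) (s : R) :
  lam.-integrable setT (EFin \o f) -> (forall x, 0 <= f x) ->
  (forall n, 0 <= c n) -> (forall n, \sum_(j < n) c j <= s) ->
  exists M : {measure set T -> \bar R}, [/\ (M setT < +oo)%E,
    localizable (@ad_norm R d) (transform M) &
    forall A l, measurable A ->
      (\sum_(j < n) c j * \1_A (g j)) @[n --> \oo] --> (l : R) ->
      fine (M A) = \int[lam]_(x in A) f x + l].
Proof.
move=> fi f0 c0 cs; have mf := integrable_measurable fi.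
pose cn n : {nonneg R} := NngNum (c0 n).
pose m n : {measure set T -> \bar R} := mscale (cn n) (dirac (g n)).
pose D : {measure set T -> \bar R} := density_measure lam mf.
pose S : {measure set T -> \bar R} := mseries m 0.
have HN := @ad_norm_algebra R d.
have Doo : (D setT < +oo)%E := density_finite mf fi.
have mT n : m n setT = (c n)%:E by rewrite /m /= /mscale /= diracT mule1.
have moo n : (m n setT < +oo)%E by rewrite mT ltry.
have ms n : \sum_(j < n) fine (m j setT) <= s.
  by under eq_bigr do rewrite mT/=.
have SA A l : measurable A -> (\sum_(j < n) c j * \1_A (g j)) @[n --> \oo] --> (l : R) ->
    S A = l%:E.
  by move=> mA; exact: (@fine_mseries_dirac cn g A l mA).
have Scvg A : measurable A -> cvgn (fun n => \sum_(j < n) c j * \1_A (g j)).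
  move=> mA; rewrite (_ : (fun n => _) = series (fun j => c j * \1_A (g j))); last first.
    by apply/funext => n; rewrite /series/= big_mkord.
  apply: nondecreasing_is_cvgn.
    by apply: nondecreasing_series => n _ _; rewrite mulr_ge0// indicE.
  exists s => _ [n _ <-]; rewrite /series/= big_mkord (le_trans _ (cs n))//.
  by apply: ler_sum => j _; rewrite ler_piMr// indicE; case: (_ \in _).
have Soo : (S setT < +oo)%E.
  by rewrite (SA setT _ measurableT (Scvg _ measurableT)) ltry.
exists (measure_add D S); split.
- apply: (@le_lt_trans _ _ (D setT + S setT)%E); last by rewrite lte_add_pinfty.
  by rewrite -measure_addE; exact: lexx.
- have -> : transform (measure_add D S) = fun y => ftd f y + transform S y.
    apply/funext => y; rewrite /transform /complex_integral /ftd /=.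
    rewrite (Rintegral_measure_add Doo Soo (measurable_cos_phase0 y) (fun w => cos_max _)).
    rewrite (Rintegral_measure_add Doo Soo (measurable_sin_phase0 y) (fun w => sin_max _)).
    rewrite /D (Rintegral_density mf fi (measurable_cos_phase0 y) (fun w => cos_max _)).
    rewrite (Rintegral_density mf fi (measurable_sin_phase0 y) (fun w => sin_max _)).
    by apply/eqP; rewrite eq_complex/=; apply/andP; split; apply/eqP; congr (_ + _);
      apply: eq_Rintegral => x _; rewrite ger0_norm// mulrC.
  apply: (localizable_add HN); first exact: localizable_density.
  apply: (@localizable_series _ _ _ HN (fun j y => (c j)%:C * wave y (g j, 0%N)) c _ s) => //.
  + by move=> j; exact: localizable_wave.
  + move=> j; have := ad_norm_wave (g j) (c j)%:C.
    by rewrite norm1_real ger0_norm.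
  + move=> y; apply/series_to_cvg; split.
      rewrite (_ : (fun n => _) = fun n => \sum_(j < n) \int[m j]_w cos (angle y (w, 0%N))).
        exact: (Rintegral_series moo ms (measurable_cos_phase0 y) (fun w => cos_max _)).
      apply/funext => n; apply: eq_bigr => j _.
      rewrite (Rintegral_mscale_dirac (cn j) _ (measurable_cos_phase0 y) (fun w => cos_max _)).
      by rewrite /= mul0r subr0.
    rewrite (_ : (fun n => _) = fun n => \sum_(j < n) \int[m j]_w sin (angle y (w, 0%N))).
      exact: (Rintegral_series moo ms (measurable_sin_phase0 y) (fun w => sin_max _)).
    apply/funext => n; apply: eq_bigr => j _.
    rewrite (Rintegral_mscale_dirac (cn j) _ (measurable_sin_phase0 y) (fun w => sin_max _)).
    by rewrite /= mul0r addr0.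
- move=> A l mA Al; transitivity (fine (D A + S A)%E); first by rewrite -measure_addE.
  rewrite (SA A l mA Al) fineD//.
    congr (_ + _); congr fine; apply: eq_integral => x _; by rewrite ger0_norm.
  rewrite ge0_fin_numE// (le_lt_trans _ Doo)//.
  by apply: le_measure; rewrite ?inE.
Qed.

End transforms_of_measures.

Section complex_series.
Context {R : realType}.
Implicit Types (F : nat -> R[i]) (c : nat -> R) (s : R).

Lemma series_to_lim F (l : R[i]) : series_to F l -> series F @ \oo --> (l : R[i]^o).
Proof.
move=> Fl; apply/(@cvgrPdist_lt _ R[i]^o) => e e0.
have eE : e = (complex.Re e)%:C.
  by apply/eqP; rewrite eq_complex/= eqxx/=; move: e0; rewrite ltcE/= => /andP[/eqP -> _].
have e0' : 0 < complex.Re e by rewrite -ltcR -eE.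
have [n0 hn0] := Fl _ (divr_gt0 e0' (ltr0n R 2)).
near=> n; rewrite eE distrC modulusE ltcR.
apply: le_lt_trans (modulus_le_norm1 _) _.
rewrite /series/= big_mkord (le_lt_trans (hn0 n _))//; first by near: n; exact: nbhs_infty_ge.
by rewrite ltr_pdivrMr// ltr_pMr// ltr1n.
Unshelve. all: by end_near. Qed.

Lemma summable_indic c s (b : nat -> bool) : (forall n, \sum_(j < n) `|c j| <= s) ->
  cvgn (fun n => \sum_(j < n) c j * (b j)%:R).
Proof.
move=> cs; rewrite (_ : (fun n => _) = series (fun j => c j * (b j)%:R)); last first.
  by apply/funext => n; rewrite /series/= big_mkord.
apply: normed_cvg; apply: nondecreasing_is_cvgn.
  by apply: nondecreasing_series => n _ _; exact: normr_ge0.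
exists s => _ [n _ <-]; rewrite /normed_series_of /series/= big_mkord (le_trans _ (cs n))//.
by apply: ler_sum => j _; rewrite normrM; case: (b j); rewrite ?normr1 ?mulr1// normr0 mulr0.
Qed.

Lemma normed_series_bounded (a : (R[i]^o)^nat) : cvgn [normed series a] ->
  exists s : R, forall n, \sum_(j < n) norm1 (a j) <= s.
Proof.
move=> /cvg_ex[L /(@cvgrPdist_lt _ R[i]^o)/(_ 1 ltr01)[n0 _ hn0]].
pose S n : R := \sum_(j < n) modulus (a j).
have SE n : [normed series a] n = (S n)%:C.
  rewrite /normed_series_of /series/= big_mkord /S rmorph_sum.
  by apply: eq_bigr => j _; rewrite modulusE.
have Smono n m : S n <= S (n + m)%N.
  elim: m => [|m IH]; first by rewrite addn0.
  by rewrite addnS /S big_ord_recr/= (le_trans IH)// lerDl modulus_ge0.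
have Sle n : S n <= complex.Re L + 1.
  apply: le_trans (Smono n n0) _.
  have h : `|(L : R[i]) - (S (n + n0)%N)%:C| < 1.
    by rewrite -SE; exact: (hn0 _ (leq_addl n n0)).
  have : norm1 (complex.Re (L - (S (n + n0)%N)%:C))%:C <= 1.
    rewrite norm1_real -lecR; apply: le_trans (ltW h).
    exact: normc_ge_Re.
  rewrite norm1_real; case: (L) => p q /=; rewrite ler_norml => /andP[]; lra.
exists (2 * (complex.Re L + 1)) => n.
apply: le_trans (_ : 2 * S n <= _); last by rewrite ler_wpM2l.
by rewrite /S mulr_sumr; apply: ler_sum => j _; exact: norm1_le_modulus.
Qed.

End complex_series.

Section localizable_fourier.
Context {R : realType} {d : nat}.
Local Notation T := (d.-tuple R).
Local Notation lam := (lebesgue_tuple d).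

(** Density and coefficients are split into positive and negative parts, [part 1] and [part (-1)].
    Since points may repeat, the two measures need not be mutually singular; [charge_integral_diff]
    does not ask for it. *)
Lemma localizable_real_charge (nu : {charge set T -> \bar R}) (f : T -> R)
    (c : nat -> R) (g : nat -> T) (s : R) :
  lam.-integrable setT (EFin \o f) -> (forall n, \sum_(j < n) `|c j| <= s) ->
  (forall A l, measurable A ->
    (\sum_(j < n) c j * \1_A (g j)) @[n --> \oo] --> (l : R) ->
    fine (nu A) = \int[lam]_(x in A) f x + l) ->
  localizable (@ad_norm R d) (fun y => charge_integral nu (fun x => wave y (x, 0%N))).
Proof.
move=> fi cs nuA; have HN := @ad_norm_algebra R d.
have ai : lam.-integrable setT (EFin \o (fun x => `|f x|)) by exact: integrable_norm.
pose part (e : R) x := 2^-1 * (`|x| + e * x).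
have part0 e x : e = 1 \/ e = -1 -> 0 <= part e x.
  rewrite /part; case=> ->; have := ler_norm x; have := ler_norm (- x); rewrite normrN; lra.
have part_le e x : e = 1 \/ e = -1 -> part e x <= `|x|.
  rewrite /part; case=> ->; have := ler_norm x; have := ler_norm (- x); rewrite normrN; lra.
have parti e : lam.-integrable setT (EFin \o (fun x => part e (f x))).
  rewrite (_ : _ \o _ = (fun x => 2^-1%:E * ((`|f x|)%:E + e%:E * (f x)%:E))%E).
    by apply: integrableZl => //; apply: integrableD => //; exact: integrableZl.
  by apply/funext => x; rewrite /part /= EFinM EFinD EFinM.
have parts e n : e = 1 \/ e = -1 -> \sum_(j < n) part e (c j) <= s.
  by move=> he; rewrite (le_trans _ (cs n))//; apply: ler_sum => j _; exact: part_le.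
have h1 : 1 = 1 :> R \/ 1 = -1 :> R by left.
have h2 : -1 = 1 :> R \/ -1 = -1 :> R by right.
have [M [Moo Ml MA]] := ad_measure g (parti 1) (fun x => part0 1 (f x) h1)
  (fun n => part0 1 (c n) h1) (fun n => parts 1 n h1).
have [N [Noo Nl NA]] := ad_measure g (parti (-1)) (fun x => part0 (-1) (f x) h2)
  (fun n => part0 (-1) (c n) h2) (fun n => parts (-1) n h2).
have nuMN A : measurable A -> fine (nu A) = fine (M A) - fine (N A).
  move=> mA.
  have cvg e : e = 1 \/ e = -1 -> cvgn (fun n => \sum_(j < n) part e (c j) * \1_A (g j)).
    move=> he; apply: (@summable_indic R (fun j => part e (c j)) s (fun j => g j \in A)) => n.
    rewrite (le_trans _ (parts e n he))//; apply: ler_sum => j _.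
    by rewrite ger0_norm// part0.
  rewrite (MA A _ mA (cvg 1 h1)) (NA A _ mA (cvg (-1) h2)).
  rewrite (nuA A _ mA (_ : _ --> limn (fun n => \sum_(j < n) part 1 (c j) * \1_A (g j)) -
     limn (fun n => \sum_(j < n) part (-1) (c j) * \1_A (g j)))); last first.
    rewrite (_ : (fun n => _) = (fun n => \sum_(j < n) part 1 (c j) * \1_A (g j)) -
        (fun n => \sum_(j < n) part (-1) (c j) * \1_A (g j))).
      exact: cvgB (cvg 1 h1) (cvg (-1) h2).
    apply/funext => n; rewrite -[RHS]sumrB; apply: eq_bigr => j _.
    by rewrite /part; field.
  have -> : \int[lam]_(x in A) f x =
      \int[lam]_(x in A) part 1 (f x) - \int[lam]_(x in A) part (-1) (f x).
    rewrite -RintegralB//; first by apply: eq_Rintegral => x _; rewrite /part; field.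
      exact: integrableS (parti 1).
    exact: integrableS (parti (-1)).
  by ring.
have E : (fun y => charge_integral nu (fun x => wave y (x, 0%N))) =
    fun y => transform M y + (-1) * transform N y.
  apply/funext => y; rewrite mulN1r.
  exact: (charge_integral_diff (phi := fun x => wave y (x, 0%N)) Moo Noo nuMN
    (measurable_cos_phase0 y) (measurable_sin_phase0 y)
    (fun x => cos_max _) (fun x => sin_max _)).
by rewrite E; apply: (localizable_add HN) => //; exact: localizable_scale.
Qed.

Lemma fourierE (mu : {charge set T -> \bar R[i]}) y : fourier mu y =
  charge_integral (re_charge mu) (fun x => wave y (x, 0%N)) +
  'i * charge_integral (im_charge mu) (fun x => wave y (x, 0%N)).
Proof.
rewrite /fourier /complex_charge_integral.
suff -> : (fun x : T => let t := - (2 * pi * scalar_product x y) in cos t +i* sin t) =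
  (fun x => wave y (x, 0%N)) by [].
by apply/funext => x; rewrite /wave /angle /= mul0r sub0r.
Qed.

Lemma localizable_fourier (mu : {charge set T -> \bar R[i]}) : Mad mu ->
  localizable (@ad_norm R d) (fourier mu).
Proof.
move=> [f [a [g [[fRe fIm] /normed_series_bounded[s as_] muA]]]].
have HN := @ad_norm_algebra R d.
have SA (A : set T) : exists L : R[i],
    limn (series (fun n => a n * (\1_A (g n))%:C : R[i]^o)) = L /\
    series_to (fun n => a n * (\1_A (g n))%:C) L.
  have [j|L hL] := @series_to_dominated R
    (fun n => (a n : R[i]) * (\1_A (g n))%:C) (fun n => norm1 (a n)) s _ as_.
    rewrite indicE; case: (_ \in _); rewrite ?mulr1//.
    by rewrite mulr0 norm1_0 norm1_ge0.
  exists L; split=> //; exact/cvg_lim/series_to_lim.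
have -> : fourier mu = fun y =>
    charge_integral (re_charge mu) (fun x => wave y (x, 0%N)) +
    'i * charge_integral (im_charge mu) (fun x => wave y (x, 0%N)).
  by apply/funext => y; exact: fourierE.
apply: (localizable_add HN); last apply: (localizable_scale HN).
  apply: (@localizable_real_charge _ _ (fun n => complex.Re (a n)) g s fRe) => [n|A l mA Al].
    rewrite (le_trans _ (as_ n))//; apply: ler_sum => j _; by rewrite lerDl.
  rewrite /= /re_charge muA//=; have [[p q] [-> /series_to_cvg[/= hL _]]] := SA A.
  rewrite /complex_integral /=.
  congr (_ + _); apply/esym; apply: (cvg_unique _ Al) => //.
  rewrite (_ : (fun n => _) = fun n => \sum_(j < n) complex.Re (a j * (\1_A (g j))%:C))//.
  apply/funext => n; apply: eq_bigr => j _.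
  by case: (a j) => ? ? /=; rewrite mulr0 subr0.
apply: (@localizable_real_charge _ _ (fun n => complex.Im (a n)) g s fIm) => [n|A l mA Al].
  rewrite (le_trans _ (as_ n))//; apply: ler_sum => j _; by rewrite lerDr.
rewrite /= /im_charge muA//=; have [[p q] [-> /series_to_cvg[_ /= hL]]] := SA A.
rewrite /complex_integral /=.
congr (_ + _); apply/esym; apply: (cvg_unique _ Al) => //.
rewrite (_ : (fun n => _) = fun n => \sum_(j < n) complex.Im (a j * (\1_A (g j))%:C))//.
apply/funext => n; apply: eq_bigr => j _.
by case: (a j) => ? ? /=; rewrite mulr0 add0r.
Qed.

End localizable_fourier.

(** * Complex measures assembled from four positive measures *)

Section complex_charge_of_measures.
Context {R : realType} {disp : measure_display} {T : measurableType disp}.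

Lemma fine_sigma_additive (M : {finite_measure set T -> \bar R}) (F : nat -> set T) :
  (forall n, measurable (F n)) -> trivIset setT F ->
  (\sum_(j < n) fine (M (F j))) @[n --> \oo] --> fine (M (\bigcup_n F n)).
Proof.
move=> mF tF; have mU : measurable (\bigcup_n F n) by exact: bigcup_measurable.
have /fine_cvgP[_] : (\sum_(0 <= i < n) M (F i))%E @[n --> \oo] -->
    (fine (M (\bigcup_n F n)))%:E.
  by rewrite fineK ?fin_num_measure//; exact: measure_semi_sigma_additive.
apply: cvg_trans; apply: near_eq_cvg; near=> n.
by rewrite /= big_mkord -sum_fine// => j _; exact: fin_num_measure.
Unshelve. all: by end_near. Qed.

Variable P : nat -> {finite_measure set T -> \bar R}.

(** The sum over k < 4 of i^k times [P k]. *)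
Definition complex_charge_fun (A : set T) : \bar R[i] :=
  ((fine (P 0%N A) - fine (P 2%N A)) +i* (fine (P 1%N A) - fine (P 3%N A)))%:E.

Let complex_charge_fun_finite A : measurable A -> complex_charge_fun A \is a fin_num.
Proof. by []. Qed.

Let complex_charge_fun_sigma_additive : semi_sigma_additive complex_charge_fun.
Proof.
move=> F mF tF mU; apply/fine_cvgP; split.
  by near=> n; apply/sum_fin_numP => j _ _.
have h : series_to (fun j => fine (complex_charge_fun (F j)))
    (fine (complex_charge_fun (\bigcup_n F n))).
  have hF k := fine_sigma_additive (M := P k) mF tF.
  apply/series_to_cvg; split; rewrite /=.
    rewrite (_ : (fun n => _) = (fun n => \sum_(j < n) fine (P 0%N (F j))) -
        (fun n => \sum_(j < n) fine (P 2%N (F j)))); first exact: cvgB.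
    by apply/funext => n; rewrite -[RHS]sumrB.
  rewrite (_ : (fun n => _) = (fun n => \sum_(j < n) fine (P 1%N (F j))) -
      (fun n => \sum_(j < n) fine (P 3%N (F j)))); first exact: cvgB.
  by apply/funext => n; rewrite -[RHS]sumrB.
have := series_to_lim h; apply: cvg_trans; apply: near_eq_cvg; near=> n.
by rewrite /= -sum_fine.
Unshelve. all: by end_near. Qed.

Let complex_charge_fun_additive : measure_function.semi_additive complex_charge_fun.
Proof.
move=> F n mF tF mU.
have fineP k : fine (P k (\big[setU/set0]_(i < n) F i)) = \sum_(i < n) fine (P k (F i)).
  by rewrite measure_semi_additive// sum_fine// => i _; exact: fin_num_measure.
rewrite /complex_charge_fun !fineP sumEFin; congr EFin.
by elim: n {mU fineP} => [|n IH]; rewrite ?big_ord0 ?subrr// !big_ord_recr/= -IH; apply/eqP;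
  rewrite eq_complex/=; apply/andP; split; apply/eqP; ring.
Qed.

HB.instance Definition _ := isFinite.Build _ _ _ complex_charge_fun
  complex_charge_fun_finite.
HB.instance Definition _ := isAdditiveCharge.Build _ _ _ complex_charge_fun
  complex_charge_fun_additive.
HB.instance Definition _ := isSemiSigmaAdditive.Build _ _ _ complex_charge_fun
  complex_charge_fun_sigma_additive.

Definition complex_charge : {charge set T -> \bar R[i]} := complex_charge_fun.

End complex_charge_of_measures.

(** * Splitting off the atoms *)

Section ad_decomposition.
Context {R : realType} {d : nat}.
Local Notation T := (d.-tuple R).
Local Notation lam := (lebesgue_tuple d).

Lemma measurable_tuple1 (x : T) : measurable [set x].
Proof.
rewrite (_ : [set x] = \bigcap_(i in [set: 'I_d]) ((@tnth _ R)^~ i @^-1` [set tnth x i])).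
  apply: fin_bigcap_measurable => [|i _]; first exact: finite_finset.
  by rewrite -[X in measurable X]setTI; exact: measurable_tnth.
apply/seteqP; split => [t -> i _ //|t /= tx].
by apply: eq_from_tnth => i; exact: tx.
Qed.

(** The singleton of [u n] if this point has not occurred before, and empty otherwise; repeated
    points are thus counted once. *)
Definition atom (u : nat -> T) (n : nat) : set T := seqDU (fun k => [set u k]) n.

Lemma measurable_atom u n : measurable (atom u n).
Proof. by apply: seqDU_measurable => k; exact: measurable_tuple1. Qed.

Lemma atoms_cover u : \bigcup_n atom u n = range u.
Proof.
rewrite -seqDU_bigcup_eq; apply/seteqP; split => [x [n _ ->]|x [n _ <-]]; by exists n.
Qed.

(** The hypothesis says exactly that the restriction of P to the complement of the range of u is
    absolutely continuous, so it has a density; on the range, a countable set, P is the sum of its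
    masses. *)
Lemma ad_decomposition (P : {finite_measure set T -> \bar R}) (u : nat -> T) :
  (forall A, measurable A -> lam A = 0%E -> (forall i, ~ A (u i)) -> P A = 0%E) ->
  exists2 f : T -> R, lam.-integrable setT (EFin \o f) &
    forall A, measurable A -> exists l, fine (P A) = \int[lam]_(x in A) f x + l /\
      (\sum_(j < n) fine (P (atom u j)) * \1_A (u j)) @[n --> \oo] --> l.
Proof.
move=> Pu.
have mU : measurable (range u).
  by rewrite -atoms_cover; apply: bigcup_measurable => n _; exact: measurable_atom.
have mCU := measurableC mU.
pose P' : {measure set T -> \bar R} := mrestr P mCU.
have P'oo : (P' setT < +oo)%E.
  by rewrite /P' /= /mrestr setTI ltey_eq fin_num_measure.
have P'l : P' `<< lam.
  apply/null_content_dominatesP => A mA A0; apply: Pu; first exact: measurableI.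
    by apply: (subset_measure0 _ _ _ A0) => //; exact: measurableI.
  by move=> i [_]; apply; exists i.
have [f fi fP] := rn_finite P'oo P'l; exists f => // A mA.
exists (fine (P (A `&` range u))); split.
  rewrite -fP// (measureDI P mA mU) setDE fineD ?fin_num_measure//; exact: measurableI.
have := fine_sigma_additive (M := P) (F := fun n => A `&` atom u n).
rewrite -setI_bigcupr atoms_cover => h.
have -> : (fun n => \sum_(j < n) fine (P (atom u j)) * \1_A (u j)) =
    (fun n => \sum_(j < n) fine (P (A `&` atom u j))).
  apply/funext => n; apply: eq_bigr => j _; rewrite indicE.
  have [uA|uA] := boolP (u j \in A).
    rewrite mulr1; congr (fine (P _)); apply/esym/setIidPr => x [-> _].
    by rewrite inE in uA.
  rewrite mulr0 (_ : A `&` _ = set0) ?measure0//.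
  by apply/seteqP; split=> // x [Ax [xu _]]; move: uA; rewrite notin_setE -xu.
apply: h => [n|]; first exact: measurableI (measurable_atom u n).
exact/trivIset_setIl/trivIset_seqDU.
Qed.

Lemma Mad_complex_charge (P : nat -> {finite_measure set T -> \bar R}) (u : nat -> T) :
  (forall k A, measurable A -> lam A = 0%E -> (forall i, ~ A (u i)) -> P k A = 0%E) ->
  Mad (complex_charge P).
Proof.
move=> Pu.
have dec k : exists f : T -> R, lam.-integrable setT (EFin \o f) /\
    forall A, measurable A -> exists l, fine (P k A) = \int[lam]_(x in A) f x + l /\
      (\sum_(j < n) fine (P k (atom u j)) * \1_A (u j)) @[n --> \oo] --> l.
  by have [f fi fP] := ad_decomposition (Pu k); exists f.
have {dec} [f fP] := boolp.choice dec.
have fi k := (fP k).1.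
pose c k n := fine (P k (atom u n)).
have c0 k n : 0 <= c k n by exact: fine_ge0.
have csum k : exists s, forall n, \sum_(j < n) c k j <= s.
  have h := fine_sigma_additive (M := P k) (measurable_atom u) (@trivIset_seqDU _ _).
  exists (fine (P k (\bigcup_n atom u n))) => n.
  rewrite -(cvg_lim _ h)//; apply: (nondecreasing_cvgn_le _ (cvgP _ h)) => p q pq.
  rewrite -!(big_mkord predT (c k)) [leRHS](@big_cat_nat _ _ _ p)//= lerDl.
  by apply: sumr_ge0.
have [s hs] := boolp.choice csum.
pose a n : R[i] := (c 0%N n - c 2%N n) +i* (c 1%N n - c 3%N n).
pose r n := c 0%N n + c 2%N n + (c 1%N n + c 3%N n).
have ar n : norm1 (a n) <= r n.
  have h (x y : R) : 0 <= x -> 0 <= y -> `|x - y| <= x + y.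
    by move=> x0 y0; rewrite ler_norml; apply/andP; split; lra.
  by rewrite /norm1/= lerD// h.
have rs n : \sum_(j < n) r j <= s 0%N + s 2%N + (s 1%N + s 3%N).
  by rewrite /r !big_split/=; apply: lerD; apply: lerD; exact: hs.
exists (fun x => (f 0%N x - f 2%N x) +i* (f 1%N x - f 3%N x)), a, u.
have fBi k k' : lam.-integrable setT (EFin \o (fun x => f k x - f k' x)).
  rewrite (_ : _ \o _ = (fun x => (f k x)%:E - (f k' x)%:E)%E).
    by apply: integrableB => //; exact: fi.
  by apply/funext => x.
split; first by split; exact: fBi.
- have [j|L /series_to_lim hL] := @series_to_dominated R (fun n => (modulus (a n))%:C) r _ _ rs.
    by rewrite norm1_real ger0_norm ?modulus_ge0// (le_trans (modulus_le_norm1 _)).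
  apply: (cvgP (L : R[i]^o)); apply: cvg_trans hL; apply: near_eq_cvg; near=> n.
  by rewrite /normed_series_of /series/=; apply: eq_bigr => j _; rewrite modulusE.
move=> A mA; have hl k := (fP k).2 A mA.
have [l hl'] := boolp.choice hl.
have lim : limn (series (fun n => a n * (\1_A (u n))%:C : R[i]^o)) =
    (l 0%N - l 2%N) +i* (l 1%N - l 3%N).
  apply/cvg_lim/series_to_lim => //; apply/series_to_cvg; split => /=.
    rewrite (_ : (fun n => _) = (fun n => \sum_(j < n) c 0%N j * \1_A (u j)) -
      (fun n => \sum_(j < n) c 2%N j * \1_A (u j))).
      exact: cvgB (hl' 0%N).2 (hl' 2%N).2.
    by apply/funext => n; rewrite -[RHS]sumrB; apply: eq_bigr => j _; ring.
  rewrite (_ : (fun n => _) = (fun n => \sum_(j < n) c 1%N j * \1_A (u j)) -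
    (fun n => \sum_(j < n) c 3%N j * \1_A (u j))).
    exact: cvgB (hl' 1%N).2 (hl' 3%N).2.
  by apply/funext => n; rewrite -[RHS]sumrB; apply: eq_bigr => j _; ring.
rewrite lim /= /complex_charge_fun; congr EFin.
rewrite (hl' 0%N).1 (hl' 1%N).1 (hl' 2%N).1 (hl' 3%N).1 /complex_integral /=.
have fiA k : lam.-integrable A (EFin \o f k) by exact: integrableS (fi k).
rewrite !RintegralB//.
by apply/eqP; rewrite eq_complex/=; apply/andP; split; apply/eqP; ring.
Unshelve. all: by end_near. Qed.

End ad_decomposition.

(** * Separating the four phases *)

Section phases.
Context {R : realType} {d : nat}.
Local Notation T := (d.-tuple R).
Local Notation Om := (d.-tuple R * nat)%type.

Definition quarter (j : nat) (w : Om) : R := ((w.2 %% 4)%N == j)%:R.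

Lemma measurable_quarter j : measurable_fun setT (quarter j).
Proof.
rewrite (_ : quarter j = \1_((@snd T nat) @^-1` [set k | (k %% 4)%N = j])).
  apply: measurable_indic; rewrite -[X in measurable X]setTI.
  by apply: measurable_snd => //.
apply/funext => w; rewrite /quarter indicE; congr (nat_of_bool _)%:R.
by apply/eqP/idP; rewrite inE.
Qed.

Lemma quarter_le1 j w : `|quarter j w| <= 1.
Proof. by rewrite /quarter; case: (_ == _); rewrite ?normr1 ?normr0. Qed.

Variables (m : {measure set Om -> \bar R}) (moo : (m setT < +oo)%E).

Lemma quarter_integrable j : (finite_copy moo).-integrable setT (EFin \o quarter j).
Proof. exact: (bounded_integrable (m := finite_copy moo) moo (measurable_quarter j) (quarter_le1 j)). Qed.

(** The marginal on R^d of the part of m whose phase is i^j. *)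
Definition phase_measure j : {measure set T -> \bar R} :=
  push_measure (density_measure (finite_copy moo) (measurable_quarter j)) measurable_fst.

Lemma phase_measure_finite j : (phase_measure j setT < +oo)%E.
Proof.
rewrite [X in (X < _)%E]/(density_measure (finite_copy moo) (measurable_quarter j) (_ @^-1` setT)).
by rewrite preimage_setT; exact: (density_finite (measurable_quarter j) (quarter_integrable j)).
Qed.

Lemma phase_measure_null j A : measurable A -> m (A `*` setT) = 0%E -> phase_measure j A = 0%E.
Proof.
move=> mA A0.
rewrite -[LHS]/(density_measure (finite_copy moo) (measurable_quarter j) (_ @^-1` A)).
rewrite (_ : _ @^-1` _ = A `*` setT); last first.
  by apply/seteqP; split=> x /=; [|move=> []].
have /null_content_dominatesP := @density_dominates R _ _ (finite_copy moo) _ (measurable_quarter j).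
by apply => //; exact: measurableX.
Qed.

Lemma phase_integral j (phi : T -> R) (C : R) : measurable_fun setT phi ->
  (forall x, `|phi x| <= C) ->
  \int[phase_measure j]_x phi x = \int[m]_w (phi w.1 * quarter j w).
Proof.
move=> mphi phiC.
have oo := density_finite (measurable_quarter j) (quarter_integrable j).
rewrite (Rintegral_push _ oo mphi phiC).
rewrite (Rintegral_density _ (quarter_integrable j) (measurableT_comp mphi measurable_fst) (fun w => phiC w.1)).
by apply: eq_Rintegral => w _; rewrite /quarter /=; case: (_ == _); rewrite ?normr1 ?normr0.
Qed.

Lemma ft_phases y : ft m y =
  (transform (phase_measure 0) y - transform (phase_measure 2) y) +
  'i * (transform (phase_measure 1) y - transform (phase_measure 3) y).
Proof.
have th w : exists q : nat, angle y w =
    angle y (w.1, 0%N) + (w.2 %% 4)%:R * (pi / 2) + q%:R * (2 * pi).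
  exists (w.2 %/ 4)%N; rewrite /angle /= mul0r sub0r {1}(divn_eq w.2 4) natrD natrM.
  by field.
(* Real and imaginary part of i^j (cos t + i sin t) with j = n mod 4 and t the angle without phase:
   exactly one of the four [quarter] factors is 1. *)
have tr w : cos (angle y w) =
      cos (angle y (w.1, 0%N)) * quarter 0 w - sin (angle y (w.1, 0%N)) * quarter 1 w
      - cos (angle y (w.1, 0%N)) * quarter 2 w + sin (angle y (w.1, 0%N)) * quarter 3 w /\
    sin (angle y w) =
      sin (angle y (w.1, 0%N)) * quarter 0 w + cos (angle y (w.1, 0%N)) * quarter 1 w
      - sin (angle y (w.1, 0%N)) * quarter 2 w - cos (angle y (w.1, 0%N)) * quarter 3 w.
  have [q ->] := th w; rewrite cos_D2pin sin_D2pin; set t := angle y (w.1, 0%N).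
  have : (w.2 %% 4 < 4)%N by rewrite ltn_mod.
  rewrite /quarter; case: (w.2 %% 4)%N => [|[|[|[|//]]]] _ /=.
  - by rewrite mul0r addr0; split; ring.
  - by rewrite mul1r cosD sinD cos_pihalf sin_pihalf; split; ring.
  - have -> : t + 2 * (pi / 2) = t + pi by field.
    by rewrite cosDpi sinDpi; split; ring.
  - have -> : t + 3 * (pi / 2) = t + pi + pi / 2 by field.
    by rewrite (cosD (t + pi)) (sinD (t + pi)) cos_pihalf sin_pihalf cosDpi sinDpi; split; ring.
have mc := measurable_cos_phase0 y; have ms := measurable_sin_phase0 y.
have bi (phi : T -> R) j : measurable_fun setT phi -> (forall x, `|phi x| <= 1) ->
    m.-integrable setT (EFin \o (fun w : Om => phi w.1 * quarter j w)).
  move=> mphi phi1; apply: (bounded_integrable moo (C := 1)).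
    by apply: measurable_funM; [exact: (measurableT_comp mphi measurable_fst)|exact: measurable_quarter].
  by move=> w; rewrite normrM mulr_ile1 ?quarter_le1.
have ci j := bi _ j mc (fun x => cos_max _).
have si j := bi _ j ms (fun x => sin_max _).
have [c pc] : exists c : nat -> R, forall j,
    \int[phase_measure j]_x cos (angle y (x, 0%N)) = c j by eexists.
have [s ps] : exists s : nat -> R, forall j,
    \int[phase_measure j]_x sin (angle y (x, 0%N)) = s j by eexists.
have qc j : \int[m]_w (cos (angle y (w.1, 0%N)) * quarter j w) = c j.
  by rewrite -pc; exact: esym (phase_integral j mc (fun x => cos_max _)).
have qs j : \int[m]_w (sin (angle y (w.1, 0%N)) * quarter j w) = s j.
  by rewrite -ps; exact: esym (phase_integral j ms (fun x => sin_max _)).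
have addi (f g : Om -> R) : m.-integrable setT (EFin \o f) -> m.-integrable setT (EFin \o g) ->
    m.-integrable setT (EFin \o (fun w => f w + g w)).
  move=> fi gi; rewrite (_ : _ \o _ = (fun x => (f x)%:E + (g x)%:E)%E).
    by apply: integrableD.
  by apply/funext => x.
have subi (f g : Om -> R) : m.-integrable setT (EFin \o f) -> m.-integrable setT (EFin \o g) ->
    m.-integrable setT (EFin \o (fun w => f w - g w)).
  move=> fi gi; rewrite (_ : _ \o _ = (fun x => (f x)%:E - (g x)%:E)%E).
    by apply: integrableB.
  by apply/funext => x.
apply/eqP; rewrite eq_complex/= /transform /complex_integral /=; apply/andP; split; apply/eqP.
  rewrite (eq_Rintegral _ (fun w _ => (tr w).1)).
  rewrite (RintegralD measurableT (subi _ _ (subi _ _ (ci 0%N) (si 1%N)) (ci 2%N)) (si 3%N)).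
  rewrite (RintegralB measurableT (subi _ _ (ci 0%N) (si 1%N)) (ci 2%N)).
  rewrite (RintegralB measurableT (ci 0%N) (si 1%N)).
  rewrite (qc 0%N) (qs 1%N) (qc 2%N) (qs 3%N) !pc !ps; ring.
rewrite (eq_Rintegral _ (fun w _ => (tr w).2)).
rewrite (RintegralB measurableT (subi _ _ (addi _ _ (si 0%N) (ci 1%N)) (si 2%N)) (ci 3%N)).
rewrite (RintegralB measurableT (addi _ _ (si 0%N) (ci 1%N)) (si 2%N)).
rewrite (RintegralD measurableT (si 0%N) (ci 1%N)).
rewrite (qs 0%N) (qc 1%N) (qs 2%N) (qc 3%N) !pc !ps; ring.
Qed.

End phases.

(** The way back from the algebra to complex measures: the four phase measures combine into a
    complex measure with the transform G, and each inherits the null-set condition of m with the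
    same points u, because it is dominated by the marginal of m. *)
Lemma ad_norm_fourier {R : realType} {d : nat} (G : d.-tuple R -> R[i]) (r : R) :
  ad_norm G r -> exists nu : {charge set (d.-tuple R) -> \bar R[i]},
    Mad nu /\ forall y, fourier nu y = G y.
Proof.
move=> [m [mr [u hu] Gm]].
have moo : (m setT < +oo)%E by rewrite (le_lt_trans mr)// ltry.
pose P k := finite_copy (phase_measure_finite moo k).
exists (complex_charge P); split.
  apply: (@Mad_complex_charge _ _ _ u) => k A mA A0 Au.
  exact: phase_measure_null (hu A mA A0 Au).
move=> y; rewrite Gm (ft_phases moo) fourierE.
have oo k := phase_measure_finite moo k.
have diff (nu : {charge set (d.-tuple R) -> \bar R}) j k :
    (forall A, measurable A -> fine (nu A) = fine (P j A) - fine (P k A)) ->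
    charge_integral nu (fun x => wave y (x, 0%N)) =
    transform (phase_measure moo j) y - transform (phase_measure moo k) y.
  move=> h; exact: (charge_integral_diff (phi := fun x => wave y (x, 0%N)) (oo j) (oo k) h
    (measurable_cos_phase0 y) (measurable_sin_phase0 y)
    (fun x => cos_max _) (fun x => sin_max _)).
by rewrite (diff (re_charge _) 0%N 2%N)// (diff (im_charge _) 1%N 3%N).
Qed.

Theorem theorem4 (R : realType) (d : nat) (hd : (0 < d)%N)
    (mu : {charge set (d.-tuple R) -> \bar R[i]})
    (K : set R[i]^o) (h : R[i] -> R[i]) :
  Mad mu ->
  compact K ->
  (exists V : set R[i]^o, [/\ open V, K `<=` V & real_analytic_on V h]) ->
  exists nu : {charge set (d.-tuple R) -> \bar R[i]},
    Mad nu /\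
    forall y : d.-tuple R, K (fourier mu y) -> fourier nu y = h (fourier mu y).
Proof.
move=> mumad cK hV.
have [G [s [NG Gh]]] := functional_calculus (@ad_norm_algebra R d)
  (localizable_fourier mumad) cK hV.
have [nu [numad nuG]] := ad_norm_fourier NG.
by exists nu; split=> // y Ky; rewrite nuG; exact: Gh.
Qed.
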